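(* Let $p\in(1,\infty)$, let $X$ be a Banach space, let $A:D(A)\subseteq X\to X$ be a closed, densely defined linear operator having the property of maximal $L^p$-regularity, let $X_p=(X,D(A))_{1-1/p,p}$, and let $t_0\ge0$. For every integer $n\ge0$ consider a function $f_n:[0,\infty)\times X_p\to X$ such that (I.a) $f_0(t,x)=f(x)$, where $f:X_p\to X$ is Lipschitz on bounded subsets of $X_p$; (I.b) for $n\ge1$, $$f_n(t,x)=f(x)+n^{\rho/p}g(nt),$$ where $\rho\in(0,1)$ and $g\in L^p_{\mathrm{loc}}(0,\infty;X)$ satisfies: for all $T>0$, $$\left(\frac{1}{nT}\right)^{1-\rho}\int_{nt_0}^{nt_0+nT}\|g(s)\|_X^p\,ds\to0\qquad\text{as } n\to\infty.$$ Let $(u_0^n)_{n\ge0}\subset X_p$ be such that (II.a) $\|u_0^n-u_0^0\|_{X_p}\to0$ as $n\to\infty$, and for $n\ge0$ let $\phi_n$ be the solution of $$\frac{d\phi_n(t)}{dt}+A\phi_n(t)=f_n(t,\phi_n(t)),\quad t>t_0,\qquad\phi_n(t_0)=u_0^n,$$ defined on its maximal interval of existence $[t_0,t_0+T_n)$. Then $T_n\in(0,\infty]$, $$T_0\le\limsup_{n\to\infty}T_n,$$ and the sequence $(\phi_n)_{n\ge1}$ converges to $\phi_0$ in the following sense: for every compact sub-interval $K\subset[t_0,t_0+T_0)$, (a) $\displaystyle\sup_{t\in K}\|\phi_n(t)-\phi_0(t)\|_{X_p}\to0$ as $n\to\infty$, and (b) $\displaystyle\|\phi_n-\phi_0\|_{W^{1,p}(K;X)\cap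 L^p(K;D(A))}\to0$ as $n\to\infty$.
   Context: Function spaces: for an interval $I\subset\mathbb{R}$ and a Banach space $Y$, $L^p(I;Y)$ is the Bochner space of strongly measurable $f:I\to Y$ with $\int_I\|f(t)\|_Y^p\,dt<\infty$, and $W^{1,p}(I;Y)$ is the space of $f\in L^p(I;Y)$ with weak derivative $\partial_tf\in L^p(I;Y)$, normed by $\sum_{\ell=0}^1\big(\int_I\|\partial_t^\ell f\|_Y^p\,dt\big)^{1/p}$. $L^p_{\mathrm{loc}}(I;Y)$ consists of all $f:I\to Y$ belonging to $L^p(K;Y)$ for every compact sub-interval $K\subset I$. The norm on an intersection is $\|f\|_{W^{1,p}(I;X)\cap L^p(I;Y)}=\|f\|_{L^p(I;Y)}+\|f\|_{W^{1,p}(I;X)}$. $D(A)$ carries the graph norm. Space of initial data: $X_p:=(X,D(A))_{1-1/p,p}$ is the real interpolation space; its norm can be expressed (up to equivalence) as $\|f\|_{X_p}=\inf\{\|F\|_{W^{1,p}(0,\infty;X)\cap L^p(0,\infty;D(A))}: f=F(0)\}$. Maximal regularity: for $0<T\le\infty$ and $I=[t_0,t_0+T)$, $A$ has the property of maximal $L^p$-regularity on $[t_0,t_0+T)$ if there is a constant $C=C(T)>0$ such that for every $f\in L^p(I;X)$ and $u_0\in X_p$ there is a unique $u\in L^p(I;D(A))\cap W^{1,p}(I;X)$ satisfying $\frac{du}{dt}+Au=f(t)$ for almost every $t\in I$ and $u(t_0)=u_0$, and moreover $\|u\|_{W^{1,p}(I;X)\cap L^p(I;D(A))}\le C(T)(\|u_0\|_{X_p}+\|f\|_{L^p(I;X)})$.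 The constant $C$ can be chosen to be a non-decreasing function of $T$. When no interval is mentioned, the property is meant on $[t_0,t_0+T)$ for every finite $T>0$. Solutions are strong solutions: a solution on $[t_0,t_0+T_n)$ is a function lying in $W^{1,p}(J;X)\cap L^p(J;D(A))$ for every compact interval $J=[t_0,t_0+T']$ with $0<T'<T_n$ (hence continuous with values in $X_p$), satisfying the equation for almost every $t$ and the initial condition. $[t_0,t_0+T_n)$ is maximal if the solution cannot be extended to a solution on a larger interval. The convergence statements on $K$ are understood for all $n$ large enough; in particular they include that $\phi_n$ is defined on $K$ (i.e. $K\subset[t_0,t_0+T_n)$) for all sufficiently large $n$. *)

(* Defs.v *)
From HB Require Import structures.
From mathcomp Require Import all_boot all_order all_algebra.
From mathcomp Require Import all_classical all_reals all_analysis.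

Set Implicit Arguments.
Unset Strict Implicit.
Unset Printing Implicit Defensive.

Import Order.TTheory GRing.Theory Num.Theory.
Import numFieldNormedType.Exports.

Local Open Scope classical_set_scope.
Local Open Scope ring_scope.

(* Functions of time are total functions R -> X, of which only the values on
   the interval under consideration matter.  Elements of L^p and W^{1,p} are
   handled through representatives. *)

(* A linear operator D(A) -> X; the values of [op] outside [dom] are
   irrelevant. *)
Record linear_operator (R : realType) (X : completeNormedModType R) :=
  LinearOperator {
    dom : set X;
    op :> X -> X;
    dom0 : dom 0;
    dom_lin : forall (a : R) (x y : X), dom x -> dom y -> dom (a *: x + y);
    op_lin : forall (a : R) (x y : X), dom x -> dom y ->
      op (a *: x + y) = a *: op x + op y
  }.

Definition closed_operator (R : realType) (X : completeNormedModType R)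
    (A : linear_operator X) : Prop :=
  closed [set z : X * X | dom A z.1 /\ z.2 = A z.1].

Definition densely_defined (R : realType) (X : completeNormedModType R)
    (A : linear_operator X) : Prop :=
  closure (dom A) = setT.

(* A subspace of X with a norm of its own.  Only the data are recorded: the two
   instances in use are X itself and D(A) with the graph norm. *)
Record normed_subspace (R : realType) (X : completeNormedModType R) :=
  NormedSubspace { carrier : set X; ns_norm : X -> R }.

Definition whole_space (R : realType) (X : completeNormedModType R) :
    normed_subspace X :=
  NormedSubspace setT (fun x : X => `|x|).

Definition graph_space (R : realType) (X : completeNormedModType R)
    (A : linear_operator X) : normed_subspace X :=
  NormedSubspace (dom A) (fun x : X => `|x| + `|A x|).

(* Bochner spaces *)

Definition simple_function (R : realType) (X : completeNormedModType R)
    (s : R -> X) : Prop :=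
  finite_set (range s) /\ forall y : X, measurable (s @^-1` [set y]).

(* The value y = 0 contributes 0 even when its level set has infinite measure,
   since [fine +oo = 0]. *)
Definition simple_integral (R : realType) (X : completeNormedModType R)
    (I : set R) (s : R -> X) : X :=
  \sum_(y \in range s) fine (lebesgue_measure (I `&` s @^-1` [set y])) *: y.

Definition strongly_measurable (R : realType) (X : completeNormedModType R)
    (Y : normed_subspace X) (I : set R) (f : R -> X) : Prop :=
  exists s : nat -> R -> X,
    (forall k, simple_function (s k) /\ forall t, carrier Y (s k t)) /\
    {ae lebesgue_measure, forall t, I t ->
       carrier Y (f t) /\
       (fun k => ns_norm Y (s k t - f t)) @ \oo --> (0 : R)}.

(* f is Bochner integrable on I with values in X, and its integral is y. *)
Definition is_bochner_integral (R : realType) (X : completeNormedModType R)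
    (I : set R) (f : R -> X) (y : X) : Prop :=
  exists s : nat -> R -> X,
    [/\ forall k, simple_function (s k) /\
          forall z, z != 0 ->
            (lebesgue_measure (I `&` s k @^-1` [set z]) < +oo)%E,
        {ae lebesgue_measure, forall t, I t -> (fun k => s k t) @ \oo --> f t},
        (fun k => \int[lebesgue_measure]_(t in I) (`|f t - s k t|%:E))%E @ \oo
          --> 0%E
      & (fun k => simple_integral I (s k)) @ \oo --> y].

Definition Lp_norm (R : realType) (X : completeNormedModType R) (p : R)
    (I : set R) (Y : normed_subspace X) (f : R -> X) : \bar R :=
  ((\int[lebesgue_measure]_(t in I) (ns_norm Y (f t) `^ p)%:E) `^ p^-1)%E.

Definition Lp_mem (R : realType) (X : completeNormedModType R) (p : R)
    (I : set R) (Y : normed_subspace X) (f : R -> X) : Prop :=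
  strongly_measurable Y I f /\
  (\int[lebesgue_measure]_(t in I) (ns_norm Y (f t) `^ p)%:E < +oo)%E.

(* phi belongs to C_c^oo(int I; R). *)
Definition test_function (R : realType) (I : set R) (phi : R -> R) : Prop :=
  (forall (k : nat) (t : R), derivable (derive1n k phi) t 1) /\
  exists a b : R, `[a, b] `<=` interior I /\
    forall t, ~ `[a, b]%classic t -> phi t = 0.

Definition is_weak_derivative (R : realType) (X : completeNormedModType R)
    (I : set R) (u v : R -> X) : Prop :=
  forall phi : R -> R, test_function I phi -> exists y : X,
    is_bochner_integral I (fun t => derive1 phi t *: u t) y /\
    is_bochner_integral I (fun t => phi t *: v t) (- y).

(* A representative of the weak derivative of u on I, if there is one. *)
Definition weak_derivative (R : realType) (X : completeNormedModType R)
    (I : set R) (u : R -> X) : R -> X :=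
  xget (fun=> 0) [set v | is_weak_derivative I u v].

Definition W1p_mem (R : realType) (X : completeNormedModType R) (p : R)
    (I : set R) (u : R -> X) : Prop :=
  Lp_mem p I (whole_space X) u /\
  exists v : R -> X,
    is_weak_derivative I u v /\ Lp_mem p I (whole_space X) v.

Definition W1p_norm (R : realType) (X : completeNormedModType R) (p : R)
    (I : set R) (u : R -> X) : \bar R :=
  (Lp_norm p I (whole_space X) u +
   Lp_norm p I (whole_space X) (weak_derivative I u))%E.

(* The space W^{1,p}(I;X) \cap L^p(I;D(A)). *)
Definition MR_mem (R : realType) (X : completeNormedModType R)
    (A : linear_operator X) (p : R) (I : set R) (u : R -> X) : Prop :=
  W1p_mem p I u /\ Lp_mem p I (graph_space A) u.

Definition MR_norm (R : realType) (X : completeNormedModType R)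
    (A : linear_operator X) (p : R) (I : set R) (u : R -> X) : \bar R :=
  (Lp_norm p I (graph_space A) u + W1p_norm p I u)%E.

(* Real interpolation (K-method) *)

Definition K_functional (R : realType) (X : completeNormedModType R)
    (Y : normed_subspace X) (t : R) (x : X) : R :=
  inf [set r | exists a b : X,
    [/\ carrier Y b, x = a + b & r = `|a| + t * ns_norm Y b]].

(* The norm of (X, Y)_{theta, q}, equal to +oo outside that space. *)
Definition interp_norm (R : realType) (X : completeNormedModType R)
    (Y : normed_subspace X) (theta q : R) (x : X) : \bar R :=
  ((\int[lebesgue_measure]_(t in `]0%R, +oo[)
      ((t `^ (- theta) * K_functional Y t x) `^ q / t)%:E) `^ q^-1)%E.

Definition Xp_norm (R : realType) (X : completeNormedModType R)
    (A : linear_operator X) (p : R) (x : X) : \bar R :=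
  interp_norm (graph_space A) (1 - p^-1) p x.

Definition Xp (R : realType) (X : completeNormedModType R)
    (A : linear_operator X) (p : R) : set X :=
  [set x | (Xp_norm A p x < +oo)%E].

(* Strong solutions and maximal regularity *)

(* [t0, t0 + T[, with T possibly +oo *)
Definition time_interval (R : realType) (t0 : R) (T : \bar R) : set R :=
  [set t | t0 <= t /\ (t%:E < t0%:E + T)%E].

(* u' + A u = h a.e. on I and u(t0) = u0.  Among the representatives of an
   element of W^{1,p}(I;X), u is required to be the continuous one, so that
   its pointwise values are meaningful. *)
Definition linear_solution (R : realType) (X : completeNormedModType R)
    (A : linear_operator X) (p : R) (I : set R) (t0 : R) (h : R -> X) (u0 : X)
    (u : R -> X) : Prop :=
  [/\ {within I, continuous u},
      MR_mem A p I u,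
      {ae lebesgue_measure, forall t, I t ->
         weak_derivative I u t + A (u t) = h t}
    & u t0 = u0].

Definition maximal_regularity_on (R : realType) (X : completeNormedModType R)
    (A : linear_operator X) (p t0 : R) (T : \bar R) : Prop :=
  let I := time_interval t0 T in
  exists2 C : R, 0 < C &
    forall (h : R -> X) (u0 : X),
      Lp_mem p I (whole_space X) h -> Xp A p u0 ->
      exists u : R -> X,
        [/\ linear_solution A p I t0 h u0 u,
            forall v : R -> X, linear_solution A p I t0 h u0 v ->
              forall t, I t -> v t = u t
          & (MR_norm A p I u <=
               C%:E * (Xp_norm A p u0 + Lp_norm p I (whole_space X) h))%E].

Definition maximal_regularity (R : realType) (X : completeNormedModType R)
    (A : linear_operator X) (p t0 : R) : Prop :=
  forall T : R, 0 < T -> maximal_regularity_on A p t0 T%:E.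

(* u is a strong solution of u' + A u = F(t, u), u(t0) = u0 on [t0, t0 + T[. *)
Definition strong_solution (R : realType) (X : completeNormedModType R)
    (A : linear_operator X) (p t0 : R) (T : \bar R) (F : R -> X -> X) (u0 : X)
    (u : R -> X) : Prop :=
  forall T' : R, 0 < T' -> (T'%:E < T)%E ->
    linear_solution A p `[t0, t0 + T'] t0 (fun t => F t (u t)) u0 u.

(* The degenerate case T = 0 (empty interval) is allowed: it is maximal exactly
   when there is no solution on any [t0, t0 + T'[ with T' > 0.  Thus
   positivity of a maximal existence time is local existence. *)
Definition maximal_solution (R : realType) (X : completeNormedModType R)
    (A : linear_operator X) (p t0 : R) (T : \bar R) (F : R -> X -> X) (u0 : X)
    (u : R -> X) : Prop :=
  [/\ (0 <= T)%E,
      strong_solution A p t0 T F u0 u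
    & forall (T' : \bar R) (v : R -> X), (T < T')%E ->
        strong_solution A p t0 T' F u0 v ->
        ~ (forall t, time_interval t0 T t -> v t = u t)].

Definition lipschitz_on_bounded_subsets (R : realType)
    (X : completeNormedModType R) (A : linear_operator X) (p : R) (f : X -> X) :
    Prop :=
  forall B : set X, B `<=` Xp A p ->
    (exists r : R, forall x, B x -> (Xp_norm A p x <= r%:E)%E) ->
    exists2 L : R, 0 <= L & forall x y, B x -> B y ->
      ((`|f x - f y|)%:E <= L%:E * Xp_norm A p (x - y)%R)%E.

(* L^p_loc(]0, +oo[; X) *)
Definition Lploc_mem (R : realType) (X : completeNormedModType R) (p : R)
    (g : R -> X) : Prop :=
  forall a b : R, 0 < a -> a <= b -> Lp_mem p `[a, b] (whole_space X) g.

(* Main.v *)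
Require Import Defs.
From HB Require Import structures.
From mathcomp Require Import all_boot all_order all_algebra.
From mathcomp Require Import finmap.
From mathcomp Require Import all_classical all_reals all_analysis.
From mathcomp Require Import measurable_realfun.
From mathcomp Require Import lra ring.

Set Implicit Arguments.
Unset Strict Implicit.
Unset Printing Implicit Defensive.

Import Order.TTheory GRing.Theory Num.Theory.
Import numFieldNormedType.Exports.

Local Open Scope classical_set_scope.
Local Open Scope ring_scope.

(** The substitution [s = n t] turns the decay hypothesis on [g] into the statement
    that the forcing terms [t |-> n^(rho/p) g(n t)] tend to 0 in L^p(t0, t0 + S; X)
    for every [S] ([oscillating_forcing_cvg0]). Hence [phi n] solves a problem
    [u' + A u = f(u) + G] whose initial value and forcing [G] are small perturbations
    of those of [phi 0], and the theorem says that this problem is stable.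

    Linear part. Maximal regularity bounds a solution [u] in W^{1,p} with values in
    X and in L^p with values in D(A); a bound of [u tau] in X_p follows from the
    trace inequality ([Xp_norm_MR]). Averaging the decomposition
    [u tau = (u tau - u s) + u s] over [s] in [(tau, tau + t)] bounds the K-functional
    of [u tau] at [t] by the integral of [|u'| + |u| + |A u|] over that interval, and
    Hardy's inequality turns such a bound into an estimate of the interpolation norm.
    The same argument on short intervals gives continuity in X_p
    ([Xp_norm_increment]). It rests on two facts about weak derivatives: increments
    are bounded by integrals of the weak derivative ([weak_derivative_increment]), which
    comes from testing with primitives of differences of mollifiers; and weak
    derivatives are unique almost everywhere ([weak_derivative_unique]), by Lebesgue
    differentiation. Since a solution up to time [t] only depends on the forcing up to
    time [t], extending the forcing by zero yields constants that are uniform over all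
    subintervals of a given [[t0, t0 + S]] ([linear_solution_bounds]).

    Nonlinear part. Let [c] be a function that solves the problem up to an error of
    size [eta] in initial value and forcing. Measure
    forcing terms by the supremum of [exp(- l (t - t0)) |h t|_X] and solutions by that
    of [exp(- l (t - t0)) |u t|_(X_p)]. For large [l] the solution operator of the linear
    problem is then as small as desired ([linear_solution_weighted]), so that the iteration
    [v |-> solution with forcing f(v) + G], started at [c], contracts and stays within
    [2 eta exp(l (t - t0))] of [c]. If [eta] is small this is at most 1 up to time [S]:
    the iteration never leaves a bounded set, on which [f] is Lipschitz. The forcing
    terms [f(v)] converge uniformly in X and the solution for their limit is the fixed
    point. This gives at once existence on the whole interval on which [c] lives and
    closeness to [c] ([semilinear_near]).

    With [c = phi 0] on [[t0, t0 + S]] and [S < T 0], one obtains for large [n] a solution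
    on [[t0, t0 + S]] that is close to [phi 0]. It agrees with [phi n] on the common
    interval of existence ([semilinear_unique]), and would extend [phi n] if [T n < S];
    thus [S <= T n] and both convergence statements hold. With [c] the solution of the
    linear problem with forcing [G], on a short interval, the same result gives local
    existence, that is [0 < T n]. *)

(** * Lower integrals of nonnegative functions *)

Section lower_integral.
Variable R : realType.
Local Notation mu := (@lebesgue_measure R).
Implicit Types (D E : set R) (f g : R -> R) (p k : R).

(** The integral of a nonnegative function, which need not be measurable: as a
    supremum over simple functions it is still monotone, so that estimates of norms
    require measurability only where integrals are added. *)
Definition lint D f : \bar R := (\int[mu]_(t in D) (f t)%:E)%E.

(** Norms of strongly measurable functions are of this kind; it suffices for the
    integral to be additive. *)
Definition aem D f :=
  exists2 g : R -> R, measurable_fun setT g & {ae mu, forall t, D t -> f t = g t}.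

Lemma lint_ge0 D f : (forall t, 0 <= f t) -> (0 <= lint D f)%E.
Proof. by move=> f0; apply: integral_ge0 => t _; rewrite lee_fin. Qed.

Import HBNNSimple.

Lemma nonneg_integralE f D : (forall t, 0 <= f t) ->
  lint D f = ereal_sup [set sintegral mu h |
    h in [set h : {nnsfun (measurableTypeR R) >-> R} | forall x, (h x)%:E <= ((EFin \o f) \_ D) x]]%E.
Proof.
move=> f0; rewrite /lint [LHS]integral_mkcond ge0_integralTE; last first.
  by move=> x; rewrite patchE; case: ifP => // _; rewrite lee_fin.
by [].
Qed.

(** A simple function below [f], cut off on the exceptional null set, lies below [g]
    and has the same integral. *)
Lemma lint_le_ae D E f g : (forall t, 0 <= f t) -> (forall t, 0 <= g t) ->
  {ae mu, forall t, D t -> E t /\ f t <= g t} -> (lint D f <= lint E g)%E.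
Proof.
move=> f0 g0 [N [mN N0 subN]].
rewrite nonneg_integralE// nonneg_integralE//.
apply: ge_ereal_sup => _ [h /= hf <-].
have mNc : measurable (~` N) by exact: measurableC.
apply: (@le_trans _ _ (sintegral mu (proj_nnsfun h mNc))).
  rewrite -!integralT_nnsfun.
  have -> : (\int[mu]_x (h x)%:E = \int[mu]_x (proj_nnsfun h mNc x)%:E)%E; last by [].
  apply: ge0_ae_eq_integral => //.
  - exact/measurable_EFinP.
  - exact/measurable_EFinP.
  - by move=> x _; rewrite lee_fin.
  - by move=> x _; rewrite lee_fin.
  exists N; split => // x /= hx; apply: contrapT => Nx; apply: hx => _.
  by rewrite mindicE mem_set ?mulr1.
apply: ereal_sup_ubound; exists (proj_nnsfun h mNc) => // x /=.
rewrite mindicE; have [xN|xN] := boolP (x \in ~` N); last first.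
  by rewrite mulr0 patchE; case: ifP => // _ /=; rewrite lee_fin.
rewrite mulr1 (le_trans (hf x))// !patchE.
case: ifPn => xD; last by case: ifP => //= _; rewrite lee_fin.
have [] : D x -> E x /\ f x <= g x.
  by apply: contrapT => /subN; move: xN; rewrite inE.
- by rewrite inE in xD.
- by move=> xE fg; rewrite mem_set//= lee_fin.
Qed.

Lemma aeS (P Q : R -> Prop) : (forall t, P t -> Q t) ->
  {ae mu, forall t, P t} -> {ae mu, forall t, Q t}.
Proof.
move=> PQ [N [mN N0 sN]]; exists N; split => // t /= nQ; apply: sN => /= Pt.
by apply: nQ; exact: PQ.
Qed.

Lemma aeI (P Q : R -> Prop) : {ae mu, forall t, P t} -> {ae mu, forall t, Q t} ->
  {ae mu, forall t, P t /\ Q t}.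
Proof.
move=> hP hQ; apply: (negligibleS _ (negligibleU hP hQ)) => t /= nPQ.
have [Pt|] := pselect (P t); last by left.
by have [Qt|] := pselect (Q t); [exfalso; exact: nPQ|right].
Qed.

Lemma aeT (P : R -> Prop) : (forall t, P t) -> {ae mu, forall t, P t}.
Proof.
by move=> PT; exists set0; split => //= t; apply; exact: PT.
Qed.

Lemma aeS2 (P Q S : R -> Prop) : (forall t, P t -> Q t -> S t) ->
  {ae mu, forall t, P t} -> {ae mu, forall t, Q t} -> {ae mu, forall t, S t}.
Proof. by move=> H P1 Q1; apply: aeS (aeI P1 Q1) => t []; exact: H. Qed.

Lemma lint_le D E f g : (forall t, 0 <= f t) -> (forall t, 0 <= g t) ->
  D `<=` E -> (forall t, D t -> f t <= g t) -> (lint D f <= lint E g)%E.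
Proof.
move=> f0 g0 DE fg; apply: lint_le_ae => //; apply: aeT => t Dt.
by split; [exact: DE|exact: fg].
Qed.

Lemma lint_eq_ae D f g : (forall t, 0 <= f t) -> (forall t, 0 <= g t) ->
  {ae mu, forall t, D t -> f t = g t} -> lint D f = lint D g.
Proof.
move=> f0 g0 fg; apply/eqP; rewrite eq_le; apply/andP; split;
  apply: lint_le_ae => //; apply: aeS fg => t fg Dt; split => //;
  by rewrite fg.
Qed.

(** * Functions equal almost everywhere to a Borel function *)

Lemma aem_measurable D f : measurable_fun setT f -> aem D f.
Proof. by move=> mf; exists f => //; exact: aeT. Qed.

Lemma aem_sub D E f : D `<=` E -> aem E f -> aem D f.
Proof. by move=> DE [g mg fg]; exists g => //; apply: aeS fg => t fg /DE. Qed.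

Lemma aem_eq D f g : {ae mu, forall t, D t -> f t = g t} -> aem D g -> aem D f.
Proof.
move=> fg [h mh gh]; exists h => //.
by apply: aeS2 fg gh => t fg gh Dt; rewrite fg// gh.
Qed.

Lemma aem_comp D f (k : R -> R) : measurable_fun setT k -> aem D f -> aem D (k \o f).
Proof.
move=> mk [g mg fg]; exists (k \o g); first exact: measurableT_comp.
by apply: aeS fg => t fg Dt /=; rewrite fg.
Qed.

Lemma aemD D f g : aem D f -> aem D g -> aem D (fun t => f t + g t).
Proof.
move=> [f' mf ff'] [g' mg gg']; exists (fun t => f' t + g' t).
  exact: measurable_funD.
by apply: aeS2 ff' gg' => t ff' gg' Dt; rewrite ff'// gg'.
Qed.

Lemma aemM D f g : aem D f -> aem D g -> aem D (fun t => f t * g t).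
Proof.
move=> [f' mf ff'] [g' mg gg']; exists (fun t => f' t * g' t).
  exact: measurable_funM.
by apply: aeS2 ff' gg' => t ff' gg' Dt; rewrite ff'// gg'.
Qed.

Lemma aemZ D k f : aem D f -> aem D (fun t => k * f t).
Proof. by move=> mf; apply: aemM mf; apply: aem_measurable. Qed.

Lemma aem_powR D p f : aem D f -> aem D (fun t => f t `^ p).
Proof. by move=> mf; apply: (aem_comp (k := @powR R ^~ p)) mf; exact: measurable_powR. Qed.

Lemma aem_ge0 D f : (forall t, 0 <= f t) -> aem D f ->
  exists g : R -> R, [/\ measurable_fun setT g, forall t, 0 <= g t &
    {ae mu, forall t, D t -> f t = g t}].
Proof.
move=> f0 [g mg fg]; exists (fun t => `|g t|); split => //.
  exact: measurableT_comp.
by apply: aeS fg => t fg Dt; rewrite -fg// ger0_norm.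
Qed.

Lemma lintD D f g : measurable D -> (forall t, 0 <= f t) -> (forall t, 0 <= g t) ->
  aem D f -> aem D g -> lint D (fun t => f t + g t) = (lint D f + lint D g)%E.
Proof.
move=> mD f0 g0 /(aem_ge0 f0)[f' [mf f'0 ff']] /(aem_ge0 g0)[g' [mg g'0 gg']].
rewrite (lint_eq_ae f0 f'0 ff') (lint_eq_ae g0 g'0 gg').
rewrite (@lint_eq_ae _ _ (fun t => f' t + g' t)); last first.
- by apply: aeS2 ff' gg' => t ff' gg' Dt; rewrite ff'// gg'.
- by move=> t; rewrite addr_ge0.
- by move=> t; rewrite addr_ge0.
rewrite /lint -ge0_integralD//.
- by move=> x _; rewrite lee_fin.
- apply/measurable_EFinP; exact: measurable_funS mf.
- by move=> x _; rewrite lee_fin.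
- apply/measurable_EFinP; exact: measurable_funS mg.
Qed.

Lemma lintZ D k f : measurable D -> 0 <= k -> (forall t, 0 <= f t) ->
  aem D f -> lint D (fun t => k * f t) = (k%:E * lint D f)%E.
Proof.
move=> mD k0 f0 /(aem_ge0 f0)[f' [mf f'0 ff']].
rewrite (lint_eq_ae f0 f'0 ff').
rewrite (@lint_eq_ae _ _ (fun t => k * f' t)); last first.
- by apply: aeS ff' => t ff' Dt; rewrite ff'.
- by move=> t; rewrite mulr_ge0.
- by move=> t; rewrite mulr_ge0.
rewrite /lint -ge0_integralZl_EFin//.
- by move=> x _; rewrite lee_fin.
- apply/measurable_EFinP; exact: measurable_funS mf.
Qed.

Lemma lint_cst D k : measurable D -> 0 <= k -> lint D (fun=> k) = (k%:E * mu D)%E.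
Proof. by move=> mD k0; rewrite /lint integral_cst. Qed.

Lemma lint0 D : lint D (fun=> 0) = 0%E.
Proof. by rewrite /lint integral0_eq. Qed.

Lemma lint_null D f : measurable D -> (forall t, 0 <= f t) -> mu D = 0%E -> lint D f = 0%E.
Proof.
move=> mD f0 D0; apply/eqP; rewrite eq_le lint_ge0// andbT -(lint0 D).
by apply: lint_le_ae => //; exists D; split => // t /= /not_implyP[].
Qed.

Lemma lint_monotone_cvg D (g : nat -> R -> R) f : measurable D ->
  (forall n, measurable_fun setT (g n)) -> (forall n t, 0 <= g n t) ->
  (forall t, D t -> {homo g ^~ t : a b / (a <= b)%N >-> a <= b}) ->
  (forall t, D t -> g ^~ t @ \oo --> f t) ->
  (fun n => lint D (g n)) @ \oo --> lint D f.
Proof.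
move=> mD mg g0 nd gf.
rewrite (_ : lint D f = \int[mu]_(x in D) (limn (fun n => (g n x)%:E)))%E.
  rewrite /lint; have := cvg_monotone_convergence (mu := mu) mD (g' := fun n x => (g n x)%:E); apply.
  - by move=> k; apply/measurable_EFinP; exact: measurable_funS (mg k).
  - by move=> k t _; rewrite lee_fin.
  - by move=> t Dt a b ab; rewrite lee_fin; exact: nd.
rewrite /lint; apply: eq_integral => t /set_mem Dt; apply/esym/cvg_lim => //.
by apply: cvg_EFin; [exact: nearW|exact: gf].
Qed.

(** * The L^p seminorm of a nonnegative function *)

Definition lpn p D f : \bar R := (lint D (fun t => f t `^ p)%R `^ p^-1)%E.

Lemma poweR_le (x y : \bar R) r : 0 <= r -> (0 <= x)%E -> (x <= y)%E ->
  (x `^ r <= y `^ r)%E.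
Proof.
move=> r0 x0 xy; apply: gt0_ler_poweR => //; rewrite in_itv/= leey andbT//.
exact: le_trans xy.
Qed.

Lemma lpn_ge0 p D f : (0 <= lpn p D f)%E.
Proof. exact: poweR_ge0. Qed.

Lemma lpn_le_ae p D E f g : 0 < p -> (forall t, 0 <= f t) -> (forall t, 0 <= g t) ->
  {ae mu, forall t, D t -> E t /\ f t <= g t} -> (lpn p D f <= lpn p E g)%E.
Proof.
move=> p0 f0 g0 fg; apply: poweR_le.
- by rewrite invr_ge0 ltW.
- by apply: lint_ge0 => t; exact: powR_ge0.
apply: lint_le_ae => [t|t|]; rewrite ?powR_ge0//.
apply: aeS fg => t + Dt => /(_ Dt)[Et fg]; split => //.
by rewrite ge0_ler_powR ?nnegrE// ltW.
Qed.

Lemma lpn_le p D E f g : 0 < p -> (forall t, 0 <= f t) -> (forall t, 0 <= g t) ->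
  D `<=` E -> (forall t, D t -> f t <= g t) -> (lpn p D f <= lpn p E g)%E.
Proof.
move=> p0 f0 g0 DE fg; apply: lpn_le_ae => //; apply: aeT => t Dt.
by split; [exact: DE|exact: fg].
Qed.

Lemma lpn_eq_ae p D f g : {ae mu, forall t, D t -> f t = g t} -> lpn p D f = lpn p D g.
Proof.
move=> fg; rewrite /lpn (lint_eq_ae (g := fun t => g t `^ p))//.
- by move=> t; exact: powR_ge0.
- by move=> t; exact: powR_ge0.
by apply: aeS fg => t fg Dt; rewrite fg.
Qed.

Lemma lpn_LnormE p D f : measurable D -> 0 < p -> (forall t, 0 <= f t) ->
  lpn p D f = Lnorm mu p%:E (EFin \o (f \_ D)).
Proof.
move=> mD p0 f0; rewrite unlock /lpn /lint; congr (_ `^ _)%E; rewrite [LHS]integral_mkcond.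
apply: eq_integral => x _; rewrite /= /patch; case: ifPn => _.
  by rewrite ger0_norm.
by rewrite /point/= normr0 powR0// gt_eqF.
Qed.

Lemma lpnD p D f g : measurable D -> 1 <= p -> (forall t, 0 <= f t) ->
  (forall t, 0 <= g t) -> aem D f -> aem D g ->
  (lpn p D (fun t => f t + g t)%R <= lpn p D f + lpn p D g)%E.
Proof.
move=> mD p1 f0 g0 /(aem_ge0 f0)[f' [mf f'0 ff']] /(aem_ge0 g0)[g' [mg g'0 gg']].
have p0 : 0 < p by exact: lt_le_trans p1.
rewrite (lpn_eq_ae p ff') (lpn_eq_ae p gg').
rewrite (@lpn_eq_ae _ _ _ (fun t => f' t + g' t)); last first.
  by apply: aeS2 ff' gg' => t ff' gg' Dt; rewrite ff'// gg'.
rewrite !lpn_LnormE//; last by move=> t; rewrite addr_ge0.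
have -> : (fun t => f' t + g' t) \_ D = (f' \_ D) \+ (g' \_ D).
  apply/funext => t; rewrite /= /patch; case: ifPn => //= _.
  by rewrite /point/= addr0.
apply: minkowski_EFin => //.
- by apply/(measurable_restrictT _ _).1 => //; exact: measurable_funS mf.
- by apply/(measurable_restrictT _ _).1 => //; exact: measurable_funS mg.
Qed.

Lemma lpnZ p D k f : measurable D -> 0 < p -> 0 <= k -> (forall t, 0 <= f t) -> aem D f ->
  lpn p D (fun t => k * f t) = (k%:E * lpn p D f)%E.
Proof.
move=> mD p0 k0 f0 mf; rewrite /lpn.
rewrite (_ : (fun t => (k * f t) `^ p) = fun t => k `^ p * f t `^ p); last first.
  by apply/funext => t; rewrite powRM.
rewrite lintZ ?powR_ge0//; last 2 first.
- by move=> t; exact: powR_ge0.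
- exact: aem_powR.
have i0 : (0 <= lint D (fun t => f t `^ p)%R)%E.
  by apply: lint_ge0 => t; exact: powR_ge0.
rewrite poweRM ?lee_fin ?powR_ge0//.
by rewrite poweR_EFin -powRrM mulfV ?gt_eqF// powRr1.
Qed.

Lemma lpn_poweR p D f : 0 < p -> (lpn p D f `^ p = lint D (fun t => f t `^ p)%R)%E.
Proof.
move=> p0; rewrite /lpn -poweRrM mulVf ?gt_eqF// poweRe1//.
by apply: lint_ge0 => t; exact: powR_ge0.
Qed.

Lemma lpn_lty p D f : 0 < p ->
  (lpn p D f < +oo)%E <-> (lint D (fun t => f t `^ p)%R < +oo)%E.
Proof.
move=> p0; split => h; last exact: poweR_lty.
by rewrite -lpn_poweR//; exact: poweR_lty.
Qed.

Lemma lint_supp (D : set R) (E : set R) (f : R -> R) : measurable D -> measurable E ->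
  D `<=` E -> (forall x, 0 <= f x) -> (forall x, E x -> ~ D x -> f x = 0) ->
  lint E f = lint D f.
Proof.
move=> mD mE DE f0 fD; rewrite /lint; apply/esym.
rewrite integral_mkcond [RHS]integral_mkcond; apply: eq_integral => x _.
rewrite /patch; case: ifPn => [/set_mem xD|xD].
  by rewrite mem_set//; exact: DE.
case: ifPn => // /set_mem xE; rewrite fD// => Dx.
by rewrite mem_set in xD.
Qed.

Lemma lpn_supp (p : R) (D E : set R) (f : R -> R) : measurable D -> measurable E ->
  0 < p -> D `<=` E -> (forall x, 0 <= f x) -> (forall x, E x -> ~ D x -> f x = 0) ->
  lpn p E f = lpn p D f.
Proof.
move=> mD mE p0 DE f0 fD; rewrite /lpn (@lint_supp D E)//.
  by move=> x; exact: powR_ge0.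
by move=> x Ex Dx; rewrite fD// powR0// gt_eqF.
Qed.

Lemma lpn0 p D : 0 < p -> lpn p D (fun=> 0) = 0%E.
Proof.
move=> p0; rewrite /lpn (_ : (fun=> 0 `^ p) = (fun=> 0)).
  by rewrite lint0 poweR0r// invr_neq0// gt_eqF.
by apply/funext => t; rewrite powR0// gt_eqF.
Qed.

End lower_integral.

Arguments lint {R} D%classical_set_scope f%ring_scope.
Arguments lpn {R} p%ring_scope D%classical_set_scope f%ring_scope.

(** * Simple functions *)

Section simple_functions.
Variable R : realType.
Local Notation mu := (@lebesgue_measure R).

(** [simple_function] for values in any type: a pair of simple functions is a simple
    function with values in a product, so that operations on simple functions are
    instances of composition. *)
Definition fsimple (Z : Type) (s : R -> Z) :=
  finite_set (range s) /\ forall z, measurable (s @^-1` [set z]).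

Lemma fsimple_preimage (Z : choiceType) (s : R -> Z) (B : set Z) :
  fsimple s -> measurable (s @^-1` B).
Proof.
move=> [fs ms]; rewrite (_ : s @^-1` B = \bigcup_(z in range s `&` B) (s @^-1` [set z])).
  by apply: fin_bigcup_measurable => // ; exact: finite_setIl.
apply/seteqP; split => [t /= Bt|t [z [_ Bz] /= ->]//].
by exists (s t) => //; split => //; exists t.
Qed.

Lemma fsimple_comp (Z : choiceType) (W : Type) (F : Z -> W) (s : R -> Z) :
  fsimple s -> fsimple (F \o s).
Proof.
move=> sS; split; last first.
  by move=> w; rewrite comp_preimage; exact: fsimple_preimage.
have := @finite_image _ _ _ F sS.1; apply: sub_finite_set.
by move=> _ [t _ <-]; exists (s t) => //; exists t.
Qed.

Lemma fsimple_pair (Z W : Type) (s : R -> Z) (r : R -> W) :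
  fsimple s -> fsimple r -> fsimple (fun t => (s t, r t)).
Proof.
move=> sS rS; split.
  have := @finite_setX _ _ _ _ sS.1 rS.1; apply: sub_finite_set.
  by move=> _ [t _ <-]; split; exists t.
move=> [z w]; rewrite (_ : _ @^-1` _ = s @^-1` [set z] `&` r @^-1` [set w]).
  by apply: measurableI; [exact: sS.2|exact: rS.2].
by apply/seteqP; split => t /= [-> ->].
Qed.

Lemma fsimple_comp2 (Z W : choiceType) (V : Type) (F : Z -> W -> V)
    (s : R -> Z) (r : R -> W) :
  fsimple s -> fsimple r -> fsimple (fun t => F (s t) (r t)).
Proof.
move=> sS rS.
exact: (@fsimple_comp _ _ (fun zw => F zw.1 zw.2) _ (fsimple_pair sS rS)).
Qed.

Lemma fsimple_cst (Z : Type) (z : Z) : fsimple (fun=> z).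
Proof.
split; first by apply: (sub_finite_set _ (finite_set1 z)) => _ [t _ <-].
move=> w; have [->|zw] := pselect (z = w).
  by rewrite (_ : _ @^-1` _ = setT)//; apply/seteqP; split.
by rewrite (_ : _ @^-1` _ = set0)//; apply/seteqP; split.
Qed.

Lemma fsimple_mem (E : set R) : measurable E -> fsimple (fun t => t \in E).
Proof.
move=> mE; split; first by apply: finite_finset.
case.
  rewrite (_ : _ @^-1` _ = E)//; apply/seteqP; split => t /=; first by move/set_mem.
  by move/mem_set.
rewrite (_ : _ @^-1` _ = ~` E); first exact: measurableC.
apply/seteqP; split => t /=; first by move=> tE Et; rewrite mem_set in tE.
by move=> tE; apply/negbTE; rewrite notin_setE.
Qed.

Lemma fsimple_measurable (Z : choiceType) (F : Z -> R) (s : R -> Z) :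
  fsimple s -> measurable_fun setT (F \o s).
Proof.
by move=> sS _ B mB; rewrite setTI comp_preimage; exact: fsimple_preimage.
Qed.

Section partition.
Variables (I : set R) (mI : measurable I) (fI : (mu I < +oo)%E).

Let m (E : set R) : R := fine (mu (I `&` E)).

Let fin_m (E : set R) : measurable E -> mu (I `&` E) \is a fin_num.
Proof.
move=> mE; rewrite ge0_fin_numE//; apply: le_lt_trans fI.
by apply: le_measure; rewrite ?inE//; exact: measurableI.
Qed.

Let m_preimage (Z W : choiceType) (F : Z -> W) (s : R -> Z) (w : W) : fsimple s ->
  m ((F \o s) @^-1` [set w]) =
  \sum_(z <- fset_set (range s) | F z == w) m (s @^-1` [set z]).
Proof.
move=> [fs ms]; rewrite /m sum_fine; last by move=> z _; exact: fin_m.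
congr fine; rewrite big_mkcond/=.
transitivity (mu (\bigcup_(z in range s)
    (if F z == w then I `&` s @^-1` [set z] else set0))).
  congr (mu _); apply/seteqP; split => [t [It /= Ft]|t [z _]].
    by exists (s t); [exists t|rewrite /= Ft eqxx].
  by case: ifPn => // /eqP Fz [It /= sz]; split => //=; rewrite sz.
rewrite measure_fin_bigcup//.
- rewrite fsbig_finite//; apply: eq_bigr => z _.
  by case: ifPn => // _; rewrite measure0.
- apply/trivIsetP => z z' _ _ zz'; apply/seteqP; split => // t [].
  case: ifPn => // _ [_ /= sz]; case: ifPn => // _ [_ /= sz'].
  by rewrite -sz -sz' eqxx in zz'.
- by move=> z _; case: ifPn => _; [apply: measurableI => //; exact: ms|exact: measurable0].
Qed.

(** The integral may be computed on a partition finer than that into level sets.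
    Linearity follows, both functions being images of their pair. *)
Lemma simple_integral_comp (X : completeNormedModType R) (Z : choiceType)
    (F : Z -> X) (s : R -> Z) : fsimple s ->
  simple_integral I (F \o s) =
  \sum_(z <- fset_set (range s)) fine (mu (I `&` s @^-1` [set z])) *: F z.
Proof.
move=> sS; have [fFs _] := fsimple_comp F sS.
rewrite /simple_integral fsbig_finite//=.
under eq_bigr do rewrite -/(m _) (m_preimage F _ sS) scaler_suml.
rewrite (exchange_big_dep xpredT)//= big_seq [RHS]big_seq; apply: eq_bigr => z.
rewrite in_fset_set ?inE; last exact: sS.1.
case => t _ <-.
rewrite (eq_bigl (fun y => y == F (s t))) => [|y]; last by rewrite eq_sym.
rewrite -big_filter (_ : [seq _ <- _ | _] = [:: F (s t)]) ?big_seq1//.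
rewrite filter_pred1_uniq ?fset_uniq//.
by rewrite in_fset_set// inE; exists t.
Qed.

Lemma lint_comp (Z : choiceType) (F : Z -> R) (s : R -> Z) :
  (forall z, 0 <= F z) -> fsimple s ->
  lint I (F \o s) = (\sum_(z <- fset_set (range s)) F z * fine (mu (I `&` s @^-1` [set z])))%:E.
Proof.
move=> F0 sS; rewrite /lint.
transitivity (\int[mu]_(t in I)
    \sum_(z <- fset_set (range s)) ((F z)%:E * (\1_(s @^-1` [set z]) t)%:E))%E.
  apply: eq_integral => t _ /=.
  have st : s t \in fset_set (range s).
    by rewrite in_fset_set ?inE; [exists t|exact: sS.1].
  rewrite (bigD1_seq (s t))//= indicE mem_set// mule1 big1 ?adde0// => z zst.
  rewrite indicE memNset ?mule0// => /= e; by rewrite e eqxx in zst.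
rewrite ge0_integral_sum//.
- rewrite -sumEFin; apply: eq_bigr => z _.
  rewrite ge0_integralZl_EFin//.
  + rewrite integral_indic; [|exact: mI|exact: sS.2].
    by rewrite [(_ `&` I)%classic]setIC EFinM fineK; last exact: fin_m (sS.2 z).
  + by apply/measurable_EFinP; apply: measurable_indic; exact: sS.2.
- move=> z; apply/measurable_EFinP.
  by apply: measurable_funM => //; apply: measurable_indic; exact: sS.2.
- by move=> z t _; rewrite mule_ge0// lee_fin.
Qed.

End partition.

End simple_functions.

(** * Strong measurability and the Bochner integral *)

Section bochner.
Variables (R : realType) (X : completeNormedModType R).
Local Notation mu := (@lebesgue_measure R).
Implicit Types (I J E : set R) (f g : R -> X).

Lemma cvge0_le (e d : nat -> \bar R) : (forall k, (0 <= e k)%E) ->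
  (forall k, (e k <= d k)%E) -> d @ \oo --> 0%E -> e @ \oo --> 0%E.
Proof.
move=> e0 ed d0; apply: (@squeeze_cvge _ _ _ _ (fun=> 0%E) _ d) => //.
  by apply: nearW => k; rewrite e0 ed.
exact: cvg_cst.
Qed.

Definition smeas I f := strongly_measurable (whole_space X) I f.

Lemma smeasP I f : smeas I f <-> exists2 s : nat -> R -> X, (forall k, fsimple (s k)) &
  {ae mu, forall t, I t -> (fun k => s k t) @ \oo --> f t}.
Proof.
split.
  move=> [s [ss sf]]; exists s; first by move=> k; case: (ss k).
  apply: aeS sf => t + It => /(_ It)[_] /= h.
  apply/cvgrPdistC_lt => e e0 /=; move/cvgr0_norm_lt : h => /(_ _ e0).
  by apply: filterS => k; rewrite normr_id.
move=> [s ss sf]; exists s; split; first by move=> k; split => //; exact: ss.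
apply: aeS sf => t + It => /(_ It) h; split => //=.
rewrite -(@normr0 _ X); apply: cvg_norm; rewrite -(subrr (f t)).
by apply: cvgB => //; exact: cvg_cst.
Qed.

Lemma smeas_sub I J f : J `<=` I -> smeas I f -> smeas J f.
Proof.
move=> JI /smeasP[s ss sf]; apply/smeasP; exists s => //.
by apply: aeS sf => t sf /JI.
Qed.

Lemma smeas_eq I f g : {ae mu, forall t, I t -> f t = g t} -> smeas I g -> smeas I f.
Proof.
move=> fg /smeasP[s ss sf]; apply/smeasP; exists s => //.
by apply: aeS2 fg sf => t fg + It => /(_ It); rewrite fg.
Qed.

Lemma smeas_lin I f g (a : R) : smeas I f -> smeas I g ->
  smeas I (fun t => a *: f t + g t).
Proof.
move=> /smeasP[s ss sf] /smeasP[r rs rg]; apply/smeasP.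
exists (fun k t => a *: s k t + r k t).
  by move=> k; exact: (fsimple_comp2 (fun x y => a *: x + y)).
apply: aeS2 sf rg => t sf rg It; apply: cvgD; last exact: rg.
by apply: cvgZr; exact: sf.
Qed.

Lemma smeas0 I : smeas I (fun=> 0).
Proof.
apply/smeasP; exists (fun _ _ => 0) => [k|]; first exact: fsimple_cst.
by apply: aeT => t _; exact: cvg_cst.
Qed.

Lemma smeasD I f g : smeas I f -> smeas I g -> smeas I (fun t => f t + g t).
Proof.
move=> mf mg; have := smeas_lin 1 mf mg.
by apply: smeas_eq; apply: aeT => t _; rewrite scale1r.
Qed.

Lemma smeasZ I f (a : R) : smeas I f -> smeas I (fun t => a *: f t).
Proof.
move=> mf; have := smeas_lin a mf (smeas0 I).
by apply: smeas_eq; apply: aeT => t _; rewrite addr0.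
Qed.

Lemma smeasB I f g : smeas I f -> smeas I g -> smeas I (fun t => f t - g t).
Proof.
move=> mf mg; have := smeasD mf (smeasZ (-1) mg).
by apply: smeas_eq; apply: aeT => t _; rewrite scaleN1r.
Qed.

Lemma smeas_fsimple I (s : R -> X) : fsimple s -> smeas I s.
Proof.
by move=> ss; apply/smeasP; exists (fun=> s) => //; apply: aeT => t _; exact: cvg_cst.
Qed.

Lemma smeas_restrict I E f : measurable E -> smeas (I `&` E) f ->
  smeas I (fun t => if t \in E then f t else 0).
Proof.
move=> mE /smeasP[s ss sf]; apply/smeasP.
exists (fun k t => if t \in E then s k t else 0).
  move=> k; apply: (fsimple_comp2 (fun (x : X) (b : bool) => if b then x else 0)) => //.
  exact: fsimple_mem.
apply: aeS sf => t sf It; case: ifPn => [/set_mem tE|_]; last exact: cvg_cst.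
exact: sf.
Qed.

Lemma smeas_norm_aem I f : measurable I -> smeas I f -> aem I (fun t => `|f t|).
Proof.
move=> mI /smeasP[s ss [N [mN N0 sN]]].
pose G := I `\` N; have mG : measurable G by exact: measurableD.
exists (fun t => if t \in G then `|f t| else 0); last first.
  exists N; split => // t /= /not_implyP[It]; rewrite /G; case: ifPn => // + _.
  by rewrite notin_setE => /not_andP[//|]; exact: contrapT.
apply: (@measurable_fun_cvg _ _ _ _ (fun k t => if t \in G then `|s k t| else 0)).
  move=> k; have := fsimple_pair (ss k) (fsimple_mem mG).
  by move/(fsimple_measurable (fun z : X * bool => if z.2 then `|z.1| else 0)).
move=> t _; case: ifPn => [/set_mem [It Nt]|_]; last exact: cvg_cst.
apply: cvg_norm; apply: contrapT => h; apply: Nt; apply: sN => /= /(_ It).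
exact: h.
Qed.

Lemma smeas_dist_aem I f g : measurable I -> smeas I f -> smeas I g ->
  aem I (fun t => `|f t - g t|).
Proof. by move=> mI mf mg; apply: smeas_norm_aem => //; exact: smeasB. Qed.

(** * The Bochner integral *)

Section finite_measure.
Variables (I : set R) (mI : measurable I) (fI : (mu I < +oo)%E).

Lemma simple_integral_lin (a : R) (s r : R -> X) : fsimple s -> fsimple r ->
  simple_integral I (fun t => a *: s t + r t) =
  a *: simple_integral I s + simple_integral I r.
Proof.
move=> ss rs; have srs := fsimple_pair ss rs.
have /= -> := simple_integral_comp mI fI (fun z : X * X => a *: z.1 + z.2) srs.
have /= -> := simple_integral_comp mI fI fst srs.
have /= -> := simple_integral_comp mI fI snd srs.
rewrite scaler_sumr -big_split/=; apply: eq_bigr => z _.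
by rewrite scalerDr !scalerA mulrC.
Qed.

Lemma simple_integral_norm (s : R -> X) : fsimple s ->
  (`|simple_integral I s|%:E <= lint I (fun t => `|s t|)%R)%E.
Proof.
move=> ss; have /= -> := simple_integral_comp mI fI id ss.
have /= -> := lint_comp mI fI (fun z : X => normr_ge0 z) ss.
rewrite lee_fin; apply: le_trans (ler_norm_sum _ _ _) _; apply: ler_sum => z _.
by rewrite normrZ mulrC ger0_norm// fine_ge0.
Qed.

Lemma lint_fsimple_lty (s : R -> X) : fsimple s -> (lint I (fun t => `|s t|)%R < +oo)%E.
Proof.
move=> ss; have /= -> := lint_comp mI fI (fun z : X => normr_ge0 z) ss.
exact: ltry.
Qed.

Lemma finite_level (s : R -> X) z : fsimple s -> (mu (I `&` s @^-1` [set z]) < +oo)%E.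
Proof.
move=> ss; apply: le_lt_trans fI; apply: le_measure; rewrite ?inE//.
by apply: measurableI => //; exact: ss.2.
Qed.

(** On a set of finite measure all level sets have finite measure. *)
Lemma bintP f y : is_bochner_integral I f y <-> exists s : nat -> R -> X,
  [/\ forall k, fsimple (s k),
      {ae mu, forall t, I t -> (fun k => s k t) @ \oo --> f t},
      (fun k => lint I (fun t => `|f t - s k t|)%R) @ \oo --> 0%E
    & (fun k => simple_integral I (s k)) @ \oo --> y].
Proof.
split => [[s [h1 h2 h3 h4]]|[s [h1 h2 h3 h4]]]; exists s; split => //.
  by move=> k; case: (h1 k).
by move=> k; split; [exact: h1|move=> z _; exact: finite_level].
Qed.

Lemma bint_smeas f y : is_bochner_integral I f y -> smeas I f.
Proof. by move=> /bintP[s [h1 h2 _ _]]; apply/smeasP; exists s. Qed.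

Lemma lint_norm_triangle f g : smeas I f -> smeas I g ->
  (lint I (fun t => `|f t|)%R <= lint I (fun t => `|g t|)%R + lint I (fun t => `|f t - g t|)%R)%E.
Proof.
move=> mf mg; rewrite -lintD//; first last.
- exact: smeas_dist_aem.
- exact: smeas_norm_aem.
apply: lint_le => // t; rewrite ?addr_ge0// => _.
by rewrite -{1}(subrK (g t) (f t)) addrC ler_normD.
Qed.

Lemma bint_norm_lty f y : is_bochner_integral I f y -> (lint I (fun t => `|f t|)%R < +oo)%E.
Proof.
move=> bf; have mf := bint_smeas bf; case/bintP: bf => s [h1 h2 h3 h4].
have /fine_cvgP[[n _ /(_ n (leqnn n)) fin] _] := h3.
have ms := smeas_fsimple I (h1 n).
apply: le_lt_trans (lint_norm_triangle mf ms) _; apply: lte_add_pinfty.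
  exact: lint_fsimple_lty.
by rewrite ltey_eq fin.
Qed.

(** The inequality for simple functions passes to the limit, as the integrals of
    [|f - s k|] tend to 0. *)
Lemma bint_norm f y : is_bochner_integral I f y ->
  (`|y|%:E <= lint I (fun t => `|f t|)%R)%E.
Proof.
move=> bf; have mf := bint_smeas bf; case/bintP: bf => s [h1 h2 h3 h4].
apply: (@lee_cvg_to _ \oo _ _ (fun k => `|simple_integral I (s k)|%:E)
  (fun k => (lint I (fun t => `|f t|)%R + lint I (fun t => `|f t - s k t|)%R)%E)).
- by apply: cvg_EFin; [apply: nearW|exact: cvg_norm].
- rewrite -[X in _ --> X]adde0; apply: cvgeD => //; last exact: cvg_cst.
  by rewrite ge0_adde_def// inE// lint_ge0.
- apply: nearW => k; apply: le_trans (simple_integral_norm (h1 k)) _.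
  have := lint_norm_triangle (smeas_fsimple I (h1 k)) mf.
  by under [X in (_ <= _ + X)%E -> _]eq_integral do rewrite distrC.
Qed.

Lemma bint_lin (a : R) f g y z : is_bochner_integral I f y ->
  is_bochner_integral I g z ->
  is_bochner_integral I (fun t => a *: f t + g t) (a *: y + z).
Proof.
move=> bf bg; have mf := bint_smeas bf; have mg := bint_smeas bg.
case/bintP: bf => s [s1 s2 s3 s4]; case/bintP: bg => r [r1 r2 r3 r4].
apply/bintP; exists (fun k t => a *: s k t + r k t); split.
- by move=> k; exact: (fsimple_comp2 (fun x y => a *: x + y)).
- apply: aeS2 s2 r2 => t sf rg It; apply: cvgD; last exact: rg.
  by apply: cvgZr; exact: sf.
- apply: (@cvge0_le _ (fun k => `|a|%:E * lint I (fun t => `|f t - s k t|)%R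
     + lint I (fun t => `|g t - r k t|)%R)%E).
  + by move=> k; exact: lint_ge0.
  + move=> k; have mfs := smeas_dist_aem mI mf (smeas_fsimple I (s1 k)).
    have mgr := smeas_dist_aem mI mg (smeas_fsimple I (r1 k)).
    rewrite -lintZ// -lintD//; last exact: (aemZ _ mfs).
    apply: lint_le => // t; rewrite ?addr_ge0 ?mulr_ge0// => _.
    rewrite opprD addrACA -scalerBr; apply: le_trans (ler_normD _ _) _.
    by rewrite normrZ.
  + rewrite -[X in _ --> X](adde0 0%E); apply: cvgeD => //.
    by rewrite -[X in _ --> X](mule0 `|a|%:E); apply: cvgeZl.
- under eq_fun do rewrite simple_integral_lin//.
  by apply: cvgD => //; apply: cvgZr.
Qed.

Lemma bint_unique f g y z : {ae mu, forall t, I t -> f t = g t} ->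
  is_bochner_integral I f y -> is_bochner_integral I g z -> y = z.
Proof.
move=> fg bf bg; have := bint_norm (bint_lin (-1) bf bg).
rewrite (@lint_eq_ae _ _ _ (fun=> 0))//; last first.
  by apply: aeS fg => t fg It; rewrite fg// scaleN1r addNr normr0.
rewrite lint0 lee_fin normr_le0 scaleN1r addrC subr_eq0 => /eqP ->//.
Qed.

Lemma bint_eq f g y : {ae mu, forall t, I t -> f t = g t} ->
  is_bochner_integral I f y -> is_bochner_integral I g y.
Proof.
move=> fg /bintP[s [s1 s2 s3 s4]]; apply/bintP; exists s; split => //.
  by apply: aeS2 fg s2 => t fg + It => /(_ It); rewrite fg.
apply: cvg_trans s3; apply: near_eq_cvg; apply: nearW => k.
by apply: lint_eq_ae => //; apply: aeS fg => t fg It; rewrite fg.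
Qed.

Import HBNNSimple.

(** Approximation of [rho] from below by simple functions; monotone convergence gives
    the convergence in mean. *)
Lemma bint_cst_mul (rho : R -> R) (c : X) : measurable_fun setT rho ->
  (forall t, 0 <= rho t) -> (lint I rho < +oo)%E ->
  is_bochner_integral I (fun t => rho t *: c) (fine (lint I rho) *: c).
Proof.
move=> mrho rho0 irho.
have mE : measurable_fun setT (EFin \o rho) by exact/measurable_EFinP.
pose g := nnsfun_approx measurableT mE.
have gS k : fsimple (g k : R -> R).
  by split=> [|z]; [exact: fimfunP|exact: measurable_funPTI].
have g0 k t : 0 <= g k t by exact: fun_ge0.
have g_cvg t : (fun k => g k t) @ \oo --> rho t.
  have /fine_cvgP[_] := cvg_nnsfun_approx measurableT mE (fun t _ => rho0 t) (Logic.I : setT t).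
  exact.
have gle k t : g k t <= rho t.
  have nd : nondecreasing_seq (fun k => g k t).
    by move=> a b ab; exact/lefP/nd_nnsfun_approx.
  by have := nondecreasing_cvgn_le nd (cvgP _ (g_cvg t)) k; rewrite (cvg_lim _ (g_cvg t)).
have mg k : aem I (g k : R -> R) by apply: aem_measurable; exact: measurable_funP.
have cvg_int : (fun k => lint I (g k)) @ \oo --> lint I rho.
  apply: lint_monotone_cvg => //.
  - by move=> t _ a b ab; exact/lefP/nd_nnsfun_approx.
have fin_rho : lint I rho \is a fin_num by rewrite ge0_fin_numE// lint_ge0.
have fin_g k : lint I (g k) \is a fin_num.
  by rewrite ge0_fin_numE ?lint_ge0//; apply: le_lt_trans irho; exact: lint_le.
apply/bintP; exists (fun k t => g k t *: c); split.
- by move=> k; exact: (fsimple_comp (fun r : R => r *: c)).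
- by apply: aeT => t _; apply: cvgZl; exact: g_cvg.
- pose d k : R := `|c| * (fine (lint I rho) - fine (lint I (g k))).
  rewrite (_ : (fun k => _) = EFin \o d).
    apply: cvg_EFin; first exact: nearW.
    rewrite (_ : fine \o _ = d)// -[X in _ --> X](mulr0 `|c|).
    apply: cvgM; first exact: cvg_cst.
    rewrite -[X in _ --> X](subrr (fine (lint I rho))).
    by apply: cvgB; [exact: cvg_cst|apply: fine_cvg; rewrite fineK].
  apply/funext => k /=; rewrite /d EFinM EFinB !fineK//.
  have mdiff : aem I (fun t => rho t - g k t)%R.
    apply: aemD; first exact: aem_measurable.
    have := aemZ (-1) (mg k); apply: aem_eq; apply: aeT => t _.
    by rewrite mulN1r.
  have d0 t : 0 <= rho t - g k t by rewrite subr_ge0.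
  transitivity (`|c|%:E * lint I (fun t => rho t - g k t)%R)%E.
    rewrite -lintZ//; congr lint; apply/funext => t.
    by rewrite -scalerBl normrZ ger0_norm// mulrC.
  congr (_ * _)%E; apply/esym/eqP; rewrite sube_eq// ?fin_num_adde_defl//.
  rewrite addeC -lintD//; apply/eqP; congr lint; apply/funext => t.
  by rewrite addrC subrK.
- rewrite (_ : (fun k => _) = fun k => fine (lint I (g k)) *: c).
    by apply: cvgZl; apply: fine_cvg; rewrite fineK.
  apply/funext => k; have /= -> := simple_integral_comp mI fI (fun r : R => r *: c) (gS k).
  rewrite (_ : lint I (g k) = lint I (fun t => `|g k t|)%R); last first.
    by congr lint; apply/funext => t; rewrite ger0_norm.
  have /= -> := lint_comp mI fI (fun z : R => normr_ge0 z) (gS k).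
  rewrite scaler_suml big_seq [RHS]big_seq; apply: eq_bigr => z.
  rewrite in_fset_set ?inE; last by case: (gS k).
  by case => t _ <-; rewrite scalerA mulrC ger0_norm.
Qed.

End finite_measure.

(** The approximating functions on [I] serve on [J]. Their integrals over [J] are
    those over [I] of their restrictions extended by zero, and these differ from the
    integrals over [I] by at most the integral of [|f - s k|]. *)
Lemma bint_restrict I J f y : measurable I -> (mu I < +oo)%E -> measurable J ->
  J `<=` I -> (forall t, I t -> ~ J t -> f t = 0) ->
  is_bochner_integral I f y -> is_bochner_integral J f y.
Proof.
move=> mI fI mJ JI f0 bf; have mf := bint_smeas mI fI bf.
have fJ : (mu J < +oo)%E by apply: le_lt_trans fI; apply: le_measure; rewrite ?inE.
have [s [s1 s2 s3 s4]] := (bintP mI fI f y).1 bf.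
pose r k t := if t \in J then s k t else 0.
have r1 k : fsimple (r k).
  apply: (fsimple_comp2 (fun (x : X) (b : bool) => if b then x else 0)) => //.
  exact: fsimple_mem.
have siE k : simple_integral J (s k) = simple_integral I (r k).
  have sJ := fsimple_pair (s1 k) (fsimple_mem mJ).
  have /= -> := simple_integral_comp mI fI (fun z : X * bool => if z.2 then z.1 else 0) sJ.
  have /= -> := simple_integral_comp mJ fJ fst sJ.
  apply: eq_bigr => -[z b] _ /=; case: b => /=.
    congr (fine (mu _) *: _); apply/seteqP; split => t /= [Jt [<- e]]; split; rewrite ?e//.
    - exact: JI.
    - exact: set_mem.
  rewrite scaler0 (_ : J `&` _ = set0) ?measure0 ?scale0r//.
  by apply/seteqP; split => // t /= [Jt [_]]; rewrite mem_set.
apply/bintP => //; exists s; split => //.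
- by apply: aeS s2 => t s2 /JI.
- by apply: cvge0_le s3 => k; [exact: lint_ge0|exact: lint_le].
rewrite (_ : (fun k => _) = fun k => simple_integral I (s k) -
    (-1 *: simple_integral I (r k) + simple_integral I (s k))); last first.
  by apply/funext => k; rewrite siE scaleN1r opprD opprK addrC subrK.
rewrite -[X in _ --> X]subr0; apply: cvgB => //.
apply/norm_cvg0P.
pose e k := -1 *: simple_integral I (r k) + simple_integral I (s k).
suff /fine_cvg : (fun k => `|e k|%:E) @ \oo --> 0%E by [].
apply: (@cvge0_le _ (fun k => lint I (fun t => `|f t - s k t|)%R)) => // k; rewrite /e.
rewrite -simple_integral_lin//.
apply: le_trans (simple_integral_norm mI fI _) _.
  exact: (fsimple_comp2 (fun x y => -1 *: x + y)).
apply: lint_le => // t It; rewrite /r; case: ifPn => [_|].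
  by rewrite scaleN1r addNr normr0.
by rewrite notin_setE => /(f0 t It) ->; rewrite scaler0 add0r sub0r normrN.
Qed.

End bochner.

(** * A class of smooth functions *)

Section smooth.
Variable R : realType.
Implicit Types (f g F : R -> R).

(** [x^(-k) exp(-1/x)] on the positive half-line: up to linear combinations this family
    is stable under differentiation, and all its members vanish at 0 to every order. *)
Definition flat (k : nat) (x : R) : R :=
  if 0 < x then x^-1 ^+ k * expR (- x^-1) else 0.

(** From [exp(y) >= 1 + y] at [y = 1 / ((m + 1) x)], raised to the power [m + 1]. *)
Lemma flat_le (k m : nat) (x : R) : 0 < x ->
  flat k x <= m.+1%:R ^+ m.+1 * (x ^+ m.+1 * x^-1 ^+ k).
Proof.
move=> x0; rewrite /flat x0 [leRHS]mulrA [leLHS]mulrC; apply: ler_wpM2r.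
  by rewrite exprn_ge0// invr_ge0 ltW.
have m0 : 0 < m.+1%:R :> R by [].
have y0 : 0 < m.+1%:R * x by rewrite mulr_gt0.
rewrite -exprMn expRN -[leRHS]invrK lef_pV2 ?posrE ?expR_gt0 ?invr_gt0 ?exprn_gt0//.
have -> : x^-1 = m.+1%:R * (m.+1%:R * x)^-1.
  by rewrite invfM mulrA mulfV ?mul1r// gt_eqF.
rewrite expRM_natl -exprVn lerXn2r ?nnegrE ?invr_ge0 ?expR_ge0 ?ltW//.
by apply: lt_le_trans (expR_ge1Dx _); rewrite ltrDr.
Qed.

Lemma flat_ge0 k x : 0 <= flat k x.
Proof.
rewrite /flat; case: ifPn => // x0.
by rewrite mulr_ge0 ?expR_ge0// exprn_ge0// invr_ge0 ltW.
Qed.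

Lemma is_derive_square (f : R -> R) (M : R) : (forall x, `|f x| <= M * x ^+ 2) ->
  is_derive (0 : R) 1 f 0.
Proof.
move=> fM; have f0 : f 0 = 0.
  by apply/eqP; rewrite -normr_le0 (le_trans (fM 0))// expr0n mulr0.
have M0 : 0 <= M by have := le_trans (normr_ge0 _) (fM 1); rewrite expr1n mulr1.
have M1 : 0 < M + 1 by rewrite ltr_wpDl.
have lim0 : h^-1 *: (f (h *: 1 + 0) - f 0) @[h --> (0:R)^'] --> (0 : R).
  apply/cvgr0Pnorm_le => e e0; near=> h.
  have h0 : h != 0 by near: h; exact: nbhs_dnbhs_neq.
  rewrite f0 subr0 addr0 scaler1 normrM normfV.
  rewrite ler_pdivrMl ?normr_gt0//; apply: le_trans (fM h) _.
  rewrite -(real_normK (num_real h)) expr2 mulrA mulrC; apply: ler_wpM2l => //.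
  apply: (@le_trans _ _ ((M + 1) * `|h|)); first by rewrite ler_wpM2r// lerDl.
  rewrite mulrC -ler_pdivlMr// ltW//; near: h; apply: dnbhs0_lt.
  by rewrite divr_gt0.
have d : derivable f 0 1 by apply/cvg_ex; exists 0; exact: lim0.
by apply: DeriveDef => //; apply/cvg_lim => //; exact: lim0.
Unshelve. all: by end_near. Qed.

Lemma is_derive_congr (f g : R -> R) (x df dg : R) : f =1 g -> df = dg ->
  is_derive x 1 f df -> is_derive x 1 g dg.
Proof. by move=> /funext -> ->. Qed.

(** The operations that build the test functions below. The derivative of a member
    belongs to the class, which makes all members infinitely differentiable. *)
Inductive smooth : (R -> R) -> Prop :=
| smooth_flat k : smooth (flat k)
| smooth_cst c : smooth (fun=> c)
| smoothD f g : smooth f -> smooth g -> smooth (fun x => f x + g x)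
| smoothM f g : smooth f -> smooth g -> smooth (fun x => f x * g x)
| smooth_affine f a b : smooth f -> smooth (fun x => f (a * x + b))
| smooth_primitive F f : (forall x : R, is_derive x 1 F (f x)) -> smooth f -> smooth F.

Lemma is_derive_flat k (x : R) : is_derive x 1 (flat k) (flat k.+2 x - k%:R * flat k.+1 x).
Proof.
have [x0|x0|<-] := ltgtP 0 x.
- pose h (y : R) := y^-1 ^+ k * expR (- y^-1).
  apply: (@near_eq_is_derive _ _ _ h).
    near=> y; rewrite /flat ifT//; near: y; exact: lt_nbhsr.
  have dV : is_derive x 1 (fun y : R => y^-1) (- x ^- 2).
    have xn0 : id x != 0 by rewrite /= gt_eqF.
    have := is_deriveV xn0 (is_derive_id x (1 : R)).
    by rewrite -[_ *: 1]/(_ * 1) mulr1.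
  have dE : is_derive x 1 (fun y : R => expR (- y^-1)) (expR (- x^-1) * x ^- 2).
    have := @is_derive1_comp R expR (fun y : R => - y^-1) x _ _ (is_derive_expR (- x^-1)) (is_deriveN dV).
    by rewrite opprK.
  have := is_deriveM (is_deriveX k dV) dE.
  apply: is_derive_congr => [y|]; first by rewrite /h !fctE.
  rewrite /flat x0 /GRing.scale/=; case: k {h} => [|k].
    by rewrite mulr0n !mul0r mulr0 subr0 expr0 mul1r addr0 exprVn mulrC.
  rewrite !fctE /= -exprVn !exprS; set E := expR _; set y := x^-1.
  by ring.
- apply: (@near_eq_is_derive _ _ _ (fun=> 0)).
    near=> y; rewrite /flat ifN// -leNgt ltW//; near: y; exact: lt_nbhsl.
  by rewrite /flat ltNge ltW//= mulr0 subr0; exact: is_derive_cst.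
- rewrite {2 3}/flat ltxx mulr0 subr0.
  apply: (@is_derive_square _ (k.+2%:R ^+ k.+2)) => y.
  rewrite ger0_norm ?flat_ge0//; have [y0|y0] := ltP 0 y; last first.
    by rewrite /flat ltNge y0/= mulr_ge0 ?sqr_ge0// exprn_ge0.
  apply: le_trans (flat_le k k.+1 y0) _; apply: ler_wpM2l; first by rewrite exprn_ge0.
  by rewrite !exprS -!mulrA -exprMn mulfV ?gt_eqF// expr1n expr0.
Unshelve. all: by end_near. Qed.

Lemma smooth_derive f : smooth f ->
  exists2 g, smooth g & forall x : R, is_derive x 1 f (g x).
Proof.
elim => {f}.
- move=> k; exists (fun x => flat k.+2 x + (- k%:R) * flat k.+1 x).
    by apply: smoothD; [exact: smooth_flat|apply: smoothM; [exact: smooth_cst|exact: smooth_flat]].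
  by move=> x; rewrite mulNr; exact: is_derive_flat.
- by move=> c; exists (fun=> 0) => [|x]; [exact: smooth_cst|exact: is_derive_cst].
- move=> f g sf [f' sf' ff'] sg [g' sg' gg'].
  exists (fun x => f' x + g' x); first exact: smoothD.
  by move=> x; exact: (is_deriveD (ff' x) (gg' x)).
- move=> f g sf [f' sf' ff'] sg [g' sg' gg'].
  exists (fun x => f x * g' x + g x * f' x); first by apply: smoothD; exact: smoothM.
  by move=> x; exact: (is_deriveM (ff' x) (gg' x)).
- move=> f a b sf [f' sf' ff']; exists (fun x => a * f' (a * x + b)).
    by apply: smoothM; [exact: smooth_cst|exact: smooth_affine].
  move=> x; have h : is_derive x 1 (fun x : R => a * x + b) a.
    have := is_deriveD (is_deriveZ a (is_derive_id x (1 : R))) (is_derive_cst b x (1 : R)).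
    by rewrite addr0 scaler1.
  have := @is_derive1_comp R f (fun x : R => a * x + b) x _ _ (ff' (a * x + b)) h.
  by rewrite mulrC.
- by move=> F f Ff sf _; exists f.
Qed.

Lemma smooth_derive1 f : smooth f -> (forall x : R, derivable f x 1) /\ smooth (derive1 f).
Proof.
move=> /smooth_derive[g sg fg]; split; first by move=> x; have [] := fg x.
rewrite (_ : derive1 f = g)//; apply/funext => x; rewrite derive1E.
by have [_] := fg x.
Qed.

Lemma smooth_derivable f : smooth f -> forall k (x : R), derivable (derive1n k f) x 1.
Proof.
move=> sf k; have {sf} : smooth (derive1n k f).
  by elim: k => // k IH; have [] := smooth_derive1 IH.
by case/smooth_derive1.
Qed.

Lemma smooth_continuous f : smooth f -> continuous f.
Proof.
move=> /smooth_derive1[df _] x; apply: differentiable_continuous.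
exact/derivable1_diffP.
Qed.

Lemma smooth_measurable f : smooth f -> measurable_fun setT f.
Proof. by move=> sf; apply: continuous_measurable_fun; exact: smooth_continuous. Qed.

Lemma smooth_test (I : set R) f a b : smooth f -> `[a, b] `<=` interior I ->
  (forall x, ~ `[a, b]%classic x -> f x = 0) -> test_function I f.
Proof. by move=> sf abI f0; split; [exact: smooth_derivable|exists a, b]. Qed.

End smooth.

(** * Mollifiers and their primitives *)

Section mollifier.
Variable R : realType.
Local Notation mu := (@lebesgue_measure R).

Lemma flat0_le1 (x : R) : flat 0 x <= 1.
Proof.
rewrite /flat; case: ifPn => // x0; rewrite expr0 mul1r -expR0 ler_expR.
by rewrite oppr_le0 invr_ge0 ltW.
Qed.

Lemma flat0_ge (x : R) : 4^-1 <= x -> expR (- 4) <= flat 0 x.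
Proof.
move=> x4; have x0 : 0 < x by apply: lt_le_trans x4; rewrite invr_gt0.
rewrite /flat x0 expr0 mul1r ler_expR lerN2 -(invrK 4) lef_pV2// posrE invr_gt0.
by [].
Qed.

Lemma flat0_gt0 (x : R) : 0 < x -> 0 < flat 0 x.
Proof. by move=> x0; rewrite /flat x0 expr0 mul1r expR_gt0. Qed.

Lemma flat_npos k (x : R) : x <= 0 -> flat k x = 0.
Proof. by move=> x0; rewrite /flat ltNge x0. Qed.

(** For [e > 0], positive exactly between [s] and [s + e]. *)
Definition bumpf (s e x : R) := flat 0 ((x - s) / e) * flat 0 (1 - (x - s) / e).

Lemma smooth_bump s e : smooth (bumpf s e).
Proof.
rewrite (_ : bumpf s e = fun x => flat 0 (e^-1 * x + (- s / e)) *
                                 flat 0 (- e^-1 * x + (1 + s / e))).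
  by apply: smoothM; apply: smooth_affine; exact: smooth_flat.
apply/funext => x; rewrite /bumpf; congr (flat _ _ * flat _ _); ring.
Qed.

Lemma bump_ge0 s e x : 0 <= bumpf s e x.
Proof. by rewrite mulr_ge0 ?flat_ge0. Qed.

Lemma bump_le1 s e x : bumpf s e x <= 1.
Proof. by rewrite -[leRHS]mulr1 ler_pM ?flat_ge0 ?flat0_le1. Qed.

Lemma bump_gt0 s e x : 0 < e -> s < x < s + e -> 0 < bumpf s e x.
Proof.
move=> e0 /andP[sx xs]; rewrite mulr_gt0// flat0_gt0//.
  by rewrite divr_gt0// subr_gt0.
by rewrite subr_gt0 ltr_pdivrMr// mul1r ltrBlDl.
Qed.

Lemma bump_out s e x : 0 < e -> ~ `[s, s + e]%classic x -> bumpf s e x = 0.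
Proof.
move=> e0 /= /negP; rewrite in_itv/= negb_and -!ltNge => /orP[xs|xs]; rewrite /bumpf.
  by rewrite (@flat_npos 0 ((x - s) / e)) ?mul0r// pmulr_lle0 ?invr_gt0// subr_le0 ltW.
rewrite (@flat_npos 0 (1 - _)) ?mulr0//.
by rewrite subr_le0 ler_pdivlMr// mul1r lerBrDl ltW.
Qed.

(** The unnormalised bump is at most 1 and at least [exp(-4)^2] on the middle half of
    its support, so its mass is comparable to its width. By the resulting bound
    on the height, mollified averages are controlled by averages over balls. *)
Lemma mollifier_exists : exists2 K : R, 0 < K & forall s e : R, 0 < e ->
  exists rho : R -> R, [/\ smooth rho, forall x, 0 <= rho x,
    forall x, ~ `[s, s + e]%classic x -> rho x = 0,
    forall x, rho x <= K / e & lint setT rho = 1%E].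
Proof.
pose c : R := expR (- 4) ^+ 2; have c0 : 0 < c by rewrite exprn_gt0// expR_gt0.
exists (2 / c); first by rewrite divr_gt0.
move=> s e e0; pose M := lint setT (bumpf s e).
have M_ge : ((c * (e / 2))%:E <= M)%E.
  rewrite (_ : (c * (e / 2))%:E = lint `[s + e / 4, s + e / 4 + e / 2] (fun=> c)).
    apply: lint_le => //; rewrite ?ltW// => x; first exact: bump_ge0.
    rewrite /= in_itv/= => /andP[x1 x2]; rewrite /c expr2 /bumpf.
    apply: ler_pM; rewrite ?expR_ge0//; apply: flat0_ge.
      rewrite ler_pdivlMr// lerBrDl; apply: le_trans x1; lra.
    rewrite lerBrDl -lerBrDr ler_pdivrMr// lerBlDl.
    apply: le_trans x2 _; rewrite le_eqVlt; apply/orP; left; apply/eqP; lra.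
  rewrite lint_cst ?(ltW c0)// lebesgue_measure_itv/= lte_fin ltrDl divr_gt0//.
  by rewrite -EFinB -EFinM; congr (_ * _)%:E; lra.
have M_le : (M <= e%:E)%E.
  rewrite (_ : e%:E = lint `[s, s + e] (fun=> 1)); last first.
    rewrite lint_cst// lebesgue_measure_itv/= lte_fin ltrDl e0 mul1e -EFinB.
    by congr EFin; lra.
  rewrite /M (@lint_supp _ `[s, s + e] setT)//; last 2 first.
  - by move=> x; exact: bump_ge0.
  - by move=> x _; exact: bump_out.
  by apply: lint_le => // x; [exact: bump_ge0|move=> _; exact: bump_le1].
have fM : M \is a fin_num by rewrite ge0_fin_numE ?(le_lt_trans M_le) ?ltry//; apply: lint_ge0 => x; exact: bump_ge0.
have M0 : c * (e / 2) <= fine M by rewrite -lee_fin fineK.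
have ce0 : 0 < c * (e / 2) by rewrite mulr_gt0// divr_gt0.
have Mp : 0 < fine M by exact: lt_le_trans M0.
exists (fun x => (fine M)^-1 * bumpf s e x); split.
- by apply: smoothM; [exact: smooth_cst|exact: smooth_bump].
- by move=> x; rewrite mulr_ge0 ?bump_ge0// invr_ge0 ltW.
- by move=> x /(bump_out e0) ->; rewrite mulr0.
- move=> x; apply: (@le_trans _ _ (fine M)^-1).
    by rewrite -[leRHS]mulr1 ler_wpM2l ?bump_le1// invr_ge0 ltW.
  apply: le_trans (_ : (c * (e / 2))^-1 <= _); first by rewrite lef_pV2.
  rewrite le_eqVlt; apply/orP; left; apply/eqP; field.
  by rewrite !gt_eqF.
- rewrite lintZ ?invr_ge0 ?(ltW Mp)//.
  + by rewrite -/M -(fineK fM) -EFinM mulVf// gt_eqF.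
  + by move=> x; exact: bump_ge0.
  + by apply: aem_measurable; apply: smooth_measurable; exact: smooth_bump.
Qed.

Section primitive.
Variables (rho : R -> R) (s e : R) (e0 : 0 < e).
Hypotheses (srho : smooth rho) (rho0 : forall x, 0 <= rho x)
  (rhoE : forall x, ~ `[s, s + e]%classic x -> rho x = 0) (irho : lint setT rho = 1%E).

(** The difference of the primitives of two mollifiers is a test function: it vanishes
    on the left of both supports, and on the right since both masses are 1. *)
Definition primitive (x : R) := fine (lint `]-oo, x] rho).

Let prim_le1 x : (lint `]-oo, x] rho <= 1)%E.
Proof. by rewrite -irho; exact: lint_le. Qed.

Let prim_fin x : lint `]-oo, x] rho \is a fin_num.
Proof. by rewrite ge0_fin_numE ?lint_ge0// (le_lt_trans (prim_le1 x))// ltry. Qed.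

Lemma primitive_itv x : 0 <= primitive x <= 1.
Proof.
by rewrite -2!lee_fin fineK ?lint_ge0//=; exact: prim_le1.
Qed.

Lemma primitive_left x : x < s -> primitive x = 0.
Proof.
move=> xs; rewrite /primitive (@lint_eq_ae _ _ _ (fun=> 0)) ?lint0//.
apply: aeT => t; rewrite /= in_itv/= => tx; apply: rhoE => /=; apply/negP.
by rewrite in_itv/= negb_and -ltNge (le_lt_trans tx xs).
Qed.

Lemma primitive_right x : s + e < x -> primitive x = 1.
Proof.
move=> xs; rewrite /primitive -(@lint_supp _ _ setT)// ?irho// => t _ /=.
rewrite in_itv/= => /negP; rewrite -ltNge => xt; apply: rhoE => /=; apply/negP.
by rewrite in_itv/= negb_and -!ltNge (lt_trans xs xt) orbT.
Qed.

Lemma primitive_is_derive (x : R) : is_derive x 1 primitive (rho x).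
Proof.
have ix : mu.-integrable `]-oo, x + 1] (EFin \o rho).
  apply/integrableP; split.
    apply/measurable_EFinP; apply: measurable_funS (smooth_measurable srho) => //.
  apply: le_lt_trans (ltry 1); rewrite -irho.
  rewrite (_ : integral _ _ _ = lint `]-oo, (x + 1)%R] rho)%E; last first.
    by rewrite /lint; apply: eq_integral => t _ /=; rewrite ger0_norm.
  exact: lint_le.
have xx1 : x < x + 1 by rewrite ltrDl.
have cx : {for x, continuous rho} by exact: (smooth_continuous srho).
have [] := @continuous_FTC1 R rho (BInfty R true) x (x + 1) xx1 ix _ cx.
  by rewrite ltNyr.
by rewrite derive1E => h1 h2; apply: DeriveDef.
Qed.

Lemma smooth_primitive_mollifier : smooth primitive.
Proof. by apply: smooth_primitive srho; exact: primitive_is_derive. Qed.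

End primitive.

End mollifier.

(** * Increments and the weak derivative *)

Section weak_derivative.
Variables (R : realType) (X : completeNormedModType R).
Local Notation mu := (@lebesgue_measure R).
Implicit Types (u v w : R -> X).

Lemma within_continuousP (I : set R) u : {within I, continuous u} <->
  forall x, I x -> forall e, 0 < e -> exists2 d, 0 < d &
    forall y, I y -> `|y - x| < d -> `|u y - u x| <= e.
Proof.
split => [/subspace_continuousP cu x Ix e e0|H].
  have /cvgrPdistC_le/(_ _ e0)[d /= d0 dP] := cu x Ix.
  by exists d => // y Iy yx; apply: dP => //=; rewrite distrC.
apply/subspace_continuousP => x Ix; rewrite /from_subspace; apply/cvgrPdistC_le => e e0.
have [d d0 dP] := H x Ix e e0; exists d => //= y /= yx Iy.
by apply: dP => //; rewrite distrC.
Qed.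

Section interval.
Variables (a b : R) (c : bool).
Let I := [set` Interval (BLeft a) (BSide c b)].

Lemma itv_measurable : measurable (I : set R).
Proof. exact: measurable_itv. Qed.

Lemma itv_finite : (mu I < +oo)%E.
Proof.
apply: (@le_lt_trans _ _ (mu `[a, b])).
  apply: le_measure; rewrite ?inE//; first exact: itv_measurable.
  by apply: subset_itvl; rewrite bnd_simp; case: c.
by rewrite lebesgue_measure_itv/=; case: ifP => _; rewrite ?ltry// -EFinB ltry.
Qed.

Lemma itv_oo_sub : `]a, b[ `<=` I.
Proof. by apply: subset_itv; rewrite bnd_simp//; case: c. Qed.

Lemma itv_interiorE : interior I = `]a, b[%classic.
Proof. by rewrite /I interior_itv. Qed.

Lemma itv_cc_interior s t : a < s -> t < b -> `[s, t] `<=` interior I.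
Proof.
by move=> as_ tb; rewrite itv_interiorE; apply: subset_itv; rewrite bnd_simp.
Qed.

Let mI := itv_measurable.
Let fI := itv_finite.

(** Testing with a function [phi] such that [phi'] is the difference of a mollifier
    near [s] and one near [t], while [|phi| <= 1] is supported in [[s, t]]: by continuity
    the two averages of [u] are close to [u s] and [u t]. *)
Lemma weak_derivative_increment_in u v s t : a < s -> s < t -> t < b ->
  {within I, continuous u} -> is_weak_derivative I u v ->
  (`|u t - u s|%:E <= lint `[s, t] (fun x => `|v x|)%R)%E.
Proof.
move=> as_ st tb cu uv.
have sI : `[s, t] `<=` I.
  by apply: subset_trans itv_oo_sub; apply: subset_itv; rewrite bnd_simp.
apply/lee_addgt0Pr => eta' eta0; pose eta := eta' / 2.
have eta_gt0 : 0 < eta by rewrite divr_gt0.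
have near_u x0 : a < x0 < b -> exists2 d, 0 < d & forall x, `|x - x0| <= d -> `|u x - u x0| <= eta.
  move=> x0I; have xI : I x0 by apply: itv_oo_sub; rewrite /= in_itv.
  have [d d0 dP] := (within_continuousP I u).1 cu x0 xI _ eta_gt0.
  case/andP: x0I => ax xb.
  pose d' := Num.min (d / 2) (Num.min ((x0 - a) / 2) ((b - x0) / 2)).
  have [h1 h2 h3] : [/\ d' <= d / 2, d' <= (x0 - a) / 2 & d' <= (b - x0) / 2].
    by split; rewrite /d' !ge_min lexx ?orbT.
  exists d'; first by rewrite /d' !lt_min !divr_gt0// subr_gt0.
  move=> x xd'; apply: dP; last by lra.
  apply: itv_oo_sub; rewrite /= in_itv/=; move: xd'; rewrite ler_norml => /andP[h4 h5].
  by apply/andP; split; lra.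
have [d1 d10 near1] : exists2 d, 0 < d & forall x, `|x - s| <= d -> `|u x - u s| <= eta.
  by apply: near_u; rewrite as_ (lt_trans st).
have [d2 d20 near2] : exists2 d, 0 < d & forall x, `|x - t| <= d -> `|u x - u t| <= eta.
  by apply: near_u; rewrite tb (lt_trans as_).
pose e := Num.min (t - s) (Num.min d1 d2).
have e0 : 0 < e by rewrite /e !lt_min subr_gt0 st d10.
have e_ts : e <= t - s by rewrite /e ge_min lexx.
have e_d1 : e <= d1 by rewrite /e !ge_min lexx orbT.
have e_d2 : e <= d2 by rewrite /e !ge_min lexx !orbT.
have [K _ moll] := mollifier_exists R.
have [r1 [sr1 r1_ge0 r1_out _ ir1]] := moll s e e0.
have [r2 [sr2 r2_ge0 r2_out _ ir2]] := moll (t - e) e e0.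
rewrite subrK in r2_out.
pose P1 := primitive r1; pose P2 := primitive r2.
pose phi x := P1 x + (-1) * P2 x.
have sphi : smooth phi.
  apply: smoothD; first exact: smooth_primitive_mollifier.
  apply: smoothM; first exact: smooth_cst.
  exact: smooth_primitive_mollifier.
have r2_out' x : ~ `[t - e, t - e + e]%classic x -> r2 x = 0 by rewrite subrK; exact: r2_out.
have phi_out x : ~ `[s, t]%classic x -> phi x = 0.
  move=> /= /negP; rewrite in_itv/= negb_and -!ltNge => /orP[xs|tx].
    rewrite /phi /P1 (primitive_left r1_ge0 r1_out)// /P2 (primitive_left r2_ge0 r2_out')//.
      by rewrite mulr0 addr0.
    by apply: lt_le_trans xs _; rewrite lerBrDl addrC -lerBrDl.
  rewrite /phi /P1 /P2 (primitive_right r1_ge0 r1_out ir1)// ?(primitive_right r2_ge0 r2_out' ir2)//.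
  - by rewrite mulr1 subrr.
  - by rewrite subrK.
  - by apply: le_lt_trans tx; rewrite -lerBrDl.
have phi_le1 x : `|phi x| <= 1.
  have /andP[p1 p1'] := primitive_itv r1_ge0 ir1 x.
  have /andP[p2 p2'] := primitive_itv r2_ge0 ir2 x.
  by rewrite /phi mulN1r ler_norml; apply/andP; split; rewrite /P1 /P2; lra.
have dphi x : derive1 phi x = r1 x - r2 x.
  rewrite derive1E.
  have h1 := primitive_is_derive sr1 r1_ge0 ir1 x.
  have h2 := primitive_is_derive sr2 r2_ge0 ir2 x.
  have [_ ->] := is_deriveD h1 (is_deriveZ (-1) h2).
  by rewrite /GRing.scale/= mulN1r.
have [|y [by1 by2]] := uv phi.
  by apply: (smooth_test sphi _ phi_out); exact: itv_cc_interior.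
have supp1 : lint I r1 = 1%E.
  rewrite -ir1; apply/esym/lint_supp => // x _ Ix; apply: r1_out => /= xs; apply: Ix.
  by apply: sI; move: xs; rewrite /= !in_itv/= => /andP[-> /=]/le_trans; apply; rewrite -lerBrDl.
have supp2 : lint I r2 = 1%E.
  rewrite -ir2; apply/esym/lint_supp => // x _ Ix; apply: r2_out => /= xs; apply: Ix.
  apply: sI; move: xs; rewrite /= !in_itv/= => /andP[h ->]; rewrite andbT.
  by apply: le_trans h; rewrite lerBrDl addrC -lerBrDl.
have bc1 := bint_cst_mul mI fI (u s) (smooth_measurable sr1) r1_ge0.
have bc2 := bint_cst_mul mI fI (u t) (smooth_measurable sr2) r2_ge0.
rewrite supp1 /= scale1r in bc1; rewrite supp2 /= scale1r in bc2.
have {}bc1 := bc1 (ltry _); have {}bc2 := bc2 (ltry _).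
have bdiff := bint_lin mI fI 1 (bint_lin mI fI (-1) bc1 by1) bc2.
have := bint_norm mI fI bdiff.
have est : (lint I (fun x => `|1 *: (-1 *: (r1 x *: u s) + phi^`()%classic x *: u x) +
                               r2 x *: u t|)%R <= (eta + eta)%:E)%E.
  have -> : ((eta + eta)%:E = lint I (fun x => eta * r1 x + eta * r2 x)%R)%E.
    rewrite lintD//.
    - rewrite !lintZ// ?supp1 ?supp2 ?mule1 ?EFinD// ?ltW//.
      + by apply: aem_measurable; exact: smooth_measurable.
      + by apply: aem_measurable; exact: smooth_measurable.
    - by move=> x; rewrite mulr_ge0// ltW.
    - by move=> x; rewrite mulr_ge0// ltW.
    - by apply: aemZ; apply: aem_measurable; exact: smooth_measurable.
    - by apply: aemZ; apply: aem_measurable; exact: smooth_measurable.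
  apply: lint_le => // x.
    by rewrite addr_ge0// mulr_ge0// ltW.
  move=> _; rewrite dphi scale1r scaleN1r scalerBl.
  rewrite (_ : _ + r2 x *: u t = r1 x *: (u x - u s) - r2 x *: (u x - u t)); last first.
    rewrite !scalerBr opprB; set p := r1 x *: u s; set q := r1 x *: u x.
    by rewrite addrA [- p + q]addrC -[LHS]addrA [- _ + _]addrC.
  apply: le_trans (ler_normB _ _) _; rewrite !normrZ !ger0_norm//.
  apply: lerD; rewrite mulrC.
    have [xs|/r1_out->] := pselect (`[s, s + e]%classic x); last by rewrite !mulr0.
    apply: ler_wpM2r => //; apply: near1; move: xs; rewrite /= in_itv/= => /andP[h1 h2].
    by rewrite ger0_norm ?subr_ge0// lerBlDl (le_trans h2)// lerD2l.
  have [xs|/r2_out->] := pselect (`[t - e, t]%classic x); last by rewrite !mulr0.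
  apply: ler_wpM2r => //; apply: near2; move: xs; rewrite /= in_itv/= => /andP[h1 h2].
  by rewrite distrC ger0_norm ?subr_ge0// lerBlDl -lerBlDr (le_trans _ h1)// lerD2l lerN2.
move=> /le_trans/(_ est); rewrite scale1r scaleN1r => est1.
have est2 : (`|y|%:E <= lint `[s, t] (fun x => `|v x|)%R)%E.
  have := bint_norm mI fI by2; rewrite normrN => /le_trans; apply.
  rewrite (@lint_supp _ `[s, t] I)//.
  - apply: lint_le => // x _; rewrite normrZ -[leRHS]mul1r.
    by apply: ler_wpM2r.
  - by move=> x _ /phi_out ->; rewrite scale0r normr0.
have -> : u t - u s = (- u s + y + u t) - y.
  by rewrite addrAC addrC addrK addrC.
apply: (@le_trans _ _ (`|y|%:E + `|- u s + y + u t|%:E)%E).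
  by rewrite -EFinD lee_fin [leRHS]addrC ler_normB.
by apply: leeD => //; apply: le_trans est1 _; rewrite lee_fin /eta -splitr.
Qed.

End interval.

End weak_derivative.

(** * Uniqueness of the weak derivative *)

Section weak_derivative_unique.
Variables (R : realType) (X : completeNormedModType R).
Local Notation mu := (@lebesgue_measure R).
Implicit Types (u v w : R -> X).

Lemma ae_countable (Z : choiceType) (D : set Z) (P : Z -> R -> Prop) : countable D ->
  (forall d, D d -> {ae mu, forall t, P d t}) -> {ae mu, forall t, forall d, D d -> P d t}.
Proof.
move=> /countable_injP[f finj] DP.
pose F n := [set t | exists d, [/\ D d, f d = n & ~ P d t]].
suff : mu.-negligible (\bigcup_n F n).
  apply: negligibleS => t /= /existsNP[d /not_implyP[Dd nP]].
  by exists (f d) => //; exists d.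
apply: negligible_bigcup => n; have [[d [Dd fd]]|nD] := pselect (exists d, D d /\ f d = n).
  apply: negligibleS (DP d Dd) => t [d' [Dd' fd' nP]] /= Pd; apply: nP.
  by rewrite (finj d' d) ?inE// fd fd'.
apply: (@negligibleS _ _ _ _ set0); last exact: negligible_set0.
by move=> t [d [Dd fd _]]; apply: nD; exists d.
Qed.

Section interval.
Variables (a b : R) (c : bool).
Let I := [set` Interval (BLeft a) (BSide c b)].
Let mI : measurable I := itv_measurable a b c.
Let fI : (mu I < +oo)%E := itv_finite a b c.

(** If the mollified averages of [Om] vanish, those of [Om - d] are [- d]. Their norm is
    also at most a constant times the average of [|Om - d|] over a ball around [t],
    which tends to its value at [t] if [t] is a Lebesgue point. *)
Lemma mollified_bound (K : R) (Om : R -> X) (d : X) (g : R -> R) (t : R) : 0 < K ->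
  (forall s e : R, 0 < e ->
      exists rho : R -> R, [/\ smooth rho, forall x, 0 <= rho x,
    forall x, ~ `[s, s + e]%classic x -> rho x = 0,
    forall x, rho x <= K / e & lint setT rho = 1%E]) ->
  (forall rho, smooth rho -> is_bochner_integral I (fun x => rho x *: Om x) 0) ->
  measurable_fun setT g -> (forall x, 0 <= g x) ->
  {ae mu, forall x, I x -> `|Om x - d| = g x} ->
  a < t < b -> lebesgue_pt g t ->
  `|d| <= 4 * K * g t.
Proof.
move=> K0 moll Om0 mg g0 Omg /andP[a_t tb] leb.
apply/ler_addgt0Pr => eta eta0.
pose eps := eta / (4 * K); have eps0 : 0 < eps by rewrite divr_gt0// mulr_gt0.
have leb' : \forall r \near (0:R)^'+, (davg g t r < eps%:E)%E.
  by move: leb => /fine_cvgP[fin /cvgr0_norm_lt/(_ _ eps0)]; apply: filterS2 fin => r fin /=;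
    rewrite ger0_norm ?fine_ge0 ?iavg_ge0// -{2}(fineK fin) lte_fin.
have [r [r0 rb davg_lt]] : exists r, [/\ 0 < r, t + r / 2 < b & (davg g t r < eps%:E)%E].
  near (0:R)^'+ => r; exists r; split.
  - by near: r; exact: nbhs_right_gt.
  - rewrite -ltrBrDl ltr_pdivrMr//; near: r; apply: nbhs_right_lt.
    by rewrite mulr_gt0// subr_gt0.
  - by near: r.
have r20 : 0 < r / 2 by rewrite divr_gt0.
have [rho [srho rho0 rho_out rho_le irho]] := moll t (r / 2) r20.
have sI : `[t, t + r / 2] `<=` I.
  apply: subset_trans (@itv_oo_sub _ a b c); apply: subset_itv; rewrite bnd_simp//.
have supp : lint I rho = 1%E.
  by rewrite -irho; apply/esym/lint_supp => // x _ Ix; apply: rho_out => /sI.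
have bd := bint_cst_mul mI fI d (smooth_measurable srho) rho0.
rewrite supp /= scale1r in bd; have {}bd := bd (ltry _).
have /(bint_norm mI fI) := bint_lin mI fI (-1) bd (Om0 _ srho).
rewrite addr0 scaleN1r normrN => /le_trans H.
have {H} := H (lint (ball t r) (fun x => 2 * K / r * g x)%R).
have le1 : (lint I (fun x => `|-1 *: (rho x *: d) + rho x *: Om x|)%R <=
  lint (ball t r) (fun x => (2 * K / r) * g x)%R)%E.
  have Kr0 : 0 <= 2 * K / r by rewrite divr_ge0 ?ltW// mulr_gt0.
  rewrite (@lint_supp _ `[t, t + r / 2] I)//; last first.
    by move=> x _ /rho_out ->; rewrite !scale0r scaler0 addr0 normr0.
  apply: lint_le_ae => // [x|]; first by rewrite mulr_ge0.
  apply: aeS Omg => x Omx /= xt; split.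
    rewrite -ball_normE /ball_/=; move: xt; rewrite in_itv/= => /andP[h1 h2].
    by rewrite distrC ger0_norm ?subr_ge0// ltrBlDl (le_lt_trans h2)// ltrD2l ltr_pdivrMr// ltr_pMr// ltr1n.
  rewrite -Omx; last exact: sI.
  rewrite scaleN1r addrC -scalerBr normrZ ger0_norm// ler_wpM2r//.
  apply: le_trans (rho_le x) _; rewrite le_eqVlt; apply/orP; left; apply/eqP; field.
  by rewrite gt_eqF.
move=> /(_ le1); have mball : measurable (ball t r) by exact: measurable_ball.
have mu_ball : mu (ball t r) = (2 * r)%:E.
  by rewrite lebesgue_measure_ball ?ltW// mulr_natl.
rewrite lintZ//; last 2 first.
- by rewrite divr_ge0 ?ltW// mulr_gt0.
- exact: aem_measurable.
have : (lint (ball t r) g <= (2 * r * (eps + g t))%:E)%E.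
  have avg : (lint (ball t r) (fun y => `|g y - g t|)%R <= (2 * r * eps)%:E)%E.
    move: davg_lt; rewrite /davg /iavg mu_ball => /ltW davg_le.
    have r2 : 0 < 2 * r by rewrite mulr_gt0.
    have : ((2 * r)%:E * (((2 * r)%:E)^-1 * lint (ball t r) (fun y => `|g y - g t|)%R) <=
            (2 * r)%:E * eps%:E)%E.
      by apply: lee_wpmul2l => //; rewrite lee_fin ltW.
    by rewrite muleA inver gt_eqF// -EFinM mulfV ?gt_eqF// mul1e -EFinM.
  have cst_int : ((2 * r * g t)%:E = lint (ball t r) (fun=> g t))%E.
    by rewrite lint_cst// mu_ball -EFinM mulrC.
  apply: (@le_trans _ _ (lint (ball t r) (fun y => `|g y - g t|)%R +
                         lint (ball t r) (fun=> g t)))%E.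
    rewrite -lintD//.
    - apply: lint_le => // y; rewrite ?addr_ge0// => _.
      by rewrite -lerBlDr ler_norm.
    - apply: aem_measurable; apply: measurableT_comp => //.
      by apply: measurable_funB => //.
    - exact: aem_measurable.
  by rewrite mulrDr EFinD cst_int leeD2r.
move=> h1 h2.
have k0 : (0 <= (2 * K / r)%:E)%E by rewrite lee_fin divr_ge0 ?ltW// mulr_gt0.
move: (le_trans h2 (lee_wpmul2l k0 h1)); rewrite -EFinM lee_fin => /le_trans; apply.
rewrite le_eqVlt; apply/orP; left; apply/eqP.
by rewrite /eps; field; rewrite !gt_eqF.
Unshelve. all: by end_near. Qed.

Lemma ae_itv_oo : {ae mu, forall t, I t -> a < t < b}.
Proof.
have n0 (x : R) : mu.-negligible [set x].
  by exists [set x]; split => //; rewrite lebesgue_measure_set1.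
apply: negligibleS (negligibleU (n0 a) (n0 b)) => t.
move=> /= /not_implyP[It /negP]; rewrite negb_and -!leNgt => /orP[ta|bt].
  + left; apply/eqP; rewrite eq_le ta/=; move: It; rewrite /I /= itv_boundlr.
    by move=> /andP[].
  + right; apply/eqP; rewrite eq_le bt andbT; move: It; rewrite /I /= itv_boundlr.
    by move=> /andP[_]; case: (c); rewrite bnd_simp// => /ltW.
Qed.

(** The simple functions approximating [Om] take countably many values [d], and almost
    every [t] is a Lebesgue point of all the functions [|Om - d|]. At such a point
    [|d| <= 4 K |Om t - d|], and letting [d] tend to [Om t] gives [Om t = 0]. *)
Lemma bint_mollified_eq0 (Om : R -> X) :
  (forall rho, smooth rho -> is_bochner_integral I (fun x => rho x *: Om x) 0) ->
  {ae mu, forall t, I t -> Om t = 0}.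
Proof.
move=> Om0; have [K K0 moll] := mollifier_exists R.
have bOm : is_bochner_integral I Om 0.
  apply: bint_eq (Om0 (fun=> 1) (smooth_cst 1)) => //.
  by apply: aeT => t _; rewrite scale1r.
have mOm := bint_smeas mI fI bOm; have iOm := bint_norm_lty mI fI bOm.
have [s ss sOm] := (smeasP I Om).1 mOm.
pose D := \bigcup_k range (s k).
have cD : countable D.
  by apply: bigcup_countable => // k _; apply: finite_set_countable; case: (ss k).
have bound d : D d -> {ae mu, forall t, I t -> `|d| <= 4 * K * `|Om t - d|}.
  move=> _; have md := smeas_fsimple I (fsimple_cst R d).
  have [g [mg g0 Omg]] := aem_ge0 (fun t => normr_ge0 (Om t - d))
    (smeas_dist_aem mI mOm md).
  pose h t := g t * \1_I t.
  have mh : measurable_fun setT h by apply: measurable_funM => //; exact: measurable_indic.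
  have h0 t : 0 <= h t by rewrite mulr_ge0.
  have Omh : {ae mu, forall t, I t -> `|Om t - d| = h t}.
    by apply: aeS Omg => t + It => /(_ It); rewrite /h indicE mem_set// mulr1.
  have ih : (lint setT h < +oo)%E.
    rewrite (@lint_supp _ I setT)//; last first.
      by move=> t _ It; rewrite /h indicE memNset// mulr0.
    rewrite -(lint_eq_ae _ _ Omh)//.
    have := lint_norm_triangle mI (smeasB mOm md) mOm => /le_lt_trans; apply.
    rewrite lte_add_pinfty//.
    rewrite (@lint_eq_ae _ _ _ (fun=> `|d|))//.
      rewrite lint_cst// lte_mul_pinfty//.
    by apply: aeT => t _; rewrite addrAC subrr add0r normrN.
  have loc : locally_integrable setT h.
    apply: open_integrable_locally; first exact: openT.
    apply/integrableP; split; first exact/measurable_EFinP.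
    apply: le_lt_trans ih; rewrite le_eqVlt; apply/orP; left; apply/eqP.
    by rewrite /lint; apply: eq_integral => t _ /=; rewrite ger0_norm.
  apply: aeS2 (lebesgue_differentiation loc) (aeI ae_itv_oo Omh) => t leb [tI Oht] It.
  rewrite Oht//; apply: (mollified_bound K0 moll Om0 mh h0 Omh) => //.
  exact: tI.
have {}bound := ae_countable cD bound.
apply: aeS2 sOm bound => t sOm bound It.
have {}sOm := sOm It.
have lim0 : (fun k => 4 * K * `|Om t - s k t|) @ \oo --> (0 : R).
  rewrite -(mulr0 (4 * K)); apply: cvgM; first exact: cvg_cst.
  apply/norm_cvg0P; rewrite -(subrr (Om t)); apply: cvgB => //; exact: cvg_cst.
have s0 : (fun k => `|s k t|) @ \oo --> (0 : R).
  apply: (squeeze_cvgr _ _ lim0); last exact: cvg_cst.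
  by apply: nearW => k; rewrite normr_ge0 bound//; exists k => //; exists t.
have s0' : (fun k => s k t) @ \oo --> (0 : X) by apply/norm_cvg0P.
exact: (cvg_unique _ sOm s0').
Qed.

(** The difference of two weak derivatives, multiplied by a test function [phi] that
    is positive inside the interval, has vanishing mollified averages: the product of
    [phi] with a smooth function is again a test function. *)
Lemma weak_derivative_unique u v w : is_weak_derivative I u v ->
  is_weak_derivative I u w -> {ae mu, forall t, I t -> v t = w t}.
Proof.
move=> uv uw.
pose An (n : nat) := [set t : R | a + n.+1%:R^-1 < t /\ t < b - n.+1%:R^-1].
have An0 n : {ae mu, forall t, I t -> An n t -> v t = w t}.
  pose an := a + n.+1%:R^-1; pose e := b - n.+1%:R^-1 - an.
  have [e0|e0] := ltP 0 e; last first.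
    apply: aeT => t _ [h1 h2]; exfalso; have := lt_trans h1 h2.
    by rewrite ltNge -subr_le0 -/an -/e e0.
  have ane : an + e = b - n.+1%:R^-1 by rewrite /e addrC subrK.
  have n0 : 0 < n.+1%:R^-1 :> R by rewrite invr_gt0.
  have h0 : {ae mu, forall t, I t -> bumpf an e t *: (v t - w t) = 0}.
    apply: bint_mollified_eq0 => rho srho.
    pose phi x := rho x * bumpf an e x.
    have tphi : test_function I phi.
      apply: (@smooth_test _ _ _ an (an + e)).
      - by apply: smoothM => //; exact: smooth_bump.
      - by apply: itv_cc_interior; rewrite ?ane ?ltrBlDr ltrDl.
      - by move=> x /(bump_out e0) h; rewrite /phi h mulr0.
    have [y [y1 y2]] := uv _ tphi; have [z [z1 z2]] := uw _ tphi.
    have yz : y = z by apply: (bint_unique mI fI _ y1 z1); exact: aeT.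
    have := bint_lin mI fI (-1) z2 y2; rewrite yz scaleN1r opprK subrr.
    apply: bint_eq => //; apply: aeT => t _.
    by rewrite /phi scaleN1r addrC -scalerBr scalerA.
  apply: aeS h0 => t h0 It [t1 t2]; apply/eqP; rewrite -subr_eq0; apply/eqP.
  have /eqP := h0 It; rewrite scaler_eq0 gt_eqF/=; first by move/eqP.
  by apply: bump_gt0 => //; rewrite t1 ane.
have := @ae_countable nat setT (fun n t => I t -> An n t -> v t = w t) _ (fun n _ => An0 n).
move=> /(_ (countableP _)) H.
apply: aeS2 H ae_itv_oo => t H tI It; have /andP[h1 h2] := tI It.
pose d := Num.min (t - a) (b - t); have d0 : 0 < d by rewrite lt_min !subr_gt0 h1.
have [n nd] : exists n : nat, n.+1%:R^-1 < d.
  exists (Num.truncn d^-1); rewrite invf_plt ?posrE//; exact: truncnS_gt.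
apply: (H n Logic.I It) => //; split.
  by rewrite addrC -ltrBrDr; apply: lt_le_trans nd _; rewrite ge_min lexx.
by rewrite ltrBrDl -ltrBrDr; apply: lt_le_trans nd _; rewrite ge_min lexx orbT.
Qed.

Lemma weak_derivativeP u v : is_weak_derivative I u v ->
  is_weak_derivative I u (weak_derivative I u).
Proof.
move=> uv; have : exists v, [set v | is_weak_derivative I u v] v by exists v.
exact: (@xgetPex _ (fun=> 0)).
Qed.

Lemma weak_derivativeE u v : is_weak_derivative I u v ->
  {ae mu, forall t, I t -> weak_derivative I u t = v t}.
Proof. by move=> uv; exact: (weak_derivative_unique (weak_derivativeP uv) uv). Qed.

Lemma is_weak_derivative_lin (k : R) u u' v v' : is_weak_derivative I u v ->
  is_weak_derivative I u' v' ->
  is_weak_derivative I (fun t => k *: u t + u' t) (fun t => k *: v t + v' t).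
Proof.
move=> uv uv' phi tphi.
have [y [y1 y2]] := uv _ tphi; have [z [z1 z2]] := uv' _ tphi.
exists (k *: y + z); split.
  apply: bint_eq (bint_lin mI fI k y1 z1) => //; apply: aeT => t _.
  by rewrite scalerDr !scalerA mulrC.
rewrite opprD -scalerN; apply: bint_eq (bint_lin mI fI k y2 z2) => //; apply: aeT => t _.
by rewrite scalerDr !scalerA mulrC.
Qed.

Lemma is_weak_derivative_eq u u' v v' : {ae mu, forall t, I t -> u t = u' t} ->
  {ae mu, forall t, I t -> v t = v' t} ->
  is_weak_derivative I u v -> is_weak_derivative I u' v'.
Proof.
move=> uu' vv' uv phi /uv[y [y1 y2]]; exists y; split.
  by apply: bint_eq y1 => //; apply: aeS uu' => t h It; rewrite h.
by apply: bint_eq y2 => //; apply: aeS vv' => t h It; rewrite h.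
Qed.

Lemma is_weak_derivative_restrict (a' b' : R) (c' : bool) u v :
  let J := [set` Interval (BLeft a') (BSide c' b')] in J `<=` I ->
  is_weak_derivative I u v -> is_weak_derivative J u v.
Proof.
move=> J JI uv phi [sphi [s [t [stJ phi0]]]].
have mJ : measurable J := itv_measurable a' b' c'.
have [|y [y1 y2]] := uv phi.
  split => //; exists s, t; split => //; apply: subset_trans stJ _.
  exact: interiorS.
have dphi0 x : ~ `[s, t]%classic x -> derive1 phi x = 0.
  move=> xst; rewrite derive1E.
  have : (\near x, phi x = (fun=> 0) x).
    have : open_nbhs x (~` `[s, t]).
      by split => //; apply: closed_openC; exact: itv_closed.
    by move/open_nbhs_nbhs; apply: filterS => z; exact: phi0.
  by move/(near_eq_derive (1 : R)) ->; rewrite derive_cst.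
have sJ : `[s, t] `<=` J by apply: subset_trans stJ _; exact: interior_subset.
exists y; split; apply: bint_restrict mI fI mJ JI _ _.
- by move=> x _ Jx; rewrite dphi0 ?scale0r// => /sJ.
- exact: y1.
- by move=> x _ Jx; rewrite phi0 ?scale0r// => /sJ.
- exact: y2.
Qed.

End interval.
End weak_derivative_unique.

(** * The spaces of maximal regularity *)

Section spaces.
Variables (R : realType) (X : completeNormedModType R) (A : linear_operator X) (p : R).
Hypothesis p1 : 1 < p.
Local Notation mu := (@lebesgue_measure R).
Implicit Types (I J : set R) (u v h : R -> X).

Let p0 : 0 < p. Proof. exact: lt_trans p1. Qed.
Let p1' : 1 <= p. Proof. exact: ltW. Qed.

Local Notation LpX I := (Lp_mem p I (whole_space X)).

Lemma Lp_normE I u : Lp_norm p I (whole_space X) u = lpn p I (fun t => `|u t|)%R.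
Proof. by []. Qed.

Lemma Lp_norm_graphE I u :
  Lp_norm p I (graph_space A) u = lpn p I (fun t => `|u t| + `|A (u t)|)%R.
Proof. by []. Qed.

Lemma LpXP I u : LpX I u <-> smeas I u /\ (lpn p I (fun t => `|u t|)%R < +oo)%E.
Proof. by rewrite /Lp_mem lpn_lty. Qed.

Lemma LpAP I u : Lp_mem p I (graph_space A) u <->
  strongly_measurable (graph_space A) I u /\
  (lpn p I (fun t => `|u t| + `|A (u t)|)%R < +oo)%E.
Proof. by rewrite /Lp_mem lpn_lty. Qed.

Local Opaque lint lpn weak_derivative is_weak_derivative.

Lemma LpX_sub I J u : J `<=` I -> LpX I u -> LpX J u.
Proof.
move=> JI /LpXP[mu_ fu]; apply/LpXP; split; first exact: smeas_sub mu_.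
by apply: le_lt_trans fu; apply: lpn_le.
Qed.

Lemma LpX_eq I u v : {ae mu, forall t, I t -> u t = v t} -> LpX I v -> LpX I u.
Proof.
move=> uv /LpXP[mv fv]; apply/LpXP; split; first exact: smeas_eq mv.
rewrite (@lpn_eq_ae _ _ _ _ (fun t => `|v t|))//.
by apply: aeS uv => t uv It; rewrite uv.
Qed.

Lemma Lp_norm_triangle I u v (k : R) : measurable I -> smeas I u -> smeas I v ->
  (lpn p I (fun t => `|(k *: u t + v t)%R|)%R <=
   `|k|%:E * lpn p I (fun t => `|u t|)%R + lpn p I (fun t => `|v t|)%R)%E.
Proof.
move=> mI mu_ mv.
have h1 := smeas_norm_aem mI mu_; have h2 := smeas_norm_aem mI mv.
have n1 t : 0 <= `|k| * `|u t| by rewrite mulr_ge0.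
rewrite -lpnZ//; apply: le_trans (lpnD mI p1' n1 (fun t => normr_ge0 (v t)) (aemZ _ h1) h2).
apply: lpn_le => // t _.
by apply: le_trans (ler_normD _ _) _; rewrite normrZ.
Qed.

Lemma LpX_lin I u v (k : R) : measurable I -> LpX I u -> LpX I v ->
  LpX I (fun t => k *: u t + v t).
Proof.
move=> mI /LpXP[mu_ fu] /LpXP[mv fv]; apply/LpXP; split; first exact: smeas_lin.
apply: le_lt_trans (Lp_norm_triangle k mI mu_ mv) _.
apply: lte_add_pinfty; last exact: fv.
by apply: lte_mul_pinfty; [|by []|exact: fu].
Qed.

Lemma LpX_restrict I J u : measurable I -> measurable J -> LpX (I `&` J) u ->
  LpX I (fun t => if t \in J then u t else 0) /\
  lpn p I (fun t => `|if t \in J then u t else 0|)%R = lpn p (I `&` J) (fun t => `|u t|)%R.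
Proof.
move=> mI mJ /LpXP[mu_ fu].
have e : lpn p I (fun t => `|if t \in J then u t else 0|)%R =
    lpn p (I `&` J) (fun t => `|u t|)%R.
  have mIJ : measurable (I `&` J) by exact: measurableI.
  have out t : I t -> ~ (I `&` J) t -> `|if t \in J then u t else 0| = 0.
    by move=> It nIJ; rewrite memNset ?normr0// => Jt; apply: nIJ.
  rewrite (lpn_supp mIJ mI p0 (@subIsetl _ I J) (fun t => normr_ge0 _) out).
  by apply: lpn_eq_ae; apply: aeT => t [_ /mem_set ->].
split; last exact: e.
by apply/LpXP; split; [exact: smeas_restrict|rewrite e].
Qed.

Lemma graph_smeas I u : strongly_measurable (graph_space A) I u ->
  [/\ {ae mu, forall t, I t -> dom A (u t)}, smeas I u & smeas I (fun t => A (u t))].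
Proof.
move=> [s [ss su]]; split.
- by apply: aeS su => t su /su[].
- apply/smeasP; exists s; first by move=> k; case: (ss k).
  apply: aeS su => t su /su[_ /= c]; apply/cvgrPdistC_le => e e0.
  move/cvgr0_norm_le : c => /(_ _ e0); apply: filterS => k; apply: le_trans.
  by rewrite ger0_norm ?addr_ge0// lerDl.
- apply/smeasP; exists (fun k t => A (s k t)).
    by move=> k; apply: (fsimple_comp A); case: (ss k).
  apply: aeS su => t su /su[/= ut c]; apply/cvgrPdistC_le => e e0.
  move/cvgr0_norm_le : c => /(_ _ e0); apply: filterS => k; apply: le_trans.
  have st : dom A (s k t) by case: (ss k) => _ /(_ t).
  have := op_lin (-1) ut st; rewrite !scaleN1r addrC => AE.
  by rewrite ger0_norm ?addr_ge0// AE [- _ + _]addrC lerDr.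
Qed.

Lemma graph_lin I u v (k : R) : strongly_measurable (graph_space A) I u ->
  strongly_measurable (graph_space A) I v ->
  strongly_measurable (graph_space A) I (fun t => k *: u t + v t).
Proof.
move=> [s [ss su]] [r [rs rv]]; exists (fun j t => k *: s j t + r j t); split.
  move=> j; have [s1 s2] := ss j; have [r1 r2] := rs j; split.
    exact: (fsimple_comp2 (fun x y => k *: x + y)).
  by move=> t; apply: dom_lin; [exact: s2|exact: r2].
apply: aeS2 su rv => t su rv It; have [/= ut cu] := su It; have [/= vt cv] := rv It.
split; first exact: dom_lin.
have lim0 : (fun j => `|k| * (`|s j t - u t| + `|A (s j t - u t)|) +
    (`|r j t - v t| + `|A (r j t - v t)|)) @ \oo --> (0 : R).
  rewrite -[X in _ --> X](addr0 0) -[X in _ --> X + _](mulr0 `|k|).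
  by apply: cvgD => //; apply: cvgM => //; exact: cvg_cst.
apply: (squeeze_cvgr _ _ lim0); last exact: cvg_cst.
apply: nearW => j; rewrite addr_ge0//=.
have dom_sub x y : dom A x -> dom A y -> dom A (x - y).
  by move=> dx dy; have := dom_lin (-1) dy dx; rewrite scaleN1r addrC.
have dsu : dom A (s j t - u t) by apply: dom_sub => //; case: (ss j) => _; exact.
have drv : dom A (r j t - v t) by apply: dom_sub => //; case: (rs j) => _; exact.
rewrite (_ : k *: s j t + r j t - (k *: u t + v t) =
             k *: (s j t - u t) + (r j t - v t)); last first.
  by rewrite opprD addrACA -scalerBr.
rewrite op_lin// mulrDr addrACA; apply: lerD.
  by apply: le_trans (ler_normD _ _) _; rewrite normrZ.
by apply: le_trans (ler_normD _ _) _; rewrite normrZ.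
Qed.

Lemma graph_sub I J u : J `<=` I -> strongly_measurable (graph_space A) I u ->
  strongly_measurable (graph_space A) J u.
Proof.
move=> JI [s [ss su]]; exists s; split => //.
by apply: aeS su => t su /JI.
Qed.

Lemma graph_norm_aem I u : measurable I -> strongly_measurable (graph_space A) I u ->
  aem I (fun t => `|u t| + `|A (u t)|).
Proof.
by move=> mI /graph_smeas[_ m1 m2]; apply: aemD; exact: smeas_norm_aem.
Qed.

Lemma LpA_lin I u v (k : R) : measurable I -> Lp_mem p I (graph_space A) u ->
  Lp_mem p I (graph_space A) v -> Lp_mem p I (graph_space A) (fun t => k *: u t + v t).
Proof.
move=> mI /LpAP[mu_ fu] /LpAP[mv fv]; apply/LpAP; split; first exact: graph_lin.
have m1 := graph_norm_aem mI mu_; have m2 := graph_norm_aem mI mv.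
have n0 (w : R -> X) t : 0 <= `|w t| + `|A (w t)| by rewrite addr_ge0.
have n1 t : 0 <= `|k| * (`|u t| + `|A (u t)|) by rewrite mulr_ge0.
apply: (@le_lt_trans _ _ (lpn p I (fun t => `|k| * (`|u t| + `|A (u t)|) +
                                            (`|v t| + `|A (v t)|))%R)).
  apply: lpn_le_ae => //.
  have [du _ _] := graph_smeas mu_; have [dv _ _] := graph_smeas mv.
  apply: aeS2 du dv => t du dv It; split=> //.
  rewrite op_lin//; [|exact: du|exact: dv].
  rewrite mulrDr addrACA; apply: lerD.
    by apply: le_trans (ler_normD _ _) _; rewrite normrZ.
  by apply: le_trans (ler_normD _ _) _; rewrite normrZ.
apply: le_lt_trans (lpnD mI p1' n1 (n0 v) (aemZ `|k| m1) m2) _.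
rewrite lpnZ//.
apply: lte_add_pinfty; last exact: fv.
by apply: lte_mul_pinfty; [|by []|exact: fu].
Qed.

Section interval.
Variables (a b : R) (c : bool).
Let I := [set` Interval (BLeft a) (BSide c b)].
Let mI : measurable I := itv_measurable a b c.
Let fI : (mu I < +oo)%E := itv_finite a b c.
Local Notation wd := (weak_derivative I).

Lemma MR_memP u : MR_mem A p I u ->
  [/\ LpX I u, is_weak_derivative I u (wd u), LpX I (wd u) &
      Lp_mem p I (graph_space A) u].
Proof.
move=> [[Lu [v [uv Lv]]] Gu]; split; [exact: Lu| | |exact: Gu].
  exact: (@weak_derivativeP _ _ a b c _ _ uv).
by apply: LpX_eq Lv; exact: (@weak_derivativeE _ _ a b c _ _ uv).
Qed.

Lemma MR_memI u v : LpX I u -> is_weak_derivative I u v -> LpX I v ->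
  Lp_mem p I (graph_space A) u -> MR_mem A p I u.
Proof. by move=> Lu uv Lv Gu; split; [split; [exact: Lu|exists v]|exact: Gu]. Qed.

Lemma MR_mem_lin u v (k : R) : MR_mem A p I u -> MR_mem A p I v ->
  MR_mem A p I (fun t => k *: u t + v t).
Proof.
move=> /MR_memP[u1 u2 u3 u4] /MR_memP[v1 v2 v3 v4].
apply: (MR_memI (v := fun t => k *: wd u t + wd v t)).
- exact: (LpX_lin k mI u1 v1).
- exact: (@is_weak_derivative_lin _ _ a b c k _ _ _ _ u2 v2).
- exact: (LpX_lin k mI u3 v3).
- exact: (LpA_lin k mI u4 v4).
Qed.

Lemma weak_derivative_lin u v (k : R) : MR_mem A p I u -> MR_mem A p I v ->
  {ae mu, forall t, I t -> wd (fun s => k *: u s + v s) t = k *: wd u t + wd v t}.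
Proof.
move=> /MR_memP[_ u2 _ _] /MR_memP[_ v2 _ _].
apply: (@weak_derivativeE _ _ a b c).
exact: (@is_weak_derivative_lin _ _ a b c k _ _ _ _ u2 v2).
Qed.

(** The integrand of all trace estimates. *)
Definition MR_density u t := `|wd u t| + (`|u t| + `|A (u t)|).

Lemma MR_density_ge0 u t : 0 <= MR_density u t.
Proof. by rewrite !addr_ge0. Qed.

Lemma MR_density_aem u : MR_mem A p I u -> aem I (MR_density u).
Proof.
move=> /MR_memP[_ _ /LpXP[m _] /LpAP[m' _]]; apply: aemD; first exact: smeas_norm_aem.
exact: graph_norm_aem.
Qed.

Lemma MR_density_le u : MR_mem A p I u -> (lpn p I (MR_density u) <= MR_norm A p I u)%E.
Proof.
move=> /MR_memP[/LpXP[m1 _] _ /LpXP[m _] /LpAP[m' _]].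
apply: le_trans (lpnD mI p1' _ _ (smeas_norm_aem mI m) (graph_norm_aem mI m')) _ => //.
rewrite /MR_norm /W1p_norm Lp_norm_graphE !Lp_normE addeC; apply: leeD; first exact: lexx.
by apply: leeDr; exact: lpn_ge0.
Qed.

Lemma MR_norm_lty u : MR_mem A p I u -> (MR_norm A p I u < +oo)%E.
Proof.
move=> /MR_memP[/LpXP[m1 f1] _ /LpXP[m f] /LpAP[m' f']].
rewrite /MR_norm /W1p_norm Lp_norm_graphE !Lp_normE.
by apply: lte_add_pinfty; [exact: f'|apply: lte_add_pinfty; [exact: f1|exact: f]].
Qed.

Section restriction.
Variables (a' b' : R) (c' : bool).
Let J := [set` Interval (BLeft a') (BSide c' b')].
Hypothesis JI : J `<=` I.

Lemma MR_mem_sub u : MR_mem A p I u -> MR_mem A p J u.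
Proof.
move=> /MR_memP[u1 u2 u3 /LpAP[u4 u5]]; split; last first.
  apply/LpAP; split; first exact: graph_sub u4.
  by apply: le_lt_trans u5; apply: lpn_le.
split; first exact: LpX_sub u1.
exists (wd u); split; last exact: LpX_sub u3.
exact: (@is_weak_derivative_restrict _ _ a b c a' b' c' _ _ JI u2).
Qed.

Lemma weak_derivative_sub u : MR_mem A p I u ->
  {ae mu, forall t, J t -> weak_derivative J u t = wd u t}.
Proof.
move=> /MR_memP[_ u2 _ _]; apply: (@weak_derivativeE _ _ a' b' c').
exact: (@is_weak_derivative_restrict _ _ a b c a' b' c' _ _ JI u2).
Qed.

Lemma MR_norm_sub u : MR_mem A p I u -> (MR_norm A p J u <= MR_norm A p I u)%E.
Proof.
move=> hu; rewrite /MR_norm /W1p_norm !Lp_norm_graphE !Lp_normE.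
apply: leeD; [|apply: leeD]; try by apply: lpn_le.
rewrite (@lpn_eq_ae _ p J (fun t => `|weak_derivative J u t|) (fun t => `|wd u t|)).
  exact: lpn_le.
by apply: aeS (weak_derivative_sub hu) => t h Jt; rewrite h.
Qed.

Lemma linear_solution_sub t0 h (u0 : X) u : linear_solution A p I t0 h u0 u ->
  linear_solution A p J t0 h u0 u.
Proof.
move=> [cu mem eqn ini]; split => //.
- exact: continuous_subspaceW cu.
- exact: MR_mem_sub.
- by apply: aeS2 (weak_derivative_sub mem) eqn => t h1 h2 Jt; rewrite h1// h2//; exact: JI.
Qed.

End restriction.

Lemma linear_solution_lin (k : R) t0 h h' (u0 v0 : X) u v :
  linear_solution A p I t0 h u0 u -> linear_solution A p I t0 h' v0 v ->
  linear_solution A p I t0 (fun t => k *: h t + h' t) (k *: u0 + v0)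
    (fun t => k *: u t + v t).
Proof.
move=> [cu mem eqn ini] [cv memv eqnv iniv]; split.
- by move=> x; apply: cvgD; [apply: cvgZr; exact: cu|exact: cv].
- exact: MR_mem_lin.
- have [_ _ _ /LpAP[gu _]] := MR_memP mem; have [_ _ _ /LpAP[gv _]] := MR_memP memv.
  have [du _ _] := graph_smeas gu; have [dv _ _] := graph_smeas gv.
  apply: aeS2 (aeI (weak_derivative_lin k mem memv) (aeI du dv)) (aeI eqn eqnv).
  move=> t [wE [dut dvt]] [e1 e2] It.
  rewrite wE// op_lin; [|exact: dut|exact: dvt].
  by rewrite addrACA -scalerDr e1// e2.
- by rewrite ini iniv.
Qed.

Lemma linear_solution_eq t0 h h' (u0 : X) u :
  {ae mu, forall t, I t -> h t = h' t} ->
  linear_solution A p I t0 h u0 u -> linear_solution A p I t0 h' u0 u.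
Proof.
move=> hh [cu mem eqn ini]; split => //.
by apply: aeS2 hh eqn => t e1 e2 It; rewrite e2// e1.
Qed.

Lemma linear_solution_LpX t0 h (u0 : X) u : linear_solution A p I t0 h u0 u -> LpX I h.
Proof.
move=> [cu mem eqn ini]; have [_ _ Lw /LpAP[gu fu]] := MR_memP mem.
have [_ mu_ mA] := graph_smeas gu.
have LA : LpX I (fun t => A (u t)).
  apply/LpXP; split; first exact: mA.
  apply: le_lt_trans fu; apply: lpn_le => // t _.
  by rewrite lerDr.
apply: LpX_eq (LpX_lin 1 mI Lw LA); apply: aeS eqn => t e It.
by rewrite scale1r e.
Qed.

End interval.

End spaces.

(** * Affine substitution and Hardy's inequality *)

Section calculus.
Variable R : realType.
Local Notation mu := (@lebesgue_measure R).

Lemma measurable_affine (a b : R) : measurable_fun setT (fun t : R => a * t + b).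
Proof. by apply: measurable_funD => //; apply: measurable_funM. Qed.

Section affine.
Variables (a b : R).
Hypothesis a0 : 0 < a.
Let phi (t : measurableTypeR R) : measurableTypeR R := a * t + b.
Let mphi : measurable_fun setT phi. Proof. exact: measurable_affine. Qed.
Let pm : {measure set (measurableTypeR R) -> \bar R} :=
  measure_function_pushforward__canonical__measure_function_Measure mu mphi.
Let nu : {measure set (measurableTypeR R) -> \bar R} := mscale (NngNum (ltW a0)) pm.

(** Both measures agree on half-open intervals, which determine Lebesgue measure. *)
Let lebesgue_affine E : measurable E -> mu E = nu E.
Proof.
move=> mE; apply: lebesgue_measure_unique => // _ [[x y] _ <-].
change (mu `]x, y]%classic = a%:E * mu (phi @^-1` `]x, y]%classic))%E.
rewrite (_ : phi @^-1` _ = `](x - b) / a, (y - b) / a]%classic); last first.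
  apply/seteqP; split => t; rewrite /= !in_itv/= /phi ltr_pdivrMr// ler_pdivlMr//;
    by rewrite ltrBlDr lerBrDr [t * a]mulrC.
rewrite !lebesgue_measure_itv/= !lte_fin ltr_pM2r ?invr_gt0// ltrD2r.
case: ifPn => _; last by rewrite mule0.
rewrite -!EFinB -EFinM -mulrBl; congr EFin; field.
by rewrite gt_eqF.
Qed.

Lemma lebesgue_measure_affine (E : set R) : measurable E ->
  mu E = (a%:E * mu ((fun t => (a * t + b)%R) @^-1` E))%E.
Proof. exact: lebesgue_affine. Qed.

Lemma lint_affine_measurable (D : set R) (f : R -> R) : measurable D ->
  measurable_fun setT f -> (forall t, 0 <= f t) ->
  lint D f = (a%:E * lint ((fun t => (a * t + b)%R) @^-1` D) (fun t => f (a * t + b))%R)%E.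
Proof.
move=> mD mf f0; have mEf : measurable_fun D (EFin \o f).
  by apply/measurable_EFinP; exact: measurable_funS mf.
rewrite /lint (_ : integral mu D _ = \int[nu]_(x in D) (EFin \o f) x)%E; last first.
  by apply: eq_measure_integral => E mE _; exact: lebesgue_affine.
rewrite ge0_integral_mscale//; last by move=> x _; rewrite lee_fin.
by rewrite /= ge0_integral_pushforward// => x _; rewrite lee_fin.
Qed.

End affine.

Lemma ae_affine (a b : R) (P : R -> Prop) : 0 < a -> {ae mu, forall t, P t} ->
  {ae mu, forall t, P (a * t + b)}.
Proof.
move=> a0 [N [mN N0 sN]]; exists ((fun t => a * t + b) @^-1` N); split.
- by rewrite -[X in measurable X]setTI; exact: measurable_affine.
- have := lebesgue_measure_affine b a0 mN; rewrite N0 => /esym/eqP.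
  by rewrite mule_eq0 eqe gt_eqF//= => /eqP.
- by move=> t /= nP; exact: sN.
Qed.

(** Almost everywhere equality is preserved by the substitution, as it preserves null
    sets; so a Borel function in place of [f] is enough. *)
Lemma lint_affine (a b : R) (D : set R) (f : R -> R) : 0 < a -> measurable D ->
  (forall t, 0 <= f t) -> aem D f ->
  lint ((fun t => (a * t + b)%R) @^-1` D) (fun t => f (a * t + b))%R = ((a^-1)%:E * lint D f)%E.
Proof.
move=> a0 mD f0 mf; have [g [mg g0 fg]] := aem_ge0 f0 mf.
rewrite (lint_eq_ae f0 g0 fg) (lint_affine_measurable b a0 mD mg g0) muleA -EFinM mulVf ?gt_eqF//.
rewrite mul1e; apply: lint_eq_ae => //.
by have := ae_affine b a0 fg.
Qed.

Lemma lint_exhaust (F : nat -> set R) (D : set R) (f : R -> R) (M : \bar R) :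
  measurable_fun setT f -> (forall t, 0 <= f t) -> (forall n, measurable (F n)) ->
  measurable D ->
  (forall m n, (m <= n)%N -> F m `<=` F n) -> D `<=` \bigcup_n F n ->
  (forall n, (lint (F n `&` D) f <= M)%E) -> (lint D f <= M)%E.
Proof.
move=> mf f0 mF mD ndF DF FM.
pose g n t := f t * \1_(F n) t.
have g0 n t : 0 <= g n t by rewrite mulr_ge0.
have cvg : (fun n => lint D (g n)) @ \oo --> lint D f.
  apply: lint_monotone_cvg => //.
  - by move=> n; apply: measurable_funM => //; exact: measurable_indic.
  - move=> t Dt m n mn; rewrite /g ler_wpM2l// !indicE.
    have [tm|] := boolP (t \in F m); last by rewrite ler0n.
    by rewrite mem_set//; apply: ndF mn _ _; exact: set_mem.
  - move=> t Dt; have [n _ nt] := DF _ Dt.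
    apply: cvg_near_cst; exists n => // m /= nm.
    by rewrite /g indicE mem_set ?mulr1//; exact: ndF nm _ nt.
apply: cvge_to_le cvg _; apply: nearW => n; apply: le_trans (FM n).
have mFD : measurable (F n `&` D) by exact: measurableI.
have out t : D t -> ~ (F n `&` D) t -> g n t = 0.
  by move=> Dt nF; rewrite /g indicE memNset ?mulr0// => Ft; apply: nF.
rewrite (lint_supp mFD mD (@subIsetr _ _ _) (g0 n) out).
by apply: (lint_le (g0 n) f0) => // t [/mem_set Ft _]; rewrite /g indicE Ft mulr1.
Qed.

Lemma hoelder_lint (p q : R) (D : set R) (f g : R -> R) : measurable D ->
  0 < p -> 0 < q -> p^-1 + q^-1 = 1 ->
  measurable_fun setT f -> measurable_fun setT g ->
  (forall t, 0 <= f t) -> (forall t, 0 <= g t) ->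
  (lint D (fun t => (f t * g t)%R)%R <= lpn p D f * lpn q D g)%E.
Proof.
move=> mD p0 q0 pq mf mg f0 g0.
have mf' : measurable_fun setT (f \_ D).
  by apply/(measurable_restrictT _ _).1 => //; exact: measurable_funS mf.
have mg' : measurable_fun setT (g \_ D).
  by apply/(measurable_restrictT _ _).1 => //; exact: measurable_funS mg.
have := hoelder mu mf' mg' p0 q0 pq.
rewrite !lpn_LnormE// Lnorm1; apply: le_trans.
rewrite /lint [leLHS]integral_mkcond le_eqVlt; apply/orP; left; apply/eqP.
apply: eq_integral => t _; rewrite /= /patch; case: ifPn => _.
  by rewrite ger0_norm// mulr_ge0.
by rewrite /point/= mulr0 normr0.
Qed.

Lemma powR_gt0_inv (x a : R) : 0 < x -> x `^ a * x `^ (- a) = 1.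
Proof. by move=> x0; rewrite powRN mulfV// gt_eqF// powR_gt0. Qed.

Lemma lint_powR_itv (c d b : R) : 0 < c -> c < d -> b + 1 != 0 ->
  lint `[c, d] (fun t => t `^ b)%R = ((b + 1)^-1 * (d `^ (b + 1) - c `^ (b + 1)))%:E.
Proof.
move=> c0 cd b1; pose F (t : R) := (b + 1)^-1 * t `^ (b + 1).
have dF (t : R) : 0 < t -> is_derive t 1 F (t `^ b).
  move=> t0; have := is_deriveZ (b + 1)^-1 (is_derive1_powR (b + 1) t0).
  by rewrite /GRing.scale/= mulrA mulVf// mul1r addrK.
have cont (t : R) (k : R) : 0 < t -> {for t, continuous (fun s : R => s `^ k)}.
  move=> t0; apply: differentiable_continuous; apply/derivable1_diffP.
  by have [] := is_derive1_powR k t0.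
have contF (t : R) : 0 < t -> {for t, continuous F}.
  move=> t0; apply: differentiable_continuous; apply/derivable1_diffP.
  by have [] := dF t t0.
rewrite /lint (@continuous_FTC2 _ _ F)//.
- by rewrite -EFinB /F -mulrBr.
- apply: continuous_in_subspaceT => t /set_mem/=; rewrite in_itv/= => /andP[ct _].
  by apply: cont; exact: lt_le_trans ct.
- split.
  + move=> t; rewrite in_itv/= => /andP[ct _].
    by have [] := dF t (lt_trans c0 ct).
  + by apply: cvg_at_right_filter; exact: contF.
  + by apply: cvg_at_left_filter; apply: contF; exact: lt_trans cd.
- move=> t; rewrite in_itv/= => /andP[ct _].
  by rewrite derive1E; have [_] := dF t (lt_trans c0 ct).
Qed.

Lemma lint_powR_tail (r a : R) : 0 < r -> 1 < a ->
  (lint `[r, +oo[ (fun t => t `^ (- a))%R <= ((a - 1)^-1 * r `^ (1 - a))%:E)%E.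
Proof.
move=> r0 a1; apply: (lint_exhaust (F := fun n => `[r, r + n%:R]%classic)) => //.
- by move=> t; exact: powR_ge0.
- move=> m n mn; apply: subset_itvl; rewrite bnd_simp lerD2l ler_nat//.
- move=> t /=; rewrite in_itv/= andbT => rt; exists (Num.truncn (t - r)).+1 => //=.
  by rewrite in_itv/= rt/= -lerBlDl ltW// truncnS_gt.
move=> n; apply: (@le_trans _ _ (lint `[r, r + n.+1%:R] (fun t => t `^ (- a))%R)).
  apply: lint_le => [t|t|t [+ _]|]; rewrite ?powR_ge0//.
  by move: t; apply: subset_itvl; rewrite bnd_simp lerD2l ler_nat.
rewrite lint_powR_itv ?ltrDl//; last by rewrite addrC subr_eq0 lt_eqF.
have -> : (- a + 1)^-1 = - (a - 1)^-1 by rewrite -invrN opprB addrC.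
rewrite lee_fin [- a + 1]addrC mulNr -mulrN opprB; apply: ler_wpM2l.
  by rewrite invr_ge0 subr_ge0 ltW.
by rewrite lerBlDr lerDl powR_ge0.
Qed.

Lemma lint_sqrt_head (t : R) : 0 < t ->
  (lint `]0%R, t] (fun s => s `^ (- 2^-1))%R <= (2 * t `^ 2^-1)%:E)%E.
Proof.
move=> t0; apply: (lint_exhaust (F := fun n => `[t / n.+2%:R, t]%classic)) => //.
- by move=> s; exact: powR_ge0.
- move=> m n mn; apply: subset_itvr; rewrite bnd_simp ler_pM2l//.
  by rewrite lef_pV2 ?posrE// ler_nat.
- move=> s /=; rewrite in_itv/= => /andP[s0 st]; exists (Num.truncn (t / s)) => //=.
  rewrite in_itv/= st andbT ler_pdivrMr// mulrC -ler_pdivrMr// ltW//.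
  by apply: lt_trans (truncnS_gt _) _; rewrite ltr_nat.
move=> n; apply: (@le_trans _ _ (lint `[t / n.+2%:R, t] (fun t => t `^ (- 2^-1))%R)).
  by apply: lint_le => [s|s|s [+ _]|]; rewrite ?powR_ge0.
rewrite lint_powR_itv//; last 3 first.
- by rewrite divr_gt0.
- by rewrite ltr_pdivrMr// ltr_pMr// ltr1n.
- by apply/eqP; lra.
rewrite (_ : - 2^-1 + 1 = 2^-1)%R; last by lra.
by rewrite invrK lee_fin ler_wpM2l// lerBlDr lerDl powR_ge0.
Qed.

Section hardy.
Variable p : R.
Hypothesis p1 : 1 < p.
Let p0 : 0 < p. Proof. exact: lt_trans p1. Qed.
Let pm0 : 0 < p - 1. Proof. by rewrite subr_gt0. Qed.

(** Hoelder's inequality with the weight [s^(-1/2)], which is integrable at 0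
    and leaves a power of [t] that is integrable at infinity. *)
Lemma hardy_pointwise (H : R -> R) (t : R) : measurable_fun setT H ->
  (forall s, 0 <= H s) -> 0 < t ->
  (lint `]0%R, t] H `^ p <=
   (2 `^ (p - 1) * t `^ ((p - 1) / 2))%:E *
     lint `]0%R, t] (fun s => s `^ ((p - 1) / 2) * H s `^ p)%R)%E.
Proof.
move=> mH H0 t0.
pose q := p / (p - 1); have q0 : 0 < q by rewrite divr_gt0.
have pq : p^-1 + q^-1 = 1.
  by rewrite /q invf_div; field; rewrite !gt_eqF.
pose al := (2 * q)^-1.
have eH : lint `]0%R, t] H = lint `]0%R, t] (fun s => (s `^ al * H s) * s `^ (- al))%R.
  apply: lint_eq_ae => //.
    by move=> s; rewrite !mulr_ge0 ?powR_ge0.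
  apply: aeT => s; rewrite /= in_itv/= => /andP[s0 _].
  by rewrite mulrAC powR_gt0_inv// mul1r.
have mpow (k : R) : measurable_fun setT (fun s : R => s `^ k) by exact: measurable_powR.
rewrite eH.
have mH' := measurable_funM (mpow al) mH.
have f0 s : 0 <= s `^ al * H s by rewrite mulr_ge0 ?powR_ge0.
have g0 s : 0 <= s `^ (- al) by exact: powR_ge0.
have mD : measurable `]0, t] by [].
have hold := hoelder_lint mD p0 q0 pq mH' (mpow (- al)) f0 g0.
have pow_le := poweR_le (ltW p0) (lint_ge0 _ (fun s => mulr_ge0 (f0 s) (g0 s))) hold.
apply: le_trans pow_le _; rewrite poweRM ?lpn_ge0// lpn_poweR// muleC.
have weight : (lpn q `]0%R, t] (fun s => s `^ (- al))%R `^ p <=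
               (2 `^ (p - 1) * t `^ ((p - 1) / 2))%:E)%E.
  rewrite /lpn -poweRrM.
  have -> : q^-1 * p = p - 1 by rewrite /q invf_div divfK// gt_eqF.
  rewrite (_ : lint _ _ = lint `]0%R, t] (fun s => s `^ (- 2^-1))%R); last first.
    apply: lint_eq_ae => [s|s|]; rewrite ?powR_ge0//; apply: aeT => s _.
    by rewrite -powRrM /al invfM mulNr -mulrA mulVf ?mulr1// gt_eqF.
  have -> : (2 `^ (p - 1) * t `^ ((p - 1) / 2) = (2 * t `^ 2^-1) `^ (p - 1)).
    by rewrite powRM ?powR_ge0// -powRrM [2^-1 * _]mulrC.
  rewrite -poweR_EFin; apply: poweR_le; [exact: ltW| |exact: lint_sqrt_head].
  by apply: lint_ge0 => s; exact: powR_ge0.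
apply: lee_pmul => //; [exact: poweR_ge0|by apply: lint_ge0 => s; exact: powR_ge0|].
apply: lint_le => // [s|s|s _]; rewrite ?mulr_ge0 ?powR_ge0//.
rewrite powRM ?powR_ge0// -powRrM ler_wpM2r ?powR_ge0// le_eqVlt; apply/orP; left.
apply/eqP; congr (_ `^ _); rewrite /al /q; field.
by rewrite !gt_eqF.
Qed.

(** Hardy's inequality: integrate the pointwise bound and exchange the order of
    integration. *)
Lemma hardy (H F : R -> R) : measurable_fun setT H -> (forall s, 0 <= H s) ->
  measurable_fun setT F -> (forall t, 0 <= F t) ->
  (forall t, 0 < t -> ((t * F t)%:E <= lint `]0%R, t] H)%E) ->
  (lint `]0%R, +oo[ (fun t => F t `^ p)%R <=
   (2 `^ p / (p - 1))%:E * lint `]0%R, +oo[ (fun s => H s `^ p)%R)%E.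
Proof.
move=> mH H0 mF F0 FH.
pose al := (p - 1) / 2; have al0 : 0 < al by rewrite divr_gt0.
pose T := measurableTypeR R.
pose E : set (T * T) := [set z | 0 < z.2 <= z.1].
have mE : measurable E.
  have m1 : measurable_fun setT (fun z : T * T => 0 < z.2 :> R).
    exact: (measurable_fun_ltr (measurable_cst _) measurable_snd).
  have m2 : measurable_fun setT (fun z : T * T => z.2 <= z.1 :> R).
    exact: (measurable_fun_ler measurable_snd measurable_fst).
  have /(_ [set true]) m3 := m1 measurableT; have /(_ [set true]) m4 := m2 measurableT.
  rewrite (_ : E = (setT `&` (fun z : T * T => 0 < z.2 :> R) @^-1` [set true]) `&`
                   (setT `&` (fun z : T * T => z.2 <= z.1 :> R) @^-1` [set true])).
    by apply: measurableI; [exact: m3|exact: m4].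
  rewrite !setTI; apply/seteqP; split => z; first by move=> /andP[h1 h2].
  by move=> [h1 h2]; apply/andP.
pose h (s : R) := s `^ al * H s `^ p.
have h0 s : 0 <= h s by rewrite mulr_ge0 ?powR_ge0.
have mh : measurable_fun setT h.
  apply: measurable_funM; first exact: measurable_powR.
  exact: (measurableT_comp (measurable_powR p)).
pose k (t : R) := t `^ (- (al + 1)).
have k0 t : 0 <= k t by exact: powR_ge0.
have mk : measurable_fun setT k by exact: measurable_powR.
pose Phi (z : T * T) : R := k z.1 * h z.2 * \1_E z.
have mPhi : measurable_fun setT Phi.
  apply: measurable_funM; last exact: measurable_indic.
  by apply: measurable_funM; [exact: (measurableT_comp mk)|exact: (measurableT_comp mh)].
have Phi0 z : 0 <= Phi z.
  by rewrite /Phi; apply: mulr_ge0 => //; apply: mulr_ge0.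
have mEPhi : measurable_fun setT (EFin \o Phi) by exact/measurable_EFinP.
have EPhi0 z : (0 <= (EFin \o Phi) z)%E by rewrite lee_fin.
have mD t : measurable (`]0, t]%classic : set T) by [].
have mh' (D : set R) : aem D h by exact: aem_measurable.
have mk' (D : set R) : aem D k by exact: aem_measurable.
have inner_s t : 0 < t -> (\int[mu]_s (EFin \o Phi) (t, s) = (k t)%:E * lint `]0%R, t] h)%E.
  move=> t0; rewrite -lintZ//.
  rewrite (_ : (\int[mu]_s _)%E = lint setT (fun s => Phi (t, s)))//.
  have out s : setT s -> ~ `]0, t]%classic s -> Phi (t, s) = 0.
    by move=> _ /= nD; rewrite /Phi indicE memNset ?mulr0//= => sE; apply: nD; rewrite in_itv.
  rewrite (lint_supp (mD t) measurableT (@subsetT _ _) (fun s => Phi0 (t, s)) out).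
  apply: (lint_eq_ae (fun s => Phi0 (t, s)) (fun s => mulr_ge0 (k0 t) (h0 s))); apply: aeT => s /=.
  by rewrite in_itv/= => st; rewrite /Phi/= indicE mem_set ?mulr1.
have inner_t s : 0 < s -> (\int[mu]_t (EFin \o Phi) (t, s) <= (al^-1 * H s `^ p)%:E)%E.
  move=> s0.
  rewrite (_ : (\int[mu]_t _)%E = lint setT (fun t => Phi (t, s)))//.
  have out t : setT t -> ~ `[s, +oo[%classic t -> Phi (t, s) = 0.
    move=> _ /= nD; rewrite /Phi indicE memNset ?mulr0//= => /andP[_ st].
    by apply: nD; rewrite in_itv/= st.
  have mS : measurable `[s, +oo[ by [].
  rewrite (lint_supp mS measurableT (@subsetT _ _) (fun t => Phi0 (t, s)) out).
  rewrite (_ : lint _ _ = lint `[s, +oo[ (fun t => h s * k t)%R); last first.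
    apply: (lint_eq_ae (fun t => Phi0 (t, s)) (fun t => mulr_ge0 (h0 s) (k0 t))); apply: aeT => t /=.
    rewrite in_itv/= andbT => st; have tE : E (t, s) by rewrite /E /= s0.
    by rewrite /Phi/= indicE (mem_set tE) mulr1 mulrC.
  rewrite lintZ//; have al1 : 1 < al + 1 by rewrite ltrDr.
  have /(lee_wpmul2l _) := lint_powR_tail s0 al1 => /(_ (h s)%:E); rewrite lee_fin.
  move=> /(_ (h0 s))/le_trans; apply; rewrite addrK -EFinM lee_fin.
  rewrite (_ : 1 - (al + 1) = - al); last by lra.
  rewrite /h (_ : _ * _ * _ = s `^ al * s `^ (- al) * (al^-1 * H s `^ p)).
    by rewrite powR_gt0_inv// mul1r.
  by ring.
have step1 : (lint `]0%R, +oo[ (fun t => F t `^ p)%R <=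
    (2 `^ (p - 1))%:E * \int[mu]_t \int[mu]_s (EFin \o Phi) (t, s))%E.
  have mG : measurable_fun setT (fun t : T => \int[mu]_s (EFin \o Phi) (t, s))%E.
    exact: measurable_fun_fubini_tonelli_F.
  rewrite -ge0_integralZl_EFin ?powR_ge0//; last by move=> t _; exact: integral_ge0.
  rewrite /lint [leLHS]integral_mkcond; apply: ge0_le_integral => //.
  - move=> t _; rewrite /patch; case: ifPn => _ //=; rewrite ?lee_fin ?powR_ge0//.
  - apply/(measurable_restrictT _ _).1 => //; apply/measurable_EFinP.
    apply: measurable_funS (measurableT_comp (measurable_powR p) mF) => //.
  - by apply: emeasurable_funM => //; exact: measurable_cst.
  move=> t _; rewrite /patch; case: ifPn => [/set_mem/=|_]; last first.
    by rewrite mule_ge0 ?lee_fin ?powR_ge0//; exact: integral_ge0.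
  rewrite in_itv/= andbT => t0; rewrite inner_s//.
  have tF0 : (0 <= (t * F t)%:E)%E by rewrite lee_fin mulr_ge0// ltW.
  have := le_trans (poweR_le (ltW p0) tF0 (FH t t0)) (hardy_pointwise mH H0 t0).
  rewrite poweR_EFin powRM ?(ltW t0)// => Ft.
  have tp0 : (0 <= (t `^ (- p))%:E)%E by rewrite lee_fin powR_ge0.
  have -> : (F t `^ p)%:E = ((t `^ (- p))%:E * (t `^ p * F t `^ p)%:E)%E.
    by rewrite -EFinM mulrA [_ * t `^ p]mulrC powR_gt0_inv// mul1r.
  apply: le_trans (lee_wpmul2l tp0 Ft) _.
  rewrite !muleA -!EFinM le_eqVlt; apply/orP; left; apply/eqP.
  congr (_%:E * _)%E; rewrite mulrCA; congr (_ * _).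
  rewrite -powRD; last by rewrite (gt_eqF t0) implybT.
  by rewrite /k /al; congr (_ `^ _); field.
apply: le_trans step1 _.
rewrite (@fubini_tonelli _ _ T T R mu mu (EFin \o Phi) mEPhi EPhi0).
rewrite (_ : 2 `^ p / (p - 1) = 2 `^ (p - 1) * al^-1); last first.
  rewrite /al invf_div mulrA; congr (_ / _).
  by rewrite -[X in _ * X](powRr1 (ler0n R 2)) -powRD ?subrK// pnatr_eq0 implybT.
rewrite EFinM -muleA; apply: lee_wpmul2l; first by rewrite lee_fin powR_ge0.
have mHp : measurable_fun setT (fun s => H s `^ p) by exact: (measurableT_comp (measurable_powR p)).
rewrite -lintZ ?invr_ge0 ?(ltW al0)//; last 2 first.
- by move=> s; exact: powR_ge0.
- exact: aem_measurable.
rewrite /lint [leRHS]integral_mkcond; apply: ge0_le_integral => //.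
- by move=> s _; apply: integral_ge0.
- exact: measurable_fun_fubini_tonelli_G.
- apply/(measurable_restrictT _ _).1 => //; apply/measurable_EFinP.
  by apply: measurable_funS (measurable_funM (measurable_cst al^-1) mHp).
move=> s _; rewrite /patch; case: ifPn => [/set_mem/=|sD].
  by rewrite in_itv/= andbT => s0; exact: inner_t.
rewrite integral0_eq// => t _ /=; rewrite /Phi indicE memNset ?mulr0//= => /andP[s0 _].
by move: sD; rewrite notin_setE/= in_itv/= s0.
Qed.

End hardy.
End calculus.

(** * The interpolation norm *)

Section interpolation.
Variables (R : realType) (X : completeNormedModType R) (A : linear_operator X) (p : R).
Hypothesis p1 : 1 < p.
Let p0 : 0 < p. Proof. exact: lt_trans p1. Qed.
Let p1' : 1 <= p. Proof. exact: ltW. Qed.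
Let pm0 : 0 < p - 1. Proof. by rewrite subr_gt0. Qed.

Local Notation K := (K_functional (graph_space A)).
Local Notation N := (Xp_norm A p).

Let Kset (t : R) (x : X) := [set r | exists a b : X,
    [/\ carrier (graph_space A) b, x = a + b & r = `|a| + t * ns_norm (graph_space A) b]].

Let Kset0 t x : Kset t x !=set0.
Proof.
exists (`|x| + t * ns_norm (graph_space A) 0), x, 0; split => //; first exact: dom0.
by rewrite addr0.
Qed.

Lemma K_le (t : R) (x b : X) : 0 <= t -> dom A b -> K t x <= `|x - b| + t * (`|b| + `|A b|).
Proof.
move=> t0 db; apply: ge_inf; last by exists (x - b), b; split => //; rewrite subrK.
by exists 0 => _ [a [c [_ _ ->]]]; rewrite addr_ge0// mulr_ge0// addr_ge0.
Qed.

Lemma K_ge0 (t : R) (x : X) : 0 <= t -> 0 <= K t x.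
Proof.
move=> t0; apply: lb_le_inf; first exact: Kset0.
by move=> _ [a [c [_ _ ->]]]; rewrite addr_ge0// mulr_ge0// addr_ge0.
Qed.

Lemma op0 : A 0 = 0.
Proof.
have := op_lin (-1) (dom0 A) (dom0 A).
by rewrite scaler0 addr0 scaleN1r addNr.
Qed.

Lemma K_le_norm (t : R) (x : X) : 0 <= t -> K t x <= `|x|.
Proof.
move=> t0; apply: le_trans (K_le x t0 (dom0 A)) _.
by rewrite op0 subr0 !normr0 addr0 mulr0 addr0.
Qed.

Lemma K_mono (s t : R) (x : X) : 0 <= s -> s <= t -> K s x <= K t x.
Proof.
move=> s0 st; apply: lb_le_inf; first exact: Kset0.
move=> _ [a [b [db -> ->]]]; apply: le_trans (K_le _ s0 db) _.
by rewrite addrK lerD2l ler_wpM2r// addr_ge0.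
Qed.

Lemma K_lin (t k : R) (x y : X) : 0 <= t -> K t (k *: x + y) <= `|k| * K t x + K t y.
Proof.
move=> t0; rewrite -lerBlDr.
have step (b : X) (db : dom A b) :
    K t (k *: x + y) - K t y <= `|k| * (`|x - b| + t * (`|b| + `|A b|)).
  rewrite lerBlDr -lerBlDl; apply: lb_le_inf; first exact: Kset0.
  move=> _ [a [c [dc -> ->]]]; rewrite lerBlDl.
  have dkc := dom_lin k db dc.
  apply: le_trans (K_le _ t0 dkc) _.
  rewrite op_lin//=.
  apply: (@le_trans _ _ ((`|k| * `|x - b| + `|a|) +
      t * ((`|k| * `|b| + `|c|) + (`|k| * `|A b| + `|A c|)))); last first.
    by rewrite le_eqVlt; apply/orP; left; apply/eqP; ring.
  have nlin (v w : X) : `|k *: v + w| <= `|k| * `|v| + `|w|.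
    by apply: le_trans (ler_normD _ _) _; rewrite normrZ.
  apply: lerD; last by apply: ler_wpM2l => //; apply: lerD; exact: nlin.
  rewrite (_ : _ - _ = k *: (x - b) + a); first exact: nlin.
  by rewrite scalerBr opprD addrACA addrK.
have [->|k0] := eqVneq k 0.
  by rewrite scale0r add0r subrr normr0 mul0r.
have kp : 0 < `|k| by rewrite normr_gt0.
rewrite -ler_pdivrMl//; apply: lb_le_inf; first exact: Kset0.
move=> _ [a [b [db xab ->]]]; rewrite ler_pdivrMl//.
by have := step b db; rewrite xab addrK.
Qed.

(** [Kq x] is the function whose L^p(0, oo) norm defines the interpolation norm. *)
Definition Kq (x : X) (t : R) : R := if 0 < t then K t x / t else 0.

Lemma Kq_ge0 x t : 0 <= Kq x t.
Proof. by rewrite /Kq; case: ifPn => // t0; rewrite divr_ge0 ?K_ge0 ?ltW. Qed.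

Lemma Kq_measurable x : measurable_fun setT (Kq x).
Proof.
pose K' (t : R) := K (Num.max t 0) x.
have mK' : measurable_fun setT K'.
  apply: nondecreasing_measurable => // s t st; apply: K_mono.
    by rewrite le_max lexx orbT.
  by rewrite ge_max !le_max st lexx !orbT.
rewrite (_ : Kq x = fun t => K' t * (t `^ (- 1) * \1_`]0%R, +oo[ t)).
  apply: measurable_funM => //; apply: measurable_funM; last exact: measurable_indic.
  exact: measurable_powR.
apply/funext => t; rewrite /Kq /K' indicE; case: ifPn => t0.
  by rewrite mem_set ?mulr1 ?max_l ?ltW//= ?powR_inv1 ?ltW// in_itv/= t0.
by rewrite memNset ?mulr0//= in_itv/= andbT; exact/negP.
Qed.

Lemma Xp_normE x : N x = lpn p `]0%R, +oo[ (Kq x).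
Proof.
rewrite /Xp_norm /interp_norm /lpn; congr (_ `^ _)%E; rewrite /lint.
apply: eq_integral => t /set_mem/=; rewrite in_itv/= andbT => t0.
rewrite /Kq t0; congr EFin; have K0 := K_ge0 x (ltW t0).
rewrite powRM ?powR_ge0// [in RHS]powRM ?invr_ge0 ?(ltW t0)// -powRrM.
rewrite mulrC mulrA mulrC; congr (_ * _).
rewrite -powR_inv1 ?(ltW t0)// -powRrM -powRD; last by rewrite (gt_eqF t0) implybT.
by congr (_ `^ _); field; rewrite gt_eqF.
Qed.

Lemma Xp_norm_lin (k : R) (x y : X) : (N (k *: x + y)%R <= `|k|%:E * N x + N y)%E.
Proof.
rewrite !Xp_normE.
have mK z (D : set R) : aem D (Kq z) by apply: aem_measurable; exact: Kq_measurable.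
have n1 t : 0 <= `|k| * Kq x t by rewrite mulr_ge0 ?Kq_ge0.
have mD : measurable (`]0%R, +oo[%classic : set R) by exact: measurable_itv.
rewrite -lpnZ//; last exact: Kq_ge0.
apply: le_trans (lpnD mD p1' n1 (Kq_ge0 y) (aemZ _ (mK x _)) (mK y _)).
apply: lpn_le => //; first exact: Kq_ge0.
  by move=> t; rewrite addr_ge0 ?Kq_ge0.
move=> t /=; rewrite in_itv/= andbT => t0; rewrite /Kq t0 mulrA -mulrDl.
apply: ler_wpM2r; first by rewrite invr_ge0 ltW.
by apply: K_lin; exact: ltW.
Qed.

Lemma Xp_lin (k : R) (x y : X) : Xp A p x -> Xp A p y -> Xp A p (k *: x + y).
Proof.
move=> Nx Ny; apply: le_lt_trans (Xp_norm_lin k x y) _.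
apply: lte_add_pinfty; last exact: Ny.
by apply: lte_mul_pinfty; [|by []|exact: Nx].
Qed.

Lemma Xp_norm_ge0 x : (0 <= N x)%E.
Proof. by rewrite Xp_normE lpn_ge0. Qed.

(** The constant of Hardy's inequality, for norms rather than their powers. *)
Definition trace_cst : R := (2 `^ p / (p - 1)) `^ p^-1.

Lemma trace_cst_gt0 : 0 < trace_cst.
Proof. by rewrite powR_gt0// divr_gt0 ?powR_gt0. Qed.

(** The trace inequality: a bound on the K-functional by the primitive of an L^p
    function is, by Hardy's inequality, a bound on the interpolation norm. *)
Lemma Xp_norm_trace (x : X) (H : R -> R) : measurable_fun setT H ->
  (forall s, 0 <= H s) ->
  (forall t, 0 < t -> ((K t x)%:E <= lint `]0%R, t] H)%E) ->
  (N x <= trace_cst%:E * lpn p `]0%R, +oo[ H)%E.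
Proof.
move=> mH H0 KH; rewrite Xp_normE.
have tK t : 0 < t -> ((t * Kq x t)%:E <= lint `]0%R, t] H)%E.
  by move=> t0; rewrite /Kq t0 mulrCA mulfV ?mulr1 ?gt_eqF//; exact: KH.
have := hardy p1 mH H0 (Kq_measurable x) (Kq_ge0 x) tK.
have i0 (D : set R) (g : R -> R) : (0 <= lint D (fun t => g t `^ p)%R)%E.
  by apply: lint_ge0 => t; exact: powR_ge0.
have pV : 0 <= p^-1 by rewrite invr_ge0 ltW.
move=> /(poweR_le pV (i0 _ _)); rewrite poweRM ?lee_fin ?divr_ge0 ?powR_ge0 ?(ltW pm0)//.
Qed.

End interpolation.

(** * Traces in the interpolation space *)

Section trace.
Variables (R : realType) (X : completeNormedModType R) (A : linear_operator X) (p : R).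
Hypothesis p1 : 1 < p.
Local Notation mu := (@lebesgue_measure R).
Let p0 : 0 < p. Proof. exact: lt_trans p1. Qed.
Let p1' : 1 <= p. Proof. exact: ltW. Qed.
Local Notation K := (K_functional (graph_space A)).
Local Notation N := (Xp_norm A p).

(** Absolute continuity of the integral at a point: the complements of shrinking
    intervals around [x] exhaust [D] up to [x] itself, so that the integrals over
    them cannot all stay away from the integral over [D]. *)
Lemma lpn_small_interval (D : set R) (f : R -> R) (x e : R) : measurable D ->
  (forall t, 0 <= f t) -> aem D f -> (lpn p D f < +oo)%E -> 0 < e ->
  exists2 d, 0 < d & (lpn p (D `&` `[(x - d)%R, (x + d)%R]) f <= e%:E)%E.
Proof.
move=> mD f0 mf fin e0.
have [g [mg g0 fg]] := aem_ge0 f0 mf.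
pose F (n : nat) : set R := D `&` `[x - n.+1%:R^-1, x + n.+1%:R^-1]%classic.
have mF n : measurable (F n) by apply: measurableI => //; exact: measurable_itv.
pose h t := g t `^ p * \1_D t.
have h0 t : 0 <= h t by rewrite mulr_ge0 ?powR_ge0.
have mh : measurable_fun setT h.
  apply: measurable_funM; last exact: measurable_indic.
  exact: (measurableT_comp (measurable_powR p) mg).
have hE (E : set R) : E `<=` D -> measurable E -> lint E (fun t => f t `^ p)%R = lint E h.
  move=> ED mE; apply: lint_eq_ae => // [t|]; first exact: powR_ge0.
  by apply: aeS fg => t fg Et; rewrite /h indicE mem_set ?mulr1 ?fg//; exact: ED.
have ih : (lint D h < +oo)%E by rewrite -hE//; exact/lpn_lty.
pose G (n : nat) : set R := [set t | n.+1%:R^-1 < `|t - x|].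
have mG n : measurable (G n).
  rewrite (_ : G n = ~` `[x - n.+1%:R^-1, x + n.+1%:R^-1]%classic).
    by apply: measurableC; exact: measurable_itv.
  apply/seteqP; split => t; rewrite /G /= in_itv/= -ler_distl => H.
    by apply/negP; rewrite -ltNge.
  by move/negP : H; rewrite -ltNge.
have [n hn] : exists n, (lint (F n) h <= (e `^ p)%:E)%E.
  apply: contrapT => /forallNP nF.
  pose c := e `^ p; have c0 : 0 < c by rewrite powR_gt0.
  have fD : lint D h \is a fin_num by rewrite ge0_fin_numE// lint_ge0.
  suff : (lint D h <= lint D h - c%:E)%E.
    by rewrite leeBrDr// -(fineK fD) -EFinD lee_fin gerDl leNgt c0.
  have mDx : measurable (D `\ x) by apply: measurableD => //; exact: measurable_set1.
  rewrite [leLHS](_ : lint D h = lint (D `\ x) h); last first.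
    apply/eqP; rewrite eq_le; apply/andP; split; last by apply: lint_le => // t [].
    apply: lint_le_ae => //; exists [set x]; split => //.
      by rewrite lebesgue_measure_set1.
    move=> t /= /not_implyP[Dt /not_andP[|//]] nt; apply: contrapT => tx; apply: nt.
    by split.
  apply: (lint_exhaust (F := G)) => //.
  - move=> m n mn t; rewrite /G /=; apply: le_lt_trans.
    by rewrite lef_pV2 ?posrE// ler_nat.
  - move=> t [Dt /eqP tx]; exists (Num.truncn (`|t - x|)^-1) => //=.
    rewrite /G /= invf_plt ?posrE ?normr_gt0 ?subr_eq0//; exact: truncnS_gt.
  move=> n; have := nF n => /negP; rewrite -ltNge => hn.
  pose Gn := G n `&` (D `\ x); have mGn : measurable Gn by exact: measurableI.
  have Fc : (c%:E <= lint (F n) h)%E by exact: ltW.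
  rewrite leeBrDr//; apply: le_trans (leeD2l _ Fc) _.
  have disj : [disjoint Gn & F n].
    apply/disj_setPLR => t [Gt _] [_ /=]; rewrite in_itv/= -ler_distl leNgt.
    by rewrite /G /= in Gt; rewrite Gt.
  have mhU : measurable_fun (Gn `|` F n) (EFin \o h).
    by apply/measurable_EFinP; exact: measurable_funS mh.
  have hU0 t : (Gn `|` F n) t -> (0 <= (EFin \o h) t)%E by move=> _; rewrite lee_fin.
  have := ge0_integral_setU mu mGn (mF n) mhU hU0 disj => /esym eU.
  apply: le_trans (_ : (lint (Gn `|` F n) h <= _)%E); first by rewrite /lint eU.
  by apply: (lint_le h0 h0) => [t [[_ [Dt _]]|[Dt _]]|t _].
exists n.+1%:R^-1; first by rewrite invr_gt0.
rewrite -[leRHS](_ : (((e `^ p)%:E) `^ p^-1)%E = _); last first.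
  by rewrite poweR_EFin -powRrM mulfV ?gt_eqF// powRr1 // ltW.
apply: poweR_le; first by rewrite invr_ge0 ltW.
  by apply: lint_ge0 => t; exact: powR_ge0.
by rewrite hE//; exact: mF.
Qed.

Let lpnE (D : set R) (f : R -> R) : lpn p D f = (lint D (fun t => f t `^ p)%R `^ p^-1)%E.
Proof. by []. Qed.

Local Opaque lint lpn weak_derivative is_weak_derivative.

Section interval.
Variables (a b : R) (c : bool).
Let I := [set` Interval (BLeft a) (BSide c b)].
Let mI : measurable I := itv_measurable a b c.

Lemma itv_cc_sub (s t : R) : a <= s -> t < b -> `[s, t] `<=` I.
Proof.
move=> as_ tb x /=; rewrite in_itv/= => /andP[sx xt]; have xb := le_lt_trans xt tb.
rewrite /I /= itv_boundlr bnd_simp (le_trans as_ sx)/=.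
by case: (c); rewrite bnd_simp// ltW.
Qed.

(** Continuity of [u] extends the bound to the left endpoint. *)
Lemma weak_derivative_increment (u v : R -> X) (s t : R) : a <= s -> s <= t -> t < b ->
  {within I, continuous u} -> is_weak_derivative I u v ->
  (`|u t - u s|%:E <= lint `[s, t] (fun x => `|v x|)%R)%E.
Proof.
move=> as_ st tb cu uv.
have [<-|st'] := eqVneq s t; first by rewrite subrr normr0 lint_ge0.
have {st st'}st : s < t by rewrite lt_neqAle st'.
have [as'|sa] := ltP a s; first exact: (@weak_derivative_increment_in _ _ a b c).
have {as_ sa}sa : s = a by apply/eqP; rewrite eq_le sa.
rewrite {}sa in st *.
apply/lee_addgt0Pr => eta eta0.
have aI : I a by apply: (@itv_cc_sub a a) => //=; rewrite ?in_itv/= ?lexx// (lt_trans st).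
have [d d0 dP] := (within_continuousP I u).1 cu a aI _ eta0.
pose s' := a + Num.min (d / 2) ((t - a) / 2).
have m0 : 0 < Num.min (d / 2) ((t - a) / 2) by rewrite lt_min !divr_gt0// subr_gt0.
have m1 : Num.min (d / 2) ((t - a) / 2) <= d / 2 by rewrite ge_min lexx.
have m2 : Num.min (d / 2) ((t - a) / 2) <= (t - a) / 2 by rewrite ge_min lexx orbT.
have as' : a < s' by rewrite /s' ltrDl.
have s't : s' < t by rewrite /s'; lra.
have s'I : I s' by apply: (@itv_cc_sub a s') => //=; rewrite ?in_itv/= ?lexx ?(ltW as')// (lt_trans s't).
have h1 : `|u s' - u a| <= eta.
  by apply: dP => //; rewrite ger0_norm ?subr_ge0 ?(ltW as')// /s'; lra.
have h2 := @weak_derivative_increment_in _ _ a b c u v s' t as' s't tb cu uv.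
apply: (@le_trans _ _ (`|u t - u s'|%:E + `|u s' - u a|%:E)%E).
  by rewrite -EFinD lee_fin -{1}(subrK (u s') (u t)) -addrA ler_normD.
apply: leeD; last by rewrite lee_fin.
apply: le_trans h2 _; apply: lint_le => //.
by apply: subset_itvr; rewrite bnd_simp ltW.
Qed.

Variable (u : R -> X).
Hypotheses (cu : {within I, continuous u}) (mem : MR_mem A p I u).
Local Notation D := (MR_density A a b c u).

Let D0 t : 0 <= D t. Proof. exact: MR_density_ge0. Qed.
Let mD : aem I D. Proof. exact: (MR_density_aem p1 mem). Qed.

Lemma itv_oc_sub (tau t : R) : a <= tau -> tau + t < b -> `]tau, tau + t] `<=` I.
Proof.
move=> atau taut; apply: subset_trans (@itv_cc_sub tau (tau + t) atau taut).
by apply: subset_itvr; rewrite bnd_simp.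
Qed.

(** Averaging the pointwise bound [Q <= |u tau - u s| + t |u s|_(D(A))] over [s]
    in [(tau, tau + t)]. *)
Lemma trace_average (Q tau t : R) : a <= tau -> 0 < t -> tau + t < b -> 0 <= Q ->
  (forall x, dom A x -> Q <= `|u tau - x| + t * (`|x| + `|A x|)) ->
  (Q%:E <= lint `]tau, (tau + t)%R] D)%E.
Proof.
move=> atau t0 taut Q0 Qle; pose J : set R := `]tau, tau + t]%classic.
have JI : J `<=` I by exact: itv_oc_sub.
have mJ : measurable J by exact: measurable_itv.
have muJ : mu J = t%:E.
  by rewrite lebesgue_measure_itv/= lte_fin ltrDl t0 -EFinB; congr EFin; lra.
pose v := weak_derivative I u; pose G s := `|u s| + `|A (u s)|.
have [_ uv /(LpXP p1)[mv _] /(LpAP A p1)[mu_ _]] := MR_memP p1 mem.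
have [du _ _] := graph_smeas mu_.
have mv' : aem J (fun s => `|v s|) by apply: (aem_sub JI); exact: smeas_norm_aem.
have mG : aem J G by apply: (aem_sub JI); exact: graph_norm_aem.
have G0 s : 0 <= G s by rewrite addr_ge0.
have lD : lint J D = (lint J (fun s => `|v s|)%R + lint J G)%E.
  by rewrite -(lintD mJ (fun s => normr_ge0 (v s)) G0 mv' mG).
change (Q%:E <= lint J D)%E.
have v0 : (0 <= lint J (fun s => `|v s|)%R)%E by exact: lint_ge0.
have GG0 : (0 <= lint J G)%E by exact: lint_ge0.
have [fv|/negPf fv] := boolP (lint J (fun s => `|v s|)%R \is a fin_num); last first.
  rewrite lD; move: fv; rewrite ge0_fin_numE// ltNge leye_eq => /negbFE/eqP ->.
  by rewrite addye ?leey// gt_eqF// (lt_le_trans _ GG0).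
have [fG|/negPf fG] := boolP (lint J G \is a fin_num); last first.
  rewrite lD; move: fG; rewrite ge0_fin_numE// ltNge leye_eq => /negbFE/eqP ->.
  by rewrite addey ?leey// gt_eqF// (lt_le_trans _ v0).
pose w := fine (lint J (fun s => `|v s|)%R).
have w0 : 0 <= w by exact: fine_ge0.
have key : {ae mu, forall s, J s -> Q <= w + t * G s}.
  apply: aeS du => s du Js; have Is := JI _ Js; apply: le_trans (Qle _ (du Is)) _.
  rewrite lerD2r -lee_fin /w fineK//.
  move: Js; rewrite /J /= in_itv/= => /andP[s1 s2].
  rewrite distrC; have ts : tau <= s by exact: ltW.
  apply: le_trans (weak_derivative_increment atau ts (le_lt_trans s2 taut) cu uv) _.
  apply: lint_le_ae => //; exists [set tau]; split => //.
    by rewrite lebesgue_measure_set1.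
  move=> x /=; rewrite !in_itv/= => /not_implyP[/andP[x1 x2]] H; apply: contrapT => xt.
  apply: H; split => //; rewrite (le_trans x2 s2) andbT lt_neqAle x1 andbT.
  by apply/eqP => e; apply: xt.
have : (lint J (fun=> Q) <= lint J (fun s => w + t * G s)%R)%E.
  apply: lint_le_ae => //; first by move=> s; rewrite addr_ge0// mulr_ge0// ltW.
  by apply: aeS key => s H Js; split => //; exact: H.
rewrite lintD//; last 3 first.
- by move=> s; rewrite mulr_ge0// ltW.
- exact: aem_measurable.
- exact: aemZ.
rewrite (lintZ mJ (ltW t0) G0 mG) (lint_cst mJ Q0) (lint_cst mJ w0) muJ -!EFinM -(fineK fG) -EFinM -EFinD lee_fin.
rewrite lD -(fineK fv) -(fineK fG) -EFinD lee_fin.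
by rewrite [w * t]mulrC -mulrDr [Q * t]mulrC ler_pM2l.
Qed.

Lemma K_trace (tau t : R) : a <= tau -> 0 < t -> tau + t < b ->
  ((K t (u tau))%:E <= lint `]tau, (tau + t)%R] D)%E.
Proof.
move=> atau t0 taut; apply: trace_average => //; first by apply: K_ge0; exact: ltW.
by move=> x dx; apply: K_le => //; exact: ltW.
Qed.

Lemma norm_trace (tau : R) : a <= tau -> tau + 1 < b ->
  (`|u tau|%:E <= lint `]tau, (tau + 1)%R] D)%E.
Proof.
move=> atau taut; apply: trace_average => // x dx.
rewrite mul1r -{1}(subrK x (u tau)); apply: le_trans (ler_normD _ _) _.
by rewrite lerD2l lerDl.
Qed.

(** Hardy's inequality integrates from 0 over the whole half-line: the density on
    [(tau, tau + d]] is moved to [(0, d]] and extended by zero. *)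
Lemma local_density (tau d : R) : a <= tau -> 0 < d -> tau + d < b ->
  exists H : R -> R, [/\ measurable_fun setT H, forall s, 0 <= H s,
    forall t, 0 < t -> lint `]0, t] H = lint `]tau, tau + Num.min t d] D &
    lpn p `]0, +oo[ H = lpn p `]tau, tau + d] D].
Proof.
move=> atau d0 taud; have [g [mg g0 Dg]] := aem_ge0 D0 mD.
pose E : set R := `]0, d]%classic.
pose H s := g (1 * s + tau) * \1_E s.
have H0 s : 0 <= H s by rewrite mulr_ge0.
have mH : measurable_fun setT H.
  apply: measurable_funM; last by apply: measurable_indic; exact: measurable_itv.
  by apply: (measurableT_comp mg); exact: measurable_affine.
have pre m : (fun t : R => 1 * t + tau) @^-1` `]tau, tau + m] = `]0, m]%classic.
  apply/seteqP; split => t; rewrite /= !in_itv/= mul1r => /andP[h1 h2];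
    apply/andP; split; lra.
have D_itv m (k : R -> R) : (forall x, 0 <= k (g x)) -> measurable_fun setT k ->
    (forall x, 0 <= k (D x)) -> m <= d ->
    lint `]0, m] (fun s => k (g (1 * s + tau)))%R = lint `]tau, tau + m] (fun s => k (D s))%R.
  move=> kg0 mk kD0 md.
  have mkg : aem `]tau, tau + m] (k \o g).
    by apply: aem_measurable; exact: measurableT_comp.
  have mitv : measurable (`]tau, tau + m]%classic : set R) by exact: measurable_itv.
  have := lint_affine tau (ltr01 : (0:R) < 1) mitv kg0 mkg.
  rewrite pre invr1 mul1e => ->; apply: lint_eq_ae => //.
  apply: aeS Dg => s Dg; rewrite /= in_itv/= => /andP[s1 s2]; rewrite Dg//.
  by apply: (itv_oc_sub atau taud); rewrite /= in_itv/= s1 (le_trans s2)// lerD2l.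
exists H; split; [exact: mH|exact: H0| |].
  move=> t t0.
  have sub : `]0, Num.min t d] `<=` `]0, t].
    by apply: subset_itvl; rewrite bnd_simp ge_min lexx.
  have out s : `]0, t]%classic s -> ~ `]0, Num.min t d]%classic s -> H s = 0.
    rewrite /= !in_itv/= le_min => /andP[s0 st] nE; rewrite /H indicE memNset ?mulr0//.
    by rewrite /E /= in_itv/= s0/= => sd; apply: nE; rewrite s0 st.
  rewrite (lint_supp _ _ sub H0 out); [|exact: measurable_itv|exact: measurable_itv].
  rewrite -(D_itv (Num.min t d) id)//; last by rewrite ge_min lexx orbT.
  apply: lint_eq_ae => //; apply: aeT => s; rewrite /= in_itv/= le_min => /andP[s0 /andP[_ sd]].
  by rewrite /H indicE mem_set ?mulr1// /E /= in_itv/= s0.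
have subE : E `<=` `]0, +oo[ by apply: subset_itvl; rewrite bnd_simp.
have out s : `]0, +oo[%classic s -> ~ E s -> H s = 0.
  by move=> _ nE; rewrite /H indicE memNset ?mulr0.
rewrite (lpn_supp _ _ p0 subE H0 out); [|exact: measurable_itv|exact: measurable_itv].
rewrite (@lpn_eq_ae _ _ _ _ (fun s => g (1 * s + tau))); last first.
  by apply: aeT => s Es; rewrite /H indicE mem_set ?mulr1.
rewrite !lpnE; apply: (congr1 (fun z => (z `^ p^-1)%E)).
exact: (D_itv d (fun x => x `^ p) (fun x => powR_ge0 _ _) (measurable_powR p)
  (fun x => powR_ge0 _ _) (lexx d)).
Qed.

(** For [t > 1] the K-functional of [u tau] is bounded by the norm of [u tau], which
    the density on [(tau, tau + 1]] controls as well. *)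
Lemma Xp_norm_MR (tau : R) : a <= tau -> tau + 1 < b ->
  (N (u tau) <= (trace_cst p)%:E * lpn p I D)%E.
Proof.
move=> atau tau1; have C0 : (0 <= (trace_cst p)%:E)%E by rewrite lee_fin ltW// trace_cst_gt0.
have Kle (t : R) : 0 < t -> ((K t (u tau))%:E <= lint `]tau, (tau + Num.min t 1)%R] D)%E.
  move=> t0; have [t1|t1] := leP t 1.
    by apply: K_trace => //; apply: le_lt_trans tau1; rewrite lerD2l.
  apply: le_trans (norm_trace atau tau1).
  by rewrite lee_fin; apply: K_le_norm; exact: ltW.
have lpnI : (lpn p `]tau, (tau + 1)%R] D <= lpn p I D)%E.
  by apply: lpn_le => //; exact: itv_oc_sub.
have [H [mH H0 HD HN]] := local_density atau ltr01 tau1.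
apply: le_trans (Xp_norm_trace p1 mH H0 _) _.
  by move=> t t0; rewrite (HD t t0); exact: Kle.
by rewrite HN; exact: lee_wpmul2l C0 _ _ lpnI.
Qed.

(** The local form of the trace inequality for a difference of two values: the
    part [t > d] of the interpolation norm only sees the norm of [X]. *)
Lemma Xp_norm_increment (d : R) : 0 < d -> exists2 k : R, 0 <= k &
  forall tau tau' : R, a <= tau -> tau + d < b -> a <= tau' -> tau' + d < b ->
  (N (u tau' - u tau)%R <= (trace_cst p)%:E *
     (lpn p `]tau', (tau' + d)%R] D + lpn p `]tau, (tau + d)%R] D +
      (k * `|u tau' - u tau|)%:E))%E.
Proof.
move=> d0; pose E : set R := `]0, d]%classic.
have mE : measurable E by exact: measurable_itv.
have muE : mu E = d%:E.
  by rewrite lebesgue_measure_itv/= lte_fin d0 -EFinB subr0.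
have dV0 : 0 <= d^-1 by rewrite invr_ge0 ltW.
have fk : (lpn p E (fun=> d^-1)%R < +oo)%E.
  by apply/lpn_lty => //; rewrite lint_cst ?powR_ge0// muE ltry.
pose k := fine (lpn p E (fun=> d^-1)).
have k0 : 0 <= k by apply: fine_ge0; exact: lpn_ge0.
exists k => // tau tau' h1 h2 h1' h2'.
set x := u tau' - u tau.
have xd0 : 0 <= `|x| * d^-1 by rewrite mulr_ge0.
pose W s := `|x| * (d^-1 * \1_E s).
have W0 s : 0 <= W s by rewrite !mulr_ge0.
have mW : measurable_fun setT W.
  by apply: measurable_funM => //; apply: measurable_funM => //; exact: measurable_indic.
have WE s : E s -> W s = `|x| * d^-1 by move=> Es; rewrite /W indicE mem_set ?mulr1.
have outW (S : set R) s : S s -> ~ E s -> W s = 0.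
  by move=> _ nE; rewrite /W indicE memNset ?mulr0.
have intW t : d < t -> lint `]0, t] W = `|x|%:E.
  move=> dt; have Et : E `<=` `]0, t] by apply: subset_itvl; rewrite bnd_simp ltW.
  have mt : measurable (`]0, t]%classic : set R) by exact: measurable_itv.
  rewrite (lint_supp mE mt Et W0 (outW _)).
  rewrite (lint_eq_ae W0 (fun=> xd0) (aeT (fun s Es => WE s Es))).
  by rewrite (lint_cst mE xd0) muE -EFinM divfK ?gt_eqF.
have mo : measurable (`]0%R, +oo[%classic : set R) by exact: measurable_itv.
have lpnW : lpn p `]0, +oo[ W = (k * `|x|)%:E.
  have Eo : E `<=` `]0, +oo[ by apply: subset_itvl; rewrite bnd_simp.
  rewrite (lpn_supp mE mo p0 Eo W0 (outW _)).
  rewrite (lpn_eq_ae p (aeT (fun s Es => WE s Es))).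
  rewrite (lpnZ mE p0 (normr_ge0 x) (fun=> dV0) (aem_measurable _ (measurable_cst _))).
  rewrite mulrC EFinM; congr (_ * _)%E; rewrite /k fineK//.
  by rewrite ge0_fin_numE// lpn_ge0.
have K1 t : 0 < t -> ((K t x)%:E <= (K t (u tau'))%:E + (K t (u tau))%:E)%E.
  move=> t0; have := K_lin A (-1) (u tau) (u tau') (ltW t0).
  by rewrite scaleN1r addrC normrN1 mul1r -EFinD lee_fin [X in _ <= X]addrC.
have aemT (f : R -> R) (S : set R) : measurable_fun setT f -> aem S f by exact: aem_measurable.
have C0 : (0 <= (trace_cst p)%:E)%E by rewrite lee_fin ltW// trace_cst_gt0.
have Kt t : d < t -> ((K t x)%:E <= lint `]0%R, t] W)%E.
  move=> dt; rewrite intW// lee_fin; apply: K_le_norm.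
  by rewrite ltW// (lt_trans d0).
have [H' [mH' H'0 HD' HN']] := local_density h1' d0 h2'.
have [H [mH H0 HD HN]] := local_density h1 d0 h2.
pose S s := H' s + H s.
have S0 s : 0 <= S s by exact: addr_ge0.
have mS : measurable_fun setT S by exact: measurable_funD.
have HH0 s : 0 <= S s + W s by exact: addr_ge0.
have mHH : measurable_fun setT (fun s => S s + W s) by exact: measurable_funD.
apply: le_trans (Xp_norm_trace p1 mHH HH0 _) _.
  move=> t t0; have mt : measurable (`]0, t]%classic : set R) by exact: measurable_itv.
  rewrite (lintD mt S0 W0 (aemT _ _ mS) (aemT _ _ mW)).
  rewrite (lintD mt H'0 H0 (aemT _ _ mH') (aemT _ _ mH)).
  have [td|td] := leP t d; last first.
    apply: le_trans (Kt t td) _; apply: leeDr; apply: adde_ge0; exact: lint_ge0.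
  apply: le_trans (K1 t t0) _; rewrite -[leLHS]adde0; apply: leeD; last exact: lint_ge0.
  rewrite (HD t t0) (HD' t t0) (min_l td); apply: leeD; apply: (K_trace _ t0).
  - exact: h1'.
  - by apply: le_lt_trans h2'; rewrite lerD2l.
  - exact: h1.
  - by apply: le_lt_trans h2; rewrite lerD2l.
apply: lee_wpmul2l; first exact: C0.
apply: le_trans (lpnD mo p1' S0 W0 (aemT _ _ mS) (aemT _ _ mW)) _.
apply: leeD; last by rewrite lpnW.
apply: le_trans (lpnD mo p1' H'0 H0 (aemT _ _ mH') (aemT _ _ mH)) _.
by rewrite HN HN'.
Qed.

End interval.
End trace.

(** * The linear problem on closed intervals *)

Section linear_problem.
Variables (R : realType) (X : completeNormedModType R) (A : linear_operator X) (p t0 : R).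
Hypothesis p1 : 1 < p.
Hypothesis maxreg : maximal_regularity A p t0.
Local Notation mu := (@lebesgue_measure R).
Let p0 : 0 < p. Proof. exact: lt_trans p1. Qed.
Local Notation N := (Xp_norm A p).
Local Notation LpX I u := (Lp_mem p I (whole_space X) u).
Local Notation lin := (linear_solution A p).

Lemma time_intervalE (T : R) :
  time_interval t0 T%:E = [set` Interval (BLeft t0) (BSide true (t0 + T))].
Proof.
by apply/seteqP; split => t; rewrite /time_interval /= in_itv/= -EFinD lte_fin => /andP.
Qed.

Lemma MR_norm_eq (I : set R) u v : (forall t, I t -> u t = v t) ->
  {ae mu, forall t, I t -> weak_derivative I u t = weak_derivative I v t} ->
  MR_norm A p I u = MR_norm A p I v.
Proof.
move=> uv uv'; rewrite /MR_norm /W1p_norm !Lp_norm_graphE !Lp_normE.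
have -> : lpn p I (fun t => `|u t| + `|A (u t)|) = lpn p I (fun t => `|v t| + `|A (v t)|).
  by apply: lpn_eq_ae; apply: aeT => t It; rewrite uv.
have -> : lpn p I (fun t => `|u t|) = lpn p I (fun t => `|v t|).
  by apply: lpn_eq_ae; apply: aeT => t It; rewrite uv.
have -> : lpn p I (fun t => `|weak_derivative I u t|) = lpn p I (fun t => `|weak_derivative I v t|).
  by apply: lpn_eq_ae; apply: aeS uv' => t H It; rewrite H.
by [].
Qed.

Let hnE (D : set R) (f : R -> X) : Lp_norm p D (whole_space X) f = lpn p D (fun t => `|f t|)%R.
Proof. by []. Qed.

Local Opaque lint lpn weak_derivative is_weak_derivative.

(** Maximal regularity speaks of half-open intervals; the right endpoint is reached by
    continuity. *)
Lemma linear_solution_unique (d : R) h u0 u v : 0 < d -> Xp A p u0 ->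
  lin `[t0, t0 + d] t0 h u0 u -> lin `[t0, t0 + d] t0 h u0 v ->
  forall t, `[t0, t0 + d]%classic t -> u t = v t.
Proof.
move=> d0 X0 su sv.
have JI : [set` Interval (BLeft t0) (BSide true (t0 + d))] `<=`
          [set` Interval (BLeft t0) (BSide false (t0 + d))].
  by apply: subset_itvl; rewrite bnd_simp.
have su' := linear_solution_sub p1 JI su; have sv' := linear_solution_sub p1 JI sv.
have [C C0 H] := maxreg d0.
have hL := linear_solution_LpX p1 su'.
rewrite time_intervalE in H.
have [w [_ uniq _]] := H _ _ hL X0.
have uv t : t0 <= t -> t < t0 + d -> u t = v t.
  move=> h1 h2; have It : [set` Interval (BLeft t0) (BSide true (t0 + d))] t.
    by rewrite /= in_itv/= h1.
  by rewrite (uniq _ su' _ It) (uniq _ sv' _ It).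
move=> t /=; rewrite in_itv/= => /andP[h1]; rewrite le_eqVlt => /predU1P[|]; last exact: uv.
move=> ->{t h1}; apply/eqP; rewrite -subr_eq0 -normr_le0; apply/ler_addgt0Pr => e e0; rewrite add0r.
have [cu _ _ _] := su; have [cv _ _ _] := sv.
have Jd : `[t0, t0 + d]%classic (t0 + d) by rewrite /= in_itv/= lexx lerDl ltW.
have e20 : 0 < e / 2 by rewrite divr_gt0.
have [du du0 Hu] := (within_continuousP _ u).1 cu _ Jd _ e20.
have [dv dv0 Hv] := (within_continuousP _ v).1 cv _ Jd _ e20.
pose m := Num.min d (Num.min du dv) / 2.
have m0 : 0 < m by rewrite divr_gt0// !lt_min d0 du0 dv0.
have [md mdu mdv] : [/\ m < d, m < du & m < dv].
  have lem x : 0 < x -> Num.min d (Num.min du dv) <= x -> m < x by rewrite /m => *; lra.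
  by split; apply: lem => //; rewrite !ge_min lexx ?orbT.
pose t := t0 + d - m.
have ht : `|t - (t0 + d)| = m by rewrite /t addrC addKr normrN gtr0_norm.
have Jt : `[t0, t0 + d]%classic t by rewrite /= in_itv/= /t; apply/andP; split; lra.
have Eu := Hu _ Jt; have Ev := Hv _ Jt; rewrite ht in Eu Ev.
have {}Eu := Eu mdu; have {}Ev := Ev mdv.
have Et : u t = v t by apply: uv; rewrite /t; lra.
rewrite distrC in Eu; rewrite -Et in Ev.
rewrite -(subrKA (u t)) (splitr e); apply: le_trans (ler_normD _ _) _; exact: lerD.
Qed.

(** Extending the forcing by zero leaves room to the right of the interval, so that
    the trace estimate applies up to the right endpoint. *)
Lemma linear_solution_extend (S : R) : 0 < S -> exists2 C : R, 0 < C &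
  forall (d : R) h u0, 0 <= d -> d <= S -> Xp A p u0 -> LpX `[t0, t0 + d] h -> exists w : R -> X,
  [/\ lin [set` Interval (BLeft t0) (BSide true (t0 + (S + 2))%R)] t0
        (fun t => if t \in `[t0, t0 + d] then h t else 0) u0 w &
   (MR_norm A p [set` Interval (BLeft t0) (BSide true (t0 + (S + 2))%R)] w <=
      C%:E * (N u0 + lpn p `[t0, (t0 + d)%R] (fun t => `|h t|)%R))%E].
Proof.
move=> S0; have S20 : 0 < S + 2 by rewrite addr_gt0.
have [C C0 H] := maxreg S20; exists C => // d h u0 d0 dS X0 hL.
rewrite time_intervalE in H.
set I := [set` _] in H *.
pose J : set R := `[t0, t0 + d]%classic.
have JI : J `<=` I by apply: subset_itvl; rewrite bnd_simp ltrD2l; lra.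
have IJ : I `&` J = J by apply/seteqP; split => [t []//|t Jt]; split => //; exact: JI.
have mI : measurable I by exact: measurable_itv.
have mJ : measurable J by exact: measurable_itv.
have hL' : LpX (I `&` J) h by rewrite IJ; exact: hL.
have [e1 e2] := LpX_restrict p1 mI mJ hL'.
have [w [sw _ bw]] := H _ _ e1 X0.
have fE : (fun t => if t \in J then h t else 0) = (fun t => if t \in `[t0, t0 + d] then h t else 0).
  by apply/funext => t; rewrite mem_setE.
exists w; split; first by rewrite -fE; exact: sw.
by rewrite hnE e2 IJ in bw; exact: bw.
Qed.

Lemma linear_solution_exists (d : R) h u0 : 0 < d -> Xp A p u0 -> LpX `[t0, t0 + d] h ->
  exists u, lin `[t0, t0 + d] t0 h u0 u.
Proof.
move=> d0 X0 hL; have [C C0 H] := linear_solution_extend d0.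
have [w [sw _]] := H _ _ _ (ltW d0) (lexx d) X0 hL; exists w.
have JI : [set` Interval (BLeft t0) (BSide false (t0 + d))] `<=`
   [set` Interval (BLeft t0) (BSide true (t0 + (d + 2)))].
  by apply: subset_itvl; rewrite bnd_simp ltrD2l; lra.
apply: linear_solution_eq (linear_solution_sub p1 JI sw).
by apply: aeT => t Jt; rewrite ifT.
Qed.

(** By uniqueness, [u] is the restriction of the solution whose forcing is extended by
    zero; the constant only depends on [S]. *)
Lemma linear_solution_continue (S : R) : 0 < S -> exists2 C : R, 0 < C &
  forall (d : R) h u0 u, 0 < d -> d <= S -> Xp A p u0 -> lin `[t0, t0 + d] t0 h u0 u ->
  exists w : R -> X,
  [/\ forall t, `[t0, t0 + d]%classic t -> u t = w t,
     {within [set` Interval (BLeft t0) (BSide true (t0 + (S + 2))%R)], continuous w},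
     MR_mem A p [set` Interval (BLeft t0) (BSide true (t0 + (S + 2))%R)] w &
   (MR_norm A p [set` Interval (BLeft t0) (BSide true (t0 + (S + 2))%R)] w <=
      C%:E * (N u0 + lpn p `[t0, (t0 + d)%R] (fun t => `|h t|)%R))%E].
Proof.
move=> S0; have [C C0 H] := linear_solution_extend S0; exists C => // d h u0 u d0 dS X0 su.
have [w [sw bw]] := H _ _ _ (ltW d0) dS X0 (linear_solution_LpX p1 su).
exists w; split; [|by case: sw|by case: sw|exact: bw].
apply: (linear_solution_unique d0 X0 su).
have JI : [set` Interval (BLeft t0) (BSide false (t0 + d))] `<=`
   [set` Interval (BLeft t0) (BSide true (t0 + (S + 2))%R)].
  by apply: subset_itvl; rewrite bnd_simp ltrD2l; lra.
apply: linear_solution_eq (linear_solution_sub p1 JI sw).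
by apply: aeT => t Jt; rewrite ifT.
Qed.

(** Causality: the bound at time [t] is the previous result on [[t0, t]], combined with
    the trace inequality for the extended solution. *)
Lemma linear_solution_bounds (S : R) : 0 < S -> exists2 C : R, 0 < C &
  forall (d : R) h u0 u, 0 < d -> d <= S -> Xp A p u0 -> lin `[t0, t0 + d] t0 h u0 u ->
  (forall t, `[t0, t0 + d]%classic t ->
    (N (u t) <= C%:E * (N u0 + lpn p `[t0, t] (fun t => `|h t|)%R))%E) /\
  (MR_norm A p `[t0, (t0 + d)%R] u <=
     C%:E * (N u0 + lpn p `[t0, (t0 + d)%R] (fun t => `|h t|)%R))%E.
Proof.
move=> S0; have [C C0 H] := linear_solution_continue S0.
have tr0 := trace_cst_gt0 p1.
exists (1 + C + trace_cst p * C); first by rewrite !addr_gt0// mulr_gt0.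
move=> d h u0 u d0 dS X0 su.
set C' := 1 + C + _.
have [C1 C2 C3] : [/\ 1 <= C', C <= C' & trace_cst p * C <= C'].
  by have := mulr_gt0 tr0 C0; rewrite /C'; split; lra.
have Nu0 := Xp_norm_ge0 A p1 u0.
have weak (c : R) (y z : \bar R) : (0 <= y)%E -> c <= C' -> (z <= c%:E * y)%E -> (z <= C'%:E * y)%E.
  move=> y0 cC zc; apply: le_trans zc _; apply: lee_wpmul2r => //.
have IJ : [set` Interval (BLeft t0) (BSide false (t0 + d))] `<=`
   [set` Interval (BLeft t0) (BSide true (t0 + (S + 2))%R)].
  by apply: subset_itvl; rewrite bnd_simp ltrD2l; lra.
have Y0 (D : set R) : (0 <= N u0 + lpn p D (fun t => `|h t|)%R)%E.
  by apply: adde_ge0 Nu0 _; exact: lpn_ge0.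
split.
  move=> t /=; rewrite in_itv/= => /andP[]; rewrite le_eqVlt => /predU1P[<- _|t0t td].
    have [_ _ _ ->] := su.
    apply: (weak 1 _ _ (Y0 _) C1).
    by rewrite mul1e leeDl// lpn_ge0.
  have s0 : 0 < t - t0 by rewrite subr_gt0.
  have sS : t - t0 <= S by lra.
  have tE : t0 + (t - t0) = t by rewrite addrC subrK.
  have sub : [set` Interval (BLeft t0) (BSide false (t0 + (t - t0)))] `<=`
     [set` Interval (BLeft t0) (BSide false (t0 + d))].
    by apply: subset_itvl; rewrite bnd_simp tE.
  have su' := linear_solution_sub p1 sub su.
  have [w [uw cw mw bw]] := H _ _ _ _ s0 sS X0 su'.
  rewrite tE in uw bw.
  have -> : u t = w t by apply: uw; rewrite /= in_itv/= lexx ltW.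
  apply: (weak (trace_cst p * C) _ _ (Y0 _) C3).
  have b1 : t + 1 < t0 + (S + 2) by lra.
  apply: le_trans (Xp_norm_MR p1 cw mw (ltW t0t) b1) _.
  rewrite EFinM -muleA; apply: lee_wpmul2l; first by rewrite lee_fin ltW.
  exact: le_trans (MR_density_le p1 mw) bw.
have [w [uw cw mw bw]] := H _ _ _ _ d0 dS X0 su.
apply: (weak C _ _ (Y0 _) C2).
have uw' : {ae mu, forall t, `[t0, t0 + d]%classic t ->
    weak_derivative `[t0, t0 + d] u t = weak_derivative `[t0, t0 + d] w t}; last first.
  by rewrite (MR_norm_eq uw uw'); exact: le_trans (MR_norm_sub p1 IJ mw) bw.
have [_ mu_ _ _] := su.
have [_ uv _ _] := MR_memP p1 mu_.
have [_ wv _ _] := MR_memP p1 (MR_mem_sub p1 IJ mw).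
apply: (@weak_derivative_unique _ _ t0 (t0 + d) false u _ _ uv).
by apply: (is_weak_derivative_eq _ _ wv); apply: aeT => // t Jt; rewrite uw.
Qed.

(** In [Xp_norm_increment] the length of the intervals is chosen first, to make the
    integral terms small; then [u s] is taken close to [u t] in X. *)
Lemma linear_solution_Xp_continuous (d : R) h u0 u : 0 < d -> Xp A p u0 ->
  lin `[t0, t0 + d] t0 h u0 u ->
  forall t, `[t0, t0 + d]%classic t -> forall e, 0 < e -> exists2 r : R, 0 < r &
    forall s, `[t0, t0 + d]%classic s -> `|s - t| < r -> (N (u s - u t)%R <= e%:E)%E.
Proof.
move=> d0 X0 su t Jt e e0.
have [C C0 H] := linear_solution_continue d0.
have [w [uw cw mw _]] := H _ _ _ _ d0 (lexx d) X0 su.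
set I := [set` Interval (BLeft t0) (BSide true (t0 + (d + 2)))] in cw mw.
have mI : measurable I by exact: measurable_itv.
have tr0 := trace_cst_gt0 p1.
pose e' := e / trace_cst p / 3.
have e'0 : 0 < e' by rewrite !divr_gt0.
have fD : (lpn p I (MR_density A t0 (t0 + (d + 2)) true w) < +oo)%E.
  exact: le_lt_trans (MR_density_le p1 mw) (MR_norm_lty p1 mw).
have D0 := MR_density_ge0 A t0 (t0 + (d + 2)) true w.
have [r r0 Hr] := lpn_small_interval p1 t mI D0 (MR_density_aem p1 mw) fD e'0.
pose q := Num.min r 1 / 2.
have m0 : 0 < Num.min r 1 by rewrite lt_min r0 ltr01.
have m1 : Num.min r 1 <= r by rewrite ge_min lexx.
have m2 : Num.min r 1 <= 1 by rewrite ge_min lexx orbT.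
have q0 : 0 < q by rewrite /q; lra.
have [qr q1] : 2 * q <= r /\ q < 1 by rewrite /q; split; lra.
have [k k0 Hk] := Xp_norm_increment p1 cw mw q0.
have It : I t by move: Jt; rewrite /I /= !in_itv/= => /andP[-> /= tt]; lra.
have ek : 0 < e' / (k + 1) by rewrite divr_gt0// ltr_wpDl.
have [r' r'0 Hr'] := (within_continuousP _ w).1 cw _ It _ ek.
exists (Num.min q r'); first by rewrite lt_min q0.
move=> s Js; rewrite lt_min => /andP[sq sr'].
have [t1 t2] : t0 <= t /\ t <= t0 + d by move: Jt; rewrite /= in_itv/= => /andP.
have [s1 s2] : t0 <= s /\ s <= t0 + d by move: Js; rewrite /= in_itv/= => /andP.
have Is : I s by rewrite /I /= in_itv/= s1/=; lra.
rewrite (uw _ Jt) (uw _ Js).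
have tq : t + q < t0 + (d + 2) by lra.
have sq' : s + q < t0 + (d + 2) by lra.
apply: le_trans (Hk t s t1 tq s1 sq') _.
have small x : t0 <= x -> x <= t0 + d -> `|x - t| < q ->
    (lpn p `]x, (x + q)%R] (MR_density A t0 (t0 + (d + 2)) true w) <= e'%:E)%E.
  move=> x1 x2 xt; apply: le_trans Hr; apply: lpn_le => // y; rewrite /= !in_itv/= => /andP[y1 y2].
  have [x3 x4] : t - x < q /\ x - t < q.
    by move: xt; rewrite ltr_norml => /andP[]; move=> ? ?; split; lra.
  rewrite /I /= in_itv/=.
  by split; apply/andP; split; lra.
have -> : e = trace_cst p * (e' + e' + e') by rewrite /e'; field; rewrite gt_eqF.
rewrite [X in (_ <= X)%E]EFinM; apply: lee_wpmul2l; first by rewrite lee_fin ltW.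
rewrite !EFinD; apply: leeD; first apply: leeD.
- exact: small.
- by apply: small => //; rewrite subrr normr0.
rewrite lee_fin; apply: le_trans (_ : k * (e' / (k + 1)) <= _).
  by apply: ler_wpM2l => //; exact: Hr'.
have k10 : 0 < k + 1 by rewrite ltr_wpDl.
by rewrite mulrCA ler_piMr ?(ltW e'0)// ler_pdivrMr// mul1r lerDl.
Qed.

End linear_problem.

(** * Exponential weights and continuous forcing *)

Section estimates.
Variables (R : realType) (X : completeNormedModType R) (p : R).
Hypothesis p1 : 1 < p.
Local Notation mu := (@lebesgue_measure R).
Let p0 : 0 < p. Proof. exact: lt_trans p1. Qed.
Local Notation LpX I u := (Lp_mem p I (whole_space X) u).

Lemma lint_expR (l t0 t : R) : 0 < l -> t0 <= t ->
  (lint `[t0, t] (fun s => expR (l * (s - t0)))%R <= (l^-1 * expR (l * (t - t0)))%:E)%E.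
Proof.
move=> l0; rewrite le_eqVlt => /predU1P[<-|t0t].
  have E0 s : 0 <= expR (l * (s - t0)) by exact: expR_ge0.
  have mu0 : mu [set t0] = 0%E by exact: lebesgue_measure_set1.
  rewrite set_itv1 (lint_null (measurable_set1 t0) E0 mu0) lee_fin.
  by rewrite mulr_ge0 ?invr_ge0 ?expR_ge0 ?ltW.
pose F (s : R) := l^-1 * expR (l * (s - t0)).
have dF (s : R) : is_derive s 1 F (expR (l * (s - t0))).
  have h1 : is_derive s 1 (fun s : R => l * (s - t0)) l.
    by apply: is_derive_eq; rewrite subr0 /GRing.scale/= mulr1.
  have := is_deriveZ l^-1 (@is_derive1_comp _ expR (fun s => l * (s - t0)) _ _ _ (is_derive_expR (l * (s - t0))) h1).
  by rewrite /GRing.scale/= mulrCA mulVf ?gt_eqF// mulr1.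
have contF (s : R) : {for s, continuous F}.
  by apply: differentiable_continuous; apply/derivable1_diffP; have [] := dF s.
have contE (s : R) : {for s, continuous (fun s : R => expR (l * (s - t0)))}.
  rewrite (_ : (fun s : R => _) = (fun s => l * F s)).
    by apply: continuousM; [exact: cst_continuous|exact: contF].
  by apply/funext => r; rewrite /F mulrA mulfV ?gt_eqF// mul1r.
rewrite /lint (@continuous_FTC2 _ _ F)//.
- rewrite -EFinB lee_fin /F subrr mulr0 expR0 mulr1 lerBlDr lerDl.
  by rewrite invr_ge0 ltW.
- by apply: continuous_subspaceT => s; exact: contE.
- split.
  + by move=> s _; have [] := dF s.
  + by apply: cvg_at_right_filter; exact: contF.
  + by apply: cvg_at_left_filter; exact: contF.
- by move=> s _; rewrite derive1E; have [_] := dF s.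
Qed.

(** The exponential weight of rate [k^p / p]: its L^p norm up to time [t] is at most
    [1/k] times its value at [t]. *)
Definition weight (k t0 t : R) : R := expR (k `^ p / p * (t - t0)).

Lemma weight_ge0 k t0 t : 0 <= weight k t0 t. Proof. exact: expR_ge0. Qed.

Lemma weight_mono k t0 s t : s <= t -> weight k t0 s <= weight k t0 t.
Proof. by move=> st; rewrite ler_expR ler_wpM2l ?lerD2r// divr_ge0 ?powR_ge0// ltW. Qed.

Lemma weight_ge1 k t0 t : t0 <= t -> 1 <= weight k t0 t.
Proof. by move=> tt; rewrite -expR0 ler_expR mulr_ge0 ?subr_ge0// divr_ge0 ?powR_ge0// ltW. Qed.

Lemma weight_measurable k t0 : measurable_fun setT (weight k t0).
Proof.
apply: continuous_measurable_fun => s; rewrite /weight.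
apply: (@continuous_comp _ _ _ (fun s : R => k `^ p / p * (s - t0)) expR); last exact: continuous_expR.
apply: continuousM; first exact: cst_continuous.
by apply: continuousB; [exact: cvg_id|exact: cst_continuous].
Qed.

Lemma lpn_weight (k t0 t : R) : 0 < k -> t0 <= t ->
  (lpn p `[t0, t] (weight k t0) <= (k^-1 * weight k t0 t)%:E)%E.
Proof.
move=> k0 tt; rewrite /lpn.
have wp s : weight k t0 s `^ p = expR (k `^ p * (s - t0)).
  by rewrite /weight -expRM; congr expR; field; rewrite gt_eqF.
rewrite (_ : (fun s => weight k t0 s `^ p) = (fun s => expR (k `^ p * (s - t0)))); last first.
  by apply/funext.
have kp : 0 < k `^ p by exact: powR_gt0.
have b := lint_expR kp tt.
apply: le_trans (poweR_le _ _ b) _; first by rewrite invr_ge0 ltW.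
  by apply: lint_ge0 => s; exact: expR_ge0.
rewrite poweR_EFin lee_fin -wp powRM ?invr_ge0 ?powR_ge0// -powRN -!powRrM.
rewrite mulNr mulfV ?gt_eqF// powR_inv1 ?(ltW k0)// powRr1//; exact: weight_ge0.
Qed.

(** The function is sampled on a grid of mesh [1 / (k + 1)]. *)
Lemma continuous_smeas (a b : R) (f : R -> X) : {within `[a, b], continuous f} ->
  smeas `[a, b] f.
Proof.
move=> cf; have [ab|ba] := leP a b; last first.
  rewrite set_itv_ge//; last by rewrite bnd_simp -ltNge.
  by apply: (smeas_eq (g := fun=> 0)); [exact: aeT|exact: smeas0].
pose E : set R := `[a, b]%classic; have mE : measurable E by exact: measurable_itv.
pose i (k : nat) (t : R) : nat := if t \in E then Num.truncn ((t - a) * k.+1%:R) else 0%N.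
have iS k : fsimple (i k).
  split.
    apply: (@sub_finite_set _ _ `I_((Num.truncn ((b - a) * k.+1%:R)).+1)); last exact: finite_II.
    move=> _ [t _ <-]; rewrite /i; case: ifPn => //= /set_mem; rewrite /E /= in_itv/= => /andP[_ tb].
    by rewrite ltnS le_truncn// ler_pM2r// lerD2r.
  have iE t z : E t -> (i k t == z) = (z%:R <= (t - a) * k.+1%:R < z.+1%:R).
    move=> Et; rewrite /i mem_set// truncn_eq// mulr_ge0// subr_ge0.
    by move: Et; rewrite /E /= in_itv/= => /andP[].
  have iN t : ~ E t -> i k t = 0%N by move=> Et; rewrite /i memNset.
  have k0 : 0 < k.+1%:R :> R by [].
  move=> z; pose J : set R := `[z%:R / k.+1%:R + a, z.+1%:R / k.+1%:R + a[%classic.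
  have JE t : J t = (z%:R <= (t - a) * k.+1%:R < z.+1%:R) :> Prop.
    by rewrite /J /= in_itv/= -lerBrDr -ltrBlDr ler_pdivrMr// ltr_pdivlMr.
  rewrite (_ : _ @^-1` _ = (E `&` J) `|` (if z == 0%N then ~` E else set0)).
    apply: measurableU; first by apply: measurableI => //; exact: measurable_itv.
    by case: ifP => _ //; exact: measurableC.
  apply/seteqP; split => t /=.
    have [Et|Et] := pselect (E t).
      by move=> /eqP; rewrite iE// => H; left; split => //; rewrite JE.
    by move=> iz; right; rewrite -iz iN.
  case=> [[Et]|]; first by rewrite JE -iE// => /eqP.
  by case: ifP => //= /eqP -> Et; rewrite iN.
apply/smeasP; exists (fun k => (fun j : nat => f (a + j%:R / k.+1%:R)) \o i k).
  by move=> k; exact: fsimple_comp.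
apply: aeT => t Et; apply/cvgrPdist_le => e e0.
have [d d0 H] := (within_continuousP _ f).1 cf t Et _ e0.
have [t1 t2] : a <= t /\ t <= b by move: Et; rewrite /= in_itv/= => /andP.
near=> k.
have k0 : 0 < k.+1%:R :> R by [].
have ta : 0 <= (t - a) * k.+1%:R by rewrite mulr_ge0// subr_ge0.
have /andP[q1 q2] := truncn_itv ta.
rewrite distrC /= /i mem_set//; set j := Num.truncn _ in q1 q2 *.
have h1 : a + j%:R / k.+1%:R <= t by rewrite -lerBrDl ler_pdivrMr.
have h2 : t < a + j%:R / k.+1%:R + k.+1%:R^-1.
  by rewrite -addrA -ltrBlDl -{2}[k.+1%:R^-1]mul1r -mulrDl ltr_pdivlMr// natr1.
apply: H; first by rewrite /= in_itv/= (le_trans h1 t2) andbT lerDl divr_ge0.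
rewrite distrC ger0_norm ?subr_ge0// ltrBlDl (lt_trans h2)// ltrD2l.
by near: k; exact: near_infty_natSinv_lt (PosNum d0).
Unshelve. all: by end_near. Qed.

Lemma continuous_LpX (a b : R) (f : R -> X) : {within `[a, b], continuous f} ->
  LpX `[a, b] f.
Proof.
move=> cf; apply/(LpXP p1); split; first exact: continuous_smeas.
have [ab|ba] := leP a b; last first.
  have e0 : lint set0 (fun t => `|f t| `^ p) = 0%E by rewrite /lint integral_set0.
  by rewrite set_itv_ge ?bnd_simp -?ltNge//; apply/lpn_lty => //; rewrite e0.
have [c _ cM] : exists2 c, c \in `[a, b]%R & forall t, t \in `[a, b]%R -> `|f t| <= `|f c|.
  apply: (@EVT_max _ (fun t => `|f t|)) => //.
  by move=> x; apply: continuous_comp; [exact: cf|exact: norm_continuous].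
apply/lpn_lty => //.
apply: (@le_lt_trans _ _ (lint `[a, b] (fun=> `|f c| `^ p))).
  apply: (lint_le (fun t => powR_ge0 _ _) (fun=> powR_ge0 _ _) (@subset_refl _ _)) => t Et.
  by apply: (ge0_ler_powR (ltW p0)); rewrite ?nnegrE ?normr_ge0//; exact: cM.
rewrite lint_cst ?powR_ge0//; apply: lte_mul_pinfty; rewrite ?lee_fin ?powR_ge0//.
by rewrite lebesgue_measure_itv/=; case: ifP => // _; rewrite -EFinB ltry.
Qed.

End estimates.

(** * Lipschitz nonlinearities in the weighted norm *)

Section geometric.
Variable R : realType.

Lemma geometric_small (Q e : R) : 0 <= Q -> 0 < e -> exists k : nat, Q / 2 ^+ k <= e.
Proof.
move=> Q0 e0; exists (Num.truncn (Q / e)).+1; rewrite ler_pdivrMr ?exprn_gt0//.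
rewrite mulrC -ler_pdivrMr//; apply: le_trans (ltW (truncnS_gt _)) _.
by rewrite -natrX ler_nat; apply: ltnW; exact: ltn_expl.
Qed.

Lemma geometric_limit (X : completeNormedModType R) (x : nat -> X) (L : R) : 0 <= L ->
  (forall k, `|x k.+1 - x k| <= L / 2 ^+ k) ->
  exists l, forall k, `|l - x k| <= 2 * L / 2 ^+ k.
Proof.
move=> L0 Hx.
have tail k m : `|x (k + m)%N - x k| <= 2 * L / 2 ^+ k - 2 * L / 2 ^+ (k + m).
  elim: m => [|m IH]; first by rewrite addn0 !subrr normr0.
  rewrite addnS -(subrKA (x (k + m)%N)); apply: le_trans (ler_normD _ _) _.
  apply: le_trans (lerD (Hx _) IH) _.
  rewrite addrC -addrA lerD2l exprS invfM; set y := (2 ^+ (k + m))^-1.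
  by rewrite le_eqVlt; apply/orP; left; apply/eqP; field.
have tail' k m : `|x (k + m)%N - x k| <= 2 * L / 2 ^+ k.
  by apply: le_trans (tail k m) _; rewrite gerBl divr_ge0 ?mulr_ge0 ?exprn_ge0.
have : cvgn x.
  apply/cauchy_cvgP; apply: cauchy_exP => e e0.
  have L20 : 0 <= 2 * L by rewrite mulr_ge0.
  have [k Hk] := geometric_small L20 (divr_gt0 e0 (ltr0n R 2)).
  exists (x k); have : \forall n \near \oo, ball (x k) e (x n); last by [].
  exists k => // n /= kn.
  rewrite -ball_normE /= -(subnKC kn) distrC; apply: le_lt_trans (tail' _ _) _.
  by apply: le_lt_trans Hk _; rewrite ltr_pdivrMr// ltr_pMr// ltr1n.
move=> cx; exists (limn x) => k.
apply/ler_addgt0Pr => e e0.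
have /cvgrPdist_lt /(_ _ e0) [m _ Hm] := cx.
rewrite -(subrKA (x (k + m)%N)) addrC; apply: le_trans (ler_normD _ _) _.
by apply: lerD; [exact: tail'|apply/ltW/Hm; exact: leq_addl].
Qed.

End geometric.

Section semilinear.
Variables (R : realType) (X : completeNormedModType R) (A : linear_operator X) (p t0 : R).
Hypothesis p1 : 1 < p.
Hypothesis maxreg : maximal_regularity A p t0.
Variable f : X -> X.
Hypothesis f_lip : lipschitz_on_bounded_subsets A p f.
Let p0 : 0 < p. Proof. exact: lt_trans p1. Qed.
Let p1' : 1 <= p. Proof. exact: ltW. Qed.
Local Notation N := (Xp_norm A p).
Local Notation LpX I u := (Lp_mem p I (whole_space X) u).
Local Notation lin := (linear_solution A p).

Local Opaque lint lpn weak_derivative is_weak_derivative.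

Lemma Xp_norm0 : N 0 = 0%E.
Proof.
have H0 (s : R) : 0 <= (0 : R) by [].
apply/eqP; rewrite eq_le Xp_norm_ge0// andbT.
apply: le_trans (Xp_norm_trace p1 (measurable_cst (0 : R)) H0 _) _.
  by move=> t t_gt0; rewrite lint0 lee_fin -(normr0 X); apply: K_le_norm; exact: ltW.
by rewrite lpn0 ?mule0.
Qed.

Lemma Xp_normBC x y : N (x - y) = N (y - x).
Proof.
have le_ (u v : X) : (N (u - v)%R <= N (v - u)%R)%E.
  have := Xp_norm_lin A p1 (-1) (v - u) 0.
  by rewrite Xp_norm0 adde0 addr0 scaleN1r opprB normrN1 mul1e.
apply/eqP; rewrite eq_le; apply/andP; split; [exact: (le_ x y)|exact: (le_ y x)].
Qed.

Lemma Xp_norm_dist x y z (a b : R) : (N (x - y)%R <= a%:E)%E -> (N (y - z)%R <= b%:E)%E ->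
  (N (x - z)%R <= (a + b)%:E)%E.
Proof.
move=> xy yz; have := Xp_norm_lin A p1 1 (x - y) (y - z).
rewrite scale1r subrKA normr1 mul1e => /le_trans; apply.
by rewrite EFinD; exact: leeD.
Qed.

Lemma lipschitz_ball (r : R) : exists2 L : R, 0 <= L &
  forall x y (m : R), (N x <= r%:E)%E -> (N y <= r%:E)%E -> (N (x - y)%R <= m%:E)%E ->
    `|f x - f y| <= L * m.
Proof.
have [||L L0 H] := f_lip (B := [set x | (N x <= r%:E)%E]).
- by move=> x /= xr; apply: le_lt_trans xr (ltry _).
- by exists r.
exists L => // x y m xr yr xy; rewrite -lee_fin; apply: le_trans (H _ _ xr yr) _.
by rewrite EFinM; apply: lee_wpmul2l => //; rewrite lee_fin.
Qed.

Lemma linear_solutionB (a b : R) (c : bool) h h' (u0 v0 : X) u v :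
  lin [set` Interval (BLeft a) (BSide c b)] t0 h u0 u ->
  lin [set` Interval (BLeft a) (BSide c b)] t0 h' v0 v ->
  lin [set` Interval (BLeft a) (BSide c b)] t0 (fun t => h t - h' t) (u0 - v0)
    (fun t => u t - v t).
Proof.
move=> su sv; have := linear_solution_lin p1 (-1) sv su.
have E (w w' : R -> X) : (fun t => -1 *: w t + w' t) = (fun t => w' t - w t).
  by apply/funext => t; rewrite scaleN1r addrC.
by rewrite !E scaleN1r addrC.
Qed.

Lemma XpB x y : Xp A p x -> Xp A p y -> Xp A p (x - y).
Proof. by move=> Nx Ny; rewrite -scaleN1r addrC; exact: Xp_lin. Qed.

(** Forcing terms are compared in the exponentially weighted norm of rate [k^p / p],
    where the solution operator has norm at most [C / k]. *)
Lemma linear_solution_weighted (S : R) : 0 < S -> exists2 C : R, 0 < C &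
  forall (k d M : R) h h1 w0 w, 0 < k -> 0 < d -> d <= S -> 0 <= M -> Xp A p w0 ->
  lin `[t0, t0 + d] t0 h w0 w -> LpX `[t0, t0 + d] h1 ->
  (forall s, `[t0, t0 + d]%classic s -> `|h s - h1 s| <= M * weight p k t0 s) ->
  (forall t, `[t0, t0 + d]%classic t ->
    (N (w t) <= C%:E * (N w0 + lpn p `[t0, (t0 + d)%R] (fun t => `|h1 t|)%R +
      (M / k * weight p k t0 t)%:E))%E) /\
  (MR_norm A p `[t0, (t0 + d)%R] w <= C%:E * (N w0 +
    lpn p `[t0, (t0 + d)%R] (fun t => `|h1 t|)%R + (M / k * weight p k t0 (t0 + d))%:E))%E.
Proof.
move=> S0; have [C C0 H] := linear_solution_bounds p1 maxreg S0; exists C => //.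
move=> k d M h h1 w0 w k0 d0 dS M0 X0 sw h1L hh.
have [h1m _] := (LpXP p1 _ _).1 h1L.
have [hm _] := (LpXP p1 _ _).1 (linear_solution_LpX p1 sw).
have [b1 b2] := H _ _ _ _ d0 dS X0 sw.
have CE0 : (0 <= C%:E)%E by rewrite lee_fin ltW.
have est t : t0 <= t -> t <= t0 + d -> (lpn p `[t0, t] (fun s => `|h s|)%R <=
    lpn p `[t0, (t0 + d)%R] (fun s => `|h1 s|)%R + (M / k * weight p k t0 t)%:E)%E.
  move=> t1 t2; have sub : `[t0, t] `<=` `[t0, t0 + d] by apply: subset_itvl; rewrite bnd_simp.
  have mt : measurable (`[t0, t]%classic : set R) by exact: measurable_itv.
  have a1 : aem `[t0, t] (fun s => `|h1 s|).
    by apply: smeas_norm_aem => //; exact: smeas_sub h1m.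
  have a2 : aem `[t0, t] (weight p k t0) by apply: aem_measurable; exact: weight_measurable.
  have q1 : (lpn p `[t0, t] (fun s => `|h s|)%R <=
      lpn p `[t0, t] (fun s => (`|h1 s| + M * weight p k t0 s)%R)%R)%E.
    apply: (lpn_le p0 (fun s => normr_ge0 (h s)) _ (@subset_refl _ _)).
      by move=> s; rewrite addr_ge0 ?mulr_ge0 ?weight_ge0.
    move=> s Js; rewrite -{1}(subrK (h1 s) (h s)) addrC; apply: le_trans (ler_normD _ _) _.
    by rewrite lerD2l; apply: hh; exact: sub.
  have Mw s : 0 <= M * weight p k t0 s by rewrite mulr_ge0 ?weight_ge0.
  apply: le_trans q1 _.
  apply: le_trans (lpnD mt p1' (fun s => normr_ge0 (h1 s)) Mw a1 (aemZ M a2)) _.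
  apply: leeD.
    by apply: (lpn_le p0 (fun s => normr_ge0 (h1 s)) (fun s => normr_ge0 (h1 s)) sub) => s _.
  rewrite (lpnZ mt p0 M0 (weight_ge0 p k t0) a2) -mulrA EFinM.
  by apply: lee_wpmul2l; rewrite ?lee_fin//; exact: (lpn_weight p1 k0 t1).
split.
  move=> t Jt; have [t1 t2] : t0 <= t /\ t <= t0 + d by move: Jt; rewrite /= in_itv/= => /andP.
  apply: le_trans (b1 t Jt) _; apply: lee_wpmul2l; first exact: CE0.
  by rewrite -addeA; apply: leeD2l; exact: (est t t1 t2).
have tE : t0 <= t0 + d by rewrite lerDl ltW.
apply: le_trans b2 _; apply: lee_wpmul2l; first exact: CE0.
by rewrite -addeA; apply: leeD2l; exact: (est _ tE (lexx _)).
Qed.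

(** Composition with [f] turns X_p-continuity into continuity in [X]. *)
Lemma lipschitz_continuous (d r : R) h u0 v : 0 < d -> Xp A p u0 ->
  lin `[t0, t0 + d] t0 h u0 v ->
  (forall t, `[t0, t0 + d]%classic t -> (N (v t) <= r%:E)%E) ->
  {within `[t0, t0 + d], continuous (fun t => f (v t))}.
Proof.
move=> d0 X0 sv vr; have [L L0 HL] := lipschitz_ball r.
apply/within_continuousP => x Jx e e0.
have e1 : 0 < e / (L + 1) by rewrite divr_gt0// ltr_wpDl.
have [q q0 Hq] := linear_solution_Xp_continuous p1 maxreg d0 X0 sv Jx e1.
exists q => // y Jy yx.
apply: le_trans (HL _ _ _ (vr y Jy) (vr x Jx) (Hq y Jy yx)) _.
have L10 : 0 < L + 1 by rewrite ltr_wpDl.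
by rewrite mulrCA ler_piMr ?(ltW e0)// ler_pdivrMr// mul1r lerDl.
Qed.

End semilinear.

(** * The fixed point *)

Section picard.
Variables (R : realType) (X : completeNormedModType R) (A : linear_operator X) (p t0 : R).
Hypothesis p1 : 1 < p.
Hypothesis maxreg : maximal_regularity A p t0.
Variable f : X -> X.
Hypothesis f_lip : lipschitz_on_bounded_subsets A p f.
Let p0 : 0 < p. Proof. exact: lt_trans p1. Qed.
Local Notation N := (Xp_norm A p).
Local Notation LpX I u := (Lp_mem p I (whole_space X) u).
Local Notation lin := (linear_solution A p).

Local Opaque lint lpn weak_derivative is_weak_derivative.

(** The problem [u' + A u = f(u) + G], [u t0 = u0]. *)
Definition semilinear_solution (d : R) (G : R -> X) (u0 : X) (v : R -> X) : Prop :=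
  lin `[t0, t0 + d] t0 (fun t => f (v t) + G t) u0 v.

Section iteration.
Variables (r C L k d eta : R) (c h G : R -> X) (c0 u0 : X).
Hypotheses (C0 : 0 < C) (L0 : 0 <= L) (k0 : 0 < k) (d0 : 0 < d).
Let J : set R := `[t0, t0 + d]%classic.
Local Notation W := (weight p k t0).
Hypothesis HC : forall (M : R) h h1 w0 w, 0 <= M -> Xp A p w0 ->
  lin J t0 h w0 w -> LpX J h1 ->
  (forall s, J s -> `|h s - h1 s| <= M * W s) ->
  (forall t, J t ->
    (N (w t) <= C%:E * (N w0 + lpn p J (fun t => `|h1 t|)%R + (M / k * W t)%:E))%E) /\
  (MR_norm A p J w <= C%:E * (N w0 +
    lpn p J (fun t => `|h1 t|)%R + (M / k * W (t0 + d))%:E))%E.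
Hypothesis HL : forall x y (m : R), (N x <= (r + 1)%:E)%E -> (N y <= (r + 1)%:E)%E ->
  (N (x - y)%R <= m%:E)%E -> `|f x - f y| <= L * m.
Hypothesis kE : 2 * (C * L) <= k.
Hypotheses (Xc : Xp A p c0) (Xu : Xp A p u0) (sc : lin J t0 h c0 c).
Hypothesis cr : forall t, J t -> (N (c t) <= r%:E)%E.
Hypothesis GL : LpX J G.
Hypothesis eta0 : 0 <= eta.
(* The error made by [c] in initial value and forcing, and its size relative to the
   weight, which keeps the iteration at distance at most 1 from [c]. *)
Hypothesis Heta : (C%:E * (N (u0 - c0)%R + lpn p J (fun t => `|f (c t) + G t - h t|)%R) <= eta%:E)%E.
Hypothesis eta1 : 2 * eta * W (t0 + d) <= 1.

Let mJ : measurable J. Proof. exact: measurable_itv. Qed.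
Let CE0 : (0 <= C%:E)%E. Proof. by rewrite lee_fin ltW. Qed.
Let Jle t : J t -> t0 <= t /\ t <= t0 + d.
Proof. by rewrite /J /= in_itv/= => /andP. Qed.
Let wle t : J t -> W t <= W (t0 + d).
Proof. by move=> /Jle[_ t2]; exact: weight_mono. Qed.
Let W1 t : J t -> 1 <= W t.
Proof. by move=> /Jle[t1 _]; exact: weight_ge1. Qed.
Let W0 t : 0 <= W t. Proof. exact: weight_ge0. Qed.

(** Preserved by the iteration: the first [eta] of the bound absorbs the error of [c],
    the second one the Lipschitz term, as [k] is at least [2 C L]. *)
Let inv v := (exists h1 w0, Xp A p w0 /\ lin J t0 h1 w0 v) /\
  forall t, J t -> (N (v t - c t)%R <= (2 * eta * W t)%:E)%E.

Let small t : J t -> 2 * eta * W t <= 1.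
Proof.
by move=> Jt; apply: le_trans eta1; rewrite ler_wpM2l ?mulr_ge0// wle.
Qed.

Let bounded (v : R -> X) : (forall t, J t -> (N (v t - c t)%R <= (2 * eta * W t)%:E)%E) ->
  forall t, J t -> (N (v t) <= (r + 1)%:E)%E.
Proof.
move=> H t Jt; have c_ : (N (c t - 0)%R <= r%:E)%E by rewrite subr0; exact: cr.
have := Xp_norm_dist p1 (H t Jt) c_; rewrite subr0 => /le_trans; apply.
by rewrite lee_fin addrC lerD2l; exact: small.
Qed.

Let c_inv : inv c.
Proof.
split; first by exists h, c0.
by move=> t _; rewrite subrr Xp_norm0// lee_fin !mulr_ge0.
Qed.

Let inv_cont v : inv v -> {within J, continuous (fun t => f (v t))}.
Proof.
move=> [[h1 [w0 [Xw sv]]] H].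
exact: (lipschitz_continuous p1 maxreg f_lip d0 Xw sv (bounded H)).
Qed.

Let forcing v : inv v -> LpX J (fun t => f (v t) + G t).
Proof.
move=> iv; have fL := continuous_LpX p1 (inv_cont iv).
have := LpX_lin p1 1 mJ fL GL.
by rewrite (_ : (fun t => 1 *: f (v t) + G t) = (fun t => f (v t) + G t))//;
  apply/funext => t; rewrite scale1r.
Qed.

Let step v w := lin J t0 (fun t => f (v t) + G t) u0 w.

Let step_exists v : inv v -> exists w, step v w.
Proof. by move=> iv; exact: (linear_solution_exists p1 maxreg d0 Xu (forcing iv)). Qed.

Let Lip v w m t : J t -> (forall t, J t -> (N (v t - c t)%R <= (2 * eta * W t)%:E)%E) ->
  (forall t, J t -> (N (w t - c t)%R <= (2 * eta * W t)%:E)%E) ->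
  (N (v t - w t)%R <= m%:E)%E -> `|f (v t) - f (w t)| <= L * m.
Proof.
by move=> Jt iv iw vw; apply: HL vw; [exact: (bounded iv Jt)|exact: (bounded iw Jt)].
Qed.

Let half (M : R) : 0 <= M -> C * (M * L / k) <= M / 2.
Proof.
move=> M0; rewrite mulrA ler_pdivrMr//.
have := ler_wpM2l M0 kE; lra.
Qed.

Let step_inv v w : inv v -> step v w ->
  inv w /\ (MR_norm A p J (fun t => w t - c t)%R <= (2 * eta * W (t0 + d))%:E)%E.
Proof.
move=> iv vw; have swc := linear_solutionB p1 vw sc.
have M0 : 0 <= 2 * eta * L by rewrite !mulr_ge0.
have h1L : LpX J (fun t => f (c t) + G t - h t).
  have := LpX_lin p1 (-1) mJ (linear_solution_LpX p1 sc) (forcing c_inv).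
  by rewrite (_ : (fun t => -1 *: h t + (f (c t) + G t)) = (fun t => f (c t) + G t - h t))//;
    apply/funext => t; rewrite scaleN1r addrC.
have hh s : J s -> `|f (v s) + G s - h s - (f (c s) + G s - h s)| <= 2 * eta * L * W s.
  move=> Js; rewrite (_ : _ - _ = f (v s) - f (c s)); last first.
    by rewrite opprB addrA subrK opprD addrA addrAC addrK.
  by apply: le_trans (Lip Js iv.2 c_inv.2 (iv.2 s Js)) _; rewrite mulrCA mulrA.
have [b1 b2] := HC M0 (XpB p1 Xu Xc) swc h1L hh.
have est t : J t -> (C%:E * (N (u0 - c0)%R + lpn p J (fun t => `|f (c t) + G t - h t|)%R +
    (2 * eta * L / k * W t)%:E) <= (2 * eta * W t)%:E)%E.
  move=> Jt; rewrite muleDr//; last first.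
    by apply: ge0_adde_def; rewrite inE ?lee_fin ?mulr_ge0 ?invr_ge0 ?(ltW k0)//;
      apply: adde_ge0; [exact: Xp_norm_ge0|exact: lpn_ge0].
  apply: le_trans (leeD2r _ Heta) _; rewrite -EFinM -EFinD lee_fin.
  have h2 := half (mulr_ge0 (ler0n _ 2) eta0).
  have h3 : C * (2 * eta * L / k * W t) <= eta * W t.
    rewrite mulrA; apply: ler_wpM2r; first exact: W0.
    by apply: le_trans h2 _; rewrite mulrC mulKf.
  apply: le_trans (lerD (ler_peMr eta0 (W1 Jt)) h3) _; lra.
have Jd : J (t0 + d) by rewrite /J /= in_itv/= lexx lerDl ltW.
split; last exact: le_trans b2 (est _ Jd).
split; last by move=> t Jt; exact: le_trans (b1 t Jt) (est t Jt).
by exists (fun t => f (v t) + G t), u0.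
Qed.

Let step_contr v v' w w' m : 0 <= m -> inv v -> inv v' -> step v w -> step v' w' ->
  (forall t, J t -> (N (v t - v' t)%R <= (m * W t)%:E)%E) ->
  forall t, J t -> (N (w t - w' t)%R <= (m / 2 * W t)%:E)%E.
Proof.
move=> m0 iv iv' vw vw' H t Jt; have sww := linear_solutionB p1 vw vw'.
have M0 : 0 <= m * L by rewrite mulr_ge0.
have zL : LpX J (fun=> 0) by apply: (continuous_LpX p1) => x; exact: cst_continuous.
have hh s : J s -> `|f (v s) + G s - (f (v' s) + G s) - 0| <= m * L * W s.
  move=> Js; rewrite subr0 opprD addrACA subrr addr0.
  by apply: le_trans (Lip Js iv.2 iv'.2 (H s Js)) _; rewrite mulrCA mulrA.
have X00 : Xp A p (u0 - u0) by apply: XpB.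
have [b1 _] := HC M0 X00 sww zL hh.
apply: le_trans (b1 t Jt) _; rewrite subrr Xp_norm0// add0e.
have -> : lpn p J (fun=> `|0 : X|) = 0%E by rewrite normr0 lpn0.
rewrite add0e -EFinM lee_fin mulrA; apply: ler_wpM2r; first exact: W0.
exact: half.
Qed.

(** The increments of [f (v_ n)] decay geometrically in X, uniformly in time. The
    solution [v] for their limit [F] is the limit of [v_ n] in X_p by continuity of the
    solution operator, so that [F = f v]. *)
Lemma picard_iteration : exists v, [/\ semilinear_solution d G u0 v,
  forall t, J t -> (N (v t - c t)%R <= (2 * eta * W t)%:E)%E &
  (MR_norm A p J (fun t => v t - c t)%R <= (2 * eta * W (t0 + d))%:E)%E].
Proof.
have /choice[next Hnext] : forall v, exists w, inv v -> step v w.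
  move=> v; have [iv|niv] := pselect (inv v); last by exists c.
  by have [w vw] := step_exists iv; exists w.
pose v_ n := iter n next c.
have iv n : inv (v_ n).
  elim: n => [|n IH]; first exact: c_inv.
  by have [] := step_inv IH (Hnext _ IH).
have vS n : step (v_ n) (v_ n.+1).
  exact: (Hnext _ (iv n)).
have incr n t : J t -> (N (v_ n.+1 t - v_ n t)%R <= (2 * eta / 2 ^+ n * W t)%:E)%E.
  elim: n t => [|n IH] t Jt; first by rewrite expr0 divr1; exact: (iv 1%N).2.
  have m0 : 0 <= 2 * eta / 2 ^+ n by rewrite divr_ge0 ?mulr_ge0 ?exprn_ge0.
  have := step_contr m0 (iv n.+1) (iv n) (vS n.+1) (vS n) IH Jt.
  by rewrite exprSr invfM mulrA.
have fincr n t : J t -> `|f (v_ n.+1 t) - f (v_ n t)| <= L / 2 ^+ n.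
  move=> Jt; apply: le_trans (Lip Jt (iv _).2 (iv _).2 (incr n t Jt)) _.
  apply: ler_wpM2l => //; rewrite mulrAC; apply: ler_piMl (small Jt).
  by rewrite invr_ge0 exprn_ge0.
have /choice[F HF] : forall t, exists l, J t -> forall n, `|l - f (v_ n t)| <= 2 * L / 2 ^+ n.
  move=> t; have [Jt|nJt] := pselect (J t); last by exists 0.
  have [l Hl] := geometric_limit (x := fun n => f (v_ n t)) L0 (fun n => fincr n t Jt).
  by exists l.
have L20 : 0 <= 2 * L by rewrite mulr_ge0.
have cF : {within J, continuous F}.
  apply/within_continuousP => x Jx e e_gt0.
  have e3 : 0 < e / 3 by rewrite divr_gt0.
  have [n Hn] := geometric_small L20 e3.
  have [q q0 Hq] := (within_continuousP _ _).1 (inv_cont (iv n)) x Jx _ e3.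
  exists q => // y Jy yx.
  rewrite -(subrKA (f (v_ n y))) -[f (v_ n y) - F x](subrKA (f (v_ n x))).
  apply: le_trans (ler_normD _ _) _; apply: le_trans (lerD (lexx _) (ler_normD _ _)) _.
  have := HF y Jy n; have := HF x Jx n; rewrite (distrC (F x)).
  by have := Hq y Jy yx; lra.
have FG : LpX J (fun t => F t + G t).
  have := LpX_lin p1 1 mJ (continuous_LpX p1 cF) GL.
  by rewrite (_ : (fun t => 1 *: F t + G t) = (fun t => F t + G t))//;
    apply/funext => t; rewrite scale1r.
have [v sv] := linear_solution_exists p1 maxreg d0 Xu FG.
pose Q := C * (2 * L / k * W (t0 + d)).
have Q0 : 0 <= Q by rewrite /Q !mulr_ge0 ?invr_ge0 ?(ltW k0) ?(ltW C0).
have X00 : Xp A p (u0 - u0) by apply: XpB.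
have zL : LpX J (fun=> 0) by apply: (continuous_LpX p1) => x; exact: cst_continuous.
have dist n t : J t -> (N (v t - v_ n.+1 t)%R <= (Q / 2 ^+ n)%:E)%E.
  move=> Jt; have sww := linear_solutionB p1 sv (vS n).
  have M0 : 0 <= 2 * L / 2 ^+ n by rewrite divr_ge0 ?exprn_ge0.
  have hh s : J s -> `|F s + G s - (f (v_ n s) + G s) - 0| <= 2 * L / 2 ^+ n * W s.
    move=> Js; rewrite subr0 opprD addrACA subrr addr0.
    by apply: le_trans (HF s Js n) _; exact: ler_peMr M0 (W1 Js).
  have [b1 _] := HC M0 X00 sww zL hh.
  apply: le_trans (b1 t Jt) _; rewrite subrr Xp_norm0// add0e.
  have -> : lpn p J (fun=> `|0 : X|) = 0%E by rewrite normr0 lpn0.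
  rewrite add0e -EFinM lee_fin /Q -!mulrA; apply: ler_wpM2l; first exact: ltW.
  rewrite !mulrA [_ / 2 ^+ n * _]mulrAC -!mulrA; do 3 (apply: ler_wpM2l => //).
    by rewrite invr_ge0 ltW.
  rewrite mulrC; apply: ler_wpM2r; first by rewrite invr_ge0 exprn_ge0.
  exact: wle.
have vc t : J t -> (N (v t - c t)%R <= (2 * eta * W t)%:E)%E.
  move=> Jt; apply/lee_addgt0Pr => e e_gt0.
  have [n Hn] := geometric_small Q0 e_gt0.
  apply: le_trans (Xp_norm_dist p1 (dist n t Jt) ((iv n.+1).2 t Jt)) _.
  by rewrite -EFinD lee_fin addrC lerD2l.
have fv t : J t -> F t = f (v t).
  move=> Jt; apply/eqP; rewrite -subr_eq0 -normr_le0; apply/ler_addgt0Pr => e e_gt0.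
  rewrite add0r.
  have LQ0 : 0 <= 2 * L + L * Q by rewrite addr_ge0// mulr_ge0.
  have [n Hn] := geometric_small LQ0 e_gt0.
  have h1 := Lip Jt vc (iv n.+1).2 (dist n t Jt).
  have h2 := HF t Jt n.+1.
  rewrite -(subrKA (f (v_ n.+1 t))); apply: le_trans (ler_normD _ _) _.
  apply: le_trans Hn; rewrite mulrDl -mulrA (distrC (f (v_ n.+1 t))).
  apply: lerD; last by rewrite mulrA in h1 *.
  apply: le_trans h2 _; rewrite -mulrA; do 2 (apply: ler_wpM2l => //).
  by rewrite lef_pV2 ?posrE ?exprn_gt0// ler_eXn2l// ltr1n.
have sem : step v v.
  by apply: linear_solution_eq sv; apply: aeT => t Jt; rewrite fv.
have ivv : inv v by split; [exists (fun t => f (v t) + G t), u0|exact: vc].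
exists v; split; [exact: sem|exact: vc|].
by have [] := step_inv ivv sem.
Qed.

End iteration.
End picard.

(** * Existence near a given function and uniqueness *)

Section wellposed.
Variables (R : realType) (X : completeNormedModType R) (A : linear_operator X) (p t0 : R).
Hypothesis p1 : 1 < p.
Hypothesis maxreg : maximal_regularity A p t0.
Variable f : X -> X.
Hypothesis f_lip : lipschitz_on_bounded_subsets A p f.
Let p0 : 0 < p. Proof. exact: lt_trans p1. Qed.
Local Notation N := (Xp_norm A p).
Local Notation LpX I u := (Lp_mem p I (whole_space X) u).
Local Notation lin := (linear_solution A p).
Local Notation semi := (semilinear_solution A p t0 f).

Local Opaque lint lpn weak_derivative is_weak_derivative.

(** Existence near a given function [c]: when [c] nearly solves the problem, in the sense
    that data and forcing are off by little, a solution exists on the whole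
    interval of [c] and stays close to [c]. *)
Lemma semilinear_near (S r : R) : 0 < S -> exists C M : R, [/\ 0 < C, 1 <= M &
  forall (d eta : R) c h G c0 u0, 0 < d -> d <= S -> Xp A p c0 -> Xp A p u0 ->
  lin `[t0, t0 + d] t0 h c0 c ->
  (forall t, `[t0, t0 + d]%classic t -> (N (c t) <= r%:E)%E) ->
  LpX `[t0, t0 + d] G -> 0 <= eta ->
  (C%:E * (N (u0 - c0)%R + lpn p `[t0, (t0 + d)%R] (fun t => `|f (c t) + G t - h t|)%R)
    <= eta%:E)%E ->
  M * eta <= 1 ->
  exists v, [/\ semi d G u0 v,
    forall t, `[t0, t0 + d]%classic t -> (N (v t - c t)%R <= (M * eta)%:E)%E &
    (MR_norm A p `[t0, (t0 + d)%R] (fun t => v t - c t)%R <= (M * eta)%:E)%E]].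
Proof.
move=> S0; have [C C0 HC] := linear_solution_weighted p1 maxreg S0.
have [L L0 HL] := lipschitz_ball f_lip (r + 1).
pose k := 2 * (C * L) + 1.
have k0 : 0 < k by rewrite ltr_wpDl// mulr_ge0// mulr_ge0// ltW.
have kE : 2 * (C * L) <= k by rewrite lerDl.
have W1 : 1 <= weight p k t0 (t0 + S) by apply: weight_ge1; rewrite // lerDl ltW.
exists C, (2 * weight p k t0 (t0 + S)); split => //; first lra.
move=> d eta c h G c0 u0 d0 dS Xc Xu sc cr GL eta0 Heta eta1.
have wS t : t <= t0 + d -> 2 * eta * weight p k t0 t <= 2 * weight p k t0 (t0 + S) * eta.
  move=> td; rewrite mulrAC; apply: ler_wpM2r => //; apply: ler_wpM2l => //.
  by apply: weight_mono => //; rewrite (le_trans td)// lerD2l.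
have eta1' : 2 * eta * weight p k t0 (t0 + d) <= 1 by apply: le_trans (wS _ (lexx _)) eta1.
have [v [sv vc MRv]] := picard_iteration p1 maxreg f_lip C0 L0 k0 d0
  (fun M h h1 w0 w => HC k d M h h1 w0 w k0 d0 dS) HL kE Xc Xu sc cr GL eta0 Heta eta1'.
exists v; split; [exact: sv| |].
  move=> t Jt; apply: le_trans (vc t Jt) _; rewrite lee_fin; apply: wS.
  by move: Jt; rewrite /= in_itv/= => /andP[].
by apply: le_trans MRv _; rewrite lee_fin; exact: wS.
Qed.

Lemma linear_solution_Xp_bounded (d : R) h u0 v : 0 < d -> Xp A p u0 ->
  lin `[t0, t0 + d] t0 h u0 v ->
  exists r : R, forall t, `[t0, t0 + d]%classic t -> (N (v t) <= r%:E)%E.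
Proof.
move=> d0 X0 sv; have [C C0 H] := linear_solution_bounds p1 maxreg d0.
have [b _] := H _ _ _ _ d0 (lexx d) X0 sv.
have [_ hfin] := (LpXP p1 _ _).1 (linear_solution_LpX p1 sv).
have fin : (N u0 + lpn p `[t0, (t0 + d)%R] (fun t => `|h t|)%R)%E \is a fin_num.
  rewrite ge0_fin_numE; first by apply: lte_add_pinfty; [exact: X0|exact: hfin].
  by apply: adde_ge0; [exact: Xp_norm_ge0|exact: lpn_ge0].
exists (C * fine (N u0 + lpn p `[t0, (t0 + d)%R] (fun t => `|h t|)%R)%E) => t Jt.
rewrite EFinM fineK//; apply: le_trans (b t Jt) _.
apply: lee_wpmul2l; first by rewrite lee_fin ltW.
apply: leeD2l; apply: (lpn_le p0 (fun s => normr_ge0 (h s)) (fun s => normr_ge0 (h s))) => //.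
by apply: subset_itvl; rewrite bnd_simp; move: Jt; rewrite /= in_itv/= => /andP[].
Qed.

(** Both solutions are bounded in X_p, and each application of the contraction halves
    the weighted bound on their distance. *)
Lemma semilinear_unique (d : R) G u0 v w : 0 < d -> Xp A p u0 ->
  semi d G u0 v -> semi d G u0 w ->
  forall t, `[t0, t0 + d]%classic t -> v t = w t.
Proof.
move=> d0 X0 sv sw; pose J : set R := `[t0, t0 + d]%classic.
have [rv Hv] := linear_solution_Xp_bounded d0 X0 sv.
have [rw Hw] := linear_solution_Xp_bounded d0 X0 sw.
pose r := Num.max rv rw.
have {}Hv t : J t -> (N (v t) <= r%:E)%E.
  by move=> Jt; apply: le_trans (Hv t Jt) _; rewrite lee_fin le_max lexx.
have {}Hw t : J t -> (N (w t) <= r%:E)%E.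
  by move=> Jt; apply: le_trans (Hw t Jt) _; rewrite lee_fin le_max lexx orbT.
have [L L0 HL] := lipschitz_ball f_lip r.
have [C C0 HC] := linear_solution_weighted p1 maxreg d0.
pose k := 2 * (C * L) + 1.
have CL : 0 <= C * L by rewrite mulr_ge0// ltW.
have k0 : 0 < k by rewrite ltr_wpDl// mulr_ge0.
have kE : 2 * (C * L) <= k by rewrite lerDl.
move: k k0 kE => k k0 kE.
have Jd : J t0 by rewrite /J /= in_itv/= lexx lerDl ltW.
have r0 : 0 <= r by rewrite -lee_fin; exact: le_trans (Xp_norm_ge0 A p1 _) (Hv t0 Jd).
pose m n := 2 * r / 2 ^+ n.
have m0 n : 0 <= m n by rewrite divr_ge0 ?mulr_ge0 ?exprn_ge0.
have svw := linear_solutionB p1 sv sw.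
have X00 : Xp A p (u0 - u0) by apply: XpB.
have zL : LpX J (fun=> 0) by apply: (continuous_LpX p1) => x; exact: cst_continuous.
have mJ : measurable J by exact: measurable_itv.
have lz : lpn p J (fun=> `|0 : X|) = 0%E by rewrite normr0 lpn0.
have Wt0 t : 0 <= weight p k t0 t by exact: weight_ge0.
have dist n t : J t -> (N (v t - w t)%R <= (m n * weight p k t0 t)%:E)%E.
  elim: n t => [|n IH] t Jt.
    have v0 : (N (v t - 0)%R <= r%:E)%E by rewrite subr0; exact: (Hv t Jt).
    have w0 : (N (0 - w t)%R <= r%:E)%E by rewrite (Xp_normBC A p1) subr0; exact: (Hw t Jt).
    apply: le_trans (Xp_norm_dist p1 v0 w0) _; rewrite lee_fin /m expr0 divr1.
    rewrite (_ : r + r = 2 * r); last by ring.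
    apply: ler_peMr; first by rewrite mulr_ge0.
    by apply: weight_ge1 => //; move: Jt; rewrite /J /= in_itv/= => /andP[].
  have M0 : 0 <= m n * L by rewrite mulr_ge0.
  have hh s : J s -> `|f (v s) + G s - (f (w s) + G s) - 0| <= m n * L * weight p k t0 s.
    move=> Js; rewrite subr0 opprD addrACA subrr addr0.
    by apply: le_trans (HL _ _ _ (Hv s Js) (Hw s Js) (IH s Js)) _; rewrite mulrCA mulrA.
  have [b _] := HC k d _ _ _ _ _ k0 d0 (lexx d) M0 X00 svw zL hh.
  apply: le_trans (b t Jt) _; rewrite subrr Xp_norm0// add0e lz add0e -EFinM lee_fin mulrA.
  apply: ler_wpM2r; first exact: Wt0.
  rewrite (_ : m n.+1 = m n / 2); last by rewrite /m exprSr invfM mulrA.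
  rewrite mulrA ler_pdivrMr//.
  by move: (m n) (m0 n) => q q0; have := ler_wpM2l q0 kE; lra.
have dist0 t : J t -> (N (v t - w t)%R <= 0%:E)%E.
  move=> Jt; apply/lee_addgt0Pr => e e0; rewrite add0e.
  have Q0 : 0 <= 2 * r * weight p k t0 t by rewrite mulr_ge0 ?mulr_ge0.
  have [n Hn] := geometric_small Q0 e0.
  by apply: le_trans (dist n t Jt) _; rewrite lee_fin /m mulrAC.
have fE t : J t -> f (v t) = f (w t).
  move=> Jt; apply/eqP; rewrite -subr_eq0 -normr_le0.
  by have := HL _ _ _ (Hv t Jt) (Hw t Jt) (dist0 t Jt); rewrite mulr0.
apply: (linear_solution_unique p1 maxreg d0 X0 sv).
by apply: linear_solution_eq sw; apply: aeT => t Jt; rewrite fE.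
Qed.

End wellposed.

(** * The oscillating forcing *)

Section ereal_limit.
Variable R : realType.

Lemma cvge0P (u : nat -> \bar R) : (forall n, (0 <= u n)%E) ->
  (u @ \oo --> 0%E <-> forall e : R, 0 < e -> \forall n \near \oo, (u n <= e%:E)%E).
Proof.
move=> u0; split=> [/fine_cvgP[ufin] /cvgrPdist_le H e e0|H].
  near=> n.
  have un : u n \is a fin_num by near: n; exact: ufin.
  rewrite -(fineK un) lee_fin; have : `|0 - fine (u n)| <= e by near: n; exact: H.
  by rewrite sub0r normrN ger0_norm// fine_ge0.
apply/fine_cvgP; split.
  near=> n; rewrite ge0_fin_numE//; apply: (@le_lt_trans _ _ 1%:E); last exact: ltry.
  by near: n; exact: H.
apply/cvgrPdist_le => e e0; near=> n.
rewrite sub0r normrN /= ger0_norm ?fine_ge0// -lee_fin.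
have ue : (u n <= e%:E)%E by near: n; exact: H.
by rewrite fineK// ge0_fin_numE// (le_lt_trans ue)// ltry.
Unshelve. all: by end_near. Qed.

End ereal_limit.

Section gluing.
Variables (R : realType) (X : completeNormedModType R).
Local Notation mu := (@lebesgue_measure R).

Lemma smeas_ae_sub (D E : set R) (f : R -> X) : {ae mu, forall t, D t -> E t} ->
  smeas E f -> smeas D f.
Proof.
move=> DE /smeasP[s ss sf]; apply/smeasP; exists s => //.
by apply: aeS2 DE sf => t DE sf /DE.
Qed.

(** Strong measurability is local. The approximating simple functions take their
    values from those of the first set that contains the point, among finitely many
    sets whose number grows along the sequence. *)
Lemma smeas_bigcup (F : nat -> set R) (f : R -> X) : (forall k, measurable (F k)) ->
  (forall k, smeas (F k) f) -> smeas (\bigcup_k F k) f.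
Proof.
move=> mF Ff.
have /choice[s Hs] : forall k, exists s : nat -> R -> X, (forall j, fsimple (s j)) /\
    {ae mu, forall t, F k t -> (fun j => s j t) @ \oo --> f t}.
  by move=> k; have /smeasP[s ss sf] := Ff k; exists s.
pose glue (j : nat) := fix glue (m k : nat) (t : R) : X :=
  if m is m'.+1 then if t \in F k then s k j t else glue m' k.+1 t else 0.
have glue_simple j m : forall k, fsimple (glue j m k).
  elim: m => [|m IH] k /=; first exact: fsimple_cst.
  apply: (fsimple_comp2 (fun (b : bool) (z : X * X) => if b then z.1 else z.2)
    (r := fun t => (s k j t, glue j m k.+1 t))).
    exact: fsimple_mem.
  by apply: fsimple_pair; [exact: (Hs k).1|exact: IH].
have glueE j m : forall k k0 t, (k <= k0 < k + m)%N -> F k0 t ->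
    (forall i, (k <= i < k0)%N -> ~ F i t) -> glue j m k t = s k0 j t.
  elim: m => [|m IH] k k0 t /andP[kk0 k0m] Ft nF /=.
    by move: k0m; rewrite addn0 ltnNge kk0.
  move: kk0; rewrite leq_eqVlt => /predU1P[->|kk0]; first by rewrite mem_set.
  rewrite memNset; last by apply: nF; rewrite leqnn.
  apply: IH => //; first by rewrite kk0 addSnnS.
  by move=> i /andP[ki ik]; apply: nF; rewrite ik ltnW.
apply/smeasP; exists (fun j => glue j j 0%N); first by move=> j; exact: glue_simple.
have all_ae : {ae mu, forall t, forall k, F k t -> (fun j => s k j t) @ \oo --> f t}.
  have := @ae_countable R nat setT (fun k t => F k t -> (fun j => s k j t) @ \oo --> f t).
  move=> /(_ (countableP _) (fun k _ => (Hs k).2)).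
  by apply: aeS => t H k; exact: H.
apply: aeS all_ae => t H [k _ Ft].
have exk : exists k, t \in F k by exists k; exact: mem_set.
pose k0 := ex_minn exk.
have [F0 min0] : F k0 t /\ forall i, F i t -> (k0 <= i)%N.
  by rewrite /k0; case: ex_minnP => m /set_mem Fm Hm; split => // i Fi; apply/Hm/mem_set.
have E : \forall j \near \oo, s k0 j t = glue j j 0%N t.
  near=> j; apply/esym/glueE => //.
    by rewrite add0n leq0n /=; near: j; exact: nbhs_infty_gt.
  by move=> i /andP[_ ik] /min0; rewrite leqNgt ik.
apply: cvg_trans (H k0 F0).
by apply: near_eq_cvg.
Unshelve. all: by end_near. Qed.

Lemma smeas_affine (a b : R) (D : set R) (f : R -> X) : 0 < a -> smeas D f ->
  smeas ((fun t => a * t + b) @^-1` D) (fun t => f (a * t + b)).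
Proof.
move=> a0 /smeasP[s ss sf]; apply/smeasP; exists (fun k t => s k (a * t + b)).
  move=> k; split.
    by apply: (sub_finite_set _ (ss k).1) => _ [t _ <-]; exists (a * t + b).
  move=> z; have := measurable_affine a b measurableT ((ss k).2 z).
  by rewrite setTI comp_preimage.
by have := ae_affine b a0 sf.
Qed.

End gluing.

Section oscillation.
Variables (R : realType) (X : completeNormedModType R) (p t0 rho : R) (g : R -> X).
Hypothesis p1 : 1 < p.
Hypothesis t0_ge0 : 0 <= t0.
Hypothesis g_loc : Lploc_mem p g.
Hypothesis g_decay : forall S : R, 0 < S ->
  ((fun n : nat => ((n%:R * S)^-1 `^ (1 - rho))%:E *
     \int[lebesgue_measure]_(s in `[(n%:R * t0)%R, (n%:R * t0 + n%:R * S)%R])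
       ((`|g s| `^ p)%R%:E))%E @ \oo --> 0%E).
Let p0 : 0 < p. Proof. exact: lt_trans p1. Qed.
Local Notation LpX I u := (Lp_mem p I (whole_space X) u).

Let decay (S : R) : 0 < S ->
  (fun n : nat => ((n%:R * S)^-1 `^ (1 - rho))%:E *
    lint `[(n%:R * t0)%R, (n%:R * t0 + n%:R * S)%R] (fun s => `|g s| `^ p)%R)%E @ \oo --> 0%E.
Proof. by move=> S0; exact: g_decay. Qed.

Let lpnE (D : set R) (h : R -> R) : lpn p D h = (lint D (fun t => h t `^ p)%R `^ p^-1)%E.
Proof. by []. Qed.

Local Opaque lint lpn.

Definition oscillating_forcing (n : nat) (t : R) : X := n%:R `^ (rho / p) *: g (n%:R * t).

Let g_smeas (a b : R) : 0 <= a -> smeas `[a, b] g.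
Proof.
move=> a0; pose F k : set R := `[k.+1%:R^-1, b]%classic.
apply: (@smeas_ae_sub _ _ _ (\bigcup_k F k)); last first.
  apply: smeas_bigcup => [k|k]; first exact: measurable_itv.
  have [kb|bk] := leP k.+1%:R^-1 b.
    by have [] := g_loc (_ : 0 < k.+1%:R^-1 :> R) kb; rewrite // invr_gt0.
  rewrite /F set_itv_ge ?bnd_simp -?ltNge//.
  by apply: (smeas_eq (g := fun=> 0)); [exact: aeT|exact: smeas0].
exists [set 0]; split; [exact: measurable_set1|exact: lebesgue_measure_set1|].
move=> t /= /not_implyP[]; rewrite in_itv/= => /andP[at_ tb] nF; apply: contrapT => tn0; apply: nF.
have t0' : 0 < t by rewrite lt_neqAle eq_sym (le_trans a0 at_) andbT; apply/eqP.
exists (Num.truncn t^-1) => //; rewrite /F /= in_itv/= tb andbT.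
by rewrite invf_ple ?posrE// ltW// truncnS_gt.
Qed.

Let window n (S : R) : set R := `[n%:R * t0, n%:R * t0 + n%:R * S]%classic.

Let g_window n (S : R) : (0 < n)%N -> 0 < S -> LpX (window n S) g.
Proof.
move=> n0 S0; have nR : 0 < n%:R :> R by rewrite ltr0n.
have nS : 0 < n%:R * S by rewrite mulr_gt0.
have [t00|t0p] := leP t0 0; last first.
  by apply: g_loc; [rewrite mulr_gt0|rewrite lerDl ltW].
have t0E : t0 = 0 by apply/eqP; rewrite eq_le t00.
apply/(LpXP p1); split; first by apply: g_smeas; rewrite mulr_ge0// ltW.
apply/lpn_lty => //.
(* If [t0 = 0], integrability near 0 comes from the decay hypothesis: the integral over
   some larger window is finite. *)
have [m mn mfin] : exists2 m, (n <= m)%N & (lint (window m S) (fun s => `|g s| `^ p)%R < +oo)%E.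
  have near1 : \forall m \near \oo, (((m%:R * S)^-1 `^ (1 - rho))%:E *
      lint (window m S) (fun s => `|g s| `^ p)%R < 1)%E.
    have half0 : 0 < 2^-1 :> R by rewrite invr_gt0.
    near=> m; apply: (@le_lt_trans _ _ (2^-1)%:E); last by rewrite lte_fin invf_lt1// ltr1n.
    near: m; apply: (cvge0P _).1 half0; last exact: decay.
    by move=> m; apply: mule_ge0; [rewrite lee_fin powR_ge0|apply: lint_ge0 => t; exact: powR_ge0].
  have [m _ Hm] : \forall m \near \oo, (n <= m)%N /\ (((m%:R * S)^-1 `^ (1 - rho))%:E *
      lint (window m S) (fun s => `|g s| `^ p)%R < 1)%E.
    by near=> m; split; near: m; [exact: nbhs_infty_ge|exact: near1].
  have [nm lt1] := Hm _ (leqnn m); exists m => //.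
  rewrite ltNge leye_eq; apply/negP => /eqP E; move: lt1; rewrite E.
  have q0 : (0 < ((m%:R * S)^-1 `^ (1 - rho))%:E)%E.
    by rewrite lte_fin powR_gt0// invr_gt0 mulr_gt0// ltr0n; exact: leq_trans nm.
  by rewrite (gt0_muley q0) ltNge leey.
apply: le_lt_trans mfin; apply: lint_le => [t|t||t _]//; try exact: powR_ge0.
rewrite /window t0E !mulr0 !add0r; apply: subset_itvl; rewrite bnd_simp.
by rewrite ler_wpM2r ?(ltW S0)// ler_nat.
Unshelve. all: by end_near. Qed.

Let pre_window n (S : R) : (0 < n)%N ->
  (fun t => n%:R * t + 0) @^-1` window n S = `[t0, t0 + S]%classic.
Proof.
move=> n0; have nR : 0 < n%:R :> R by rewrite ltr0n.
apply/seteqP; split => t; rewrite /window /= !in_itv/= addr0 -mulrDr !ler_pM2l//.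
Qed.

Let lint_forcing n (S : R) : (0 < n)%N -> 0 < S ->
  lint `[t0, (t0 + S)%R] (fun t => `|oscillating_forcing n t| `^ p)%R =
  ((S `^ (1 - rho))%:E * (((n%:R * S)^-1 `^ (1 - rho))%:E *
    lint (window n S) (fun s => `|g s| `^ p)%R))%E.
Proof.
move=> n0 S0; have nR : 0 < n%:R :> R by rewrite ltr0n.
have [gm _] := (LpXP p1 _ _).1 (g_window n0 S0).
have mw : measurable (window n S) by exact: measurable_itv.
have ag : aem (window n S) (fun s => `|g s| `^ p).
  by apply: aem_powR; exact: smeas_norm_aem.
have gp0 (s : R) : 0 <= `|g s| `^ p by exact: powR_ge0.
have := lint_affine 0 nR mw gp0 ag; rewrite pre_window// => E.
have ag' : aem `[t0, t0 + S] (fun t => `|g (n%:R * t + 0)| `^ p).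
  apply: aem_powR; apply: smeas_norm_aem; first exact: measurable_itv.
  by rewrite -(pre_window S n0); exact: smeas_affine.
have -> : (fun t => `|oscillating_forcing n t| `^ p) =
    (fun t => n%:R `^ rho * `|g (n%:R * t + 0)| `^ p).
  apply/funext => t; rewrite /oscillating_forcing normrZ addr0 ger0_norm ?powR_ge0//.
  by rewrite powRM ?powR_ge0// -powRrM divfK ?gt_eqF.
have mI : measurable (`[t0, t0 + S]%classic : set R) by exact: measurable_itv.
rewrite (lintZ mI (powR_ge0 _ _) (fun t => gp0 _) ag') E !muleA -!EFinM; congr (_%:E * _)%E.
rewrite invfM powRM ?invr_ge0 ?(ltW nR) ?(ltW S0)// mulrCA -powRM ?invr_ge0 ?(ltW S0)//.
rewrite mulfV ?gt_eqF// powR1 mulr1 -powR_inv1 ?ler0n// -powRrM -powRD; last first.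
  by rewrite (gt_eqF nR)/= implybT.
by congr (_ `^ _); ring.
Qed.

Lemma oscillating_forcing_LpX n (S : R) : (0 < n)%N -> 0 < S ->
  LpX `[t0, t0 + S] (oscillating_forcing n).
Proof.
move=> n0 S0; have nR : 0 < n%:R :> R by rewrite ltr0n.
have [gm gfin] := (LpXP p1 _ _).1 (g_window n0 S0).
apply/(LpXP p1); split.
  have h := smeas_affine 0 nR gm; rewrite pre_window// in h.
  have := smeasZ (n%:R `^ (rho / p)) h.
  by congr smeas; apply/funext => t; rewrite addr0.
apply/lpn_lty => //; rewrite lint_forcing//.
have {}gfin : (lint (window n S) (fun s => `|g s| `^ p)%R < +oo)%E by exact/lpn_lty.
by apply: lte_mul_pinfty; rewrite ?lee_fin ?powR_ge0//;
  apply: lte_mul_pinfty; rewrite ?lee_fin ?powR_ge0.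
Qed.

(** The substitution [s = n t] turns the decay hypothesis into smallness in L^p. *)
Lemma oscillating_forcing_cvg0 (S : R) : 0 < S ->
  (fun n => lpn p `[t0, (t0 + S)%R] (fun t => `|oscillating_forcing n t|)%R) @ \oo --> 0%E.
Proof.
move=> S0.
apply/cvge0P => [n|e e0]; first exact: lpn_ge0.
have S1 : 0 < S `^ (1 - rho) by rewrite powR_gt0.
pose e' := e `^ p / S `^ (1 - rho).
have e'0 : 0 < e' by rewrite divr_gt0// powR_gt0.
have small : \forall n \near \oo, (((n%:R * S)^-1 `^ (1 - rho))%:E *
    lint (window n S) (fun s => `|g s| `^ p)%R <= e'%:E)%E.
  apply: (cvge0P _).1 e'0; last exact: decay.
  by move=> m; apply: mule_ge0; [rewrite lee_fin powR_ge0|apply: lint_ge0 => t; exact: powR_ge0].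
near=> n.
have n0 : (0 < n)%N by near: n; exact: nbhs_infty_gt.
have sm : (((n%:R * S)^-1 `^ (1 - rho))%:E *
    lint (window n S) (fun s => `|g s| `^ p)%R <= e'%:E)%E by near: n; exact: small.
have le : (lint `[t0, (t0 + S)%R] (fun t => `|oscillating_forcing n t| `^ p)%R <= (e `^ p)%:E)%E.
  rewrite lint_forcing//.
  apply: (@le_trans _ _ ((S `^ (1 - rho))%:E * e'%:E)%E).
    by apply: lee_wpmul2l; rewrite ?lee_fin ?powR_ge0.
  by rewrite -EFinM lee_fin /e' mulrCA mulfV ?gt_eqF// mulr1.
rewrite lpnE; apply: le_trans (poweR_le _ _ le) _; first by rewrite invr_ge0 ltW.
  by apply: lint_ge0 => t; exact: powR_ge0.
by rewrite poweR_EFin -powRrM mulfV ?gt_eqF// powRr1// ltW.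
Unshelve. all: by end_near. Qed.

End oscillation.

(** * Maximal solutions and stability *)

Section local.
Variables (R : realType) (X : completeNormedModType R) (A : linear_operator X) (p t0 : R).
Hypothesis p1 : 1 < p.
Hypothesis maxreg : maximal_regularity A p t0.
Variable f : X -> X.
Hypothesis f_lip : lipschitz_on_bounded_subsets A p f.
Local Notation mu := (@lebesgue_measure R).
Let p0 : 0 < p. Proof. exact: lt_trans p1. Qed.
Local Notation N := (Xp_norm A p).
Local Notation LpX I u := (Lp_mem p I (whole_space X) u).
Local Notation lin := (linear_solution A p).
Local Notation semi := (semilinear_solution A p t0 f).

Local Opaque lint lpn weak_derivative is_weak_derivative.

Lemma real_between (x : R) (T : \bar R) : (x%:E < T)%E -> exists S, x < S /\ (S%:E < T)%E.
Proof.
case: T => [r| |//]; last by exists (x + 1); rewrite ltrDl ltry.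
by rewrite lte_fin => xr; exists ((x + r) / 2); rewrite lte_fin; split; lra.
Qed.

Lemma lee_real_lt (x y : \bar R) : (forall r : R, (r%:E < x)%E -> (r%:E <= y)%E) -> (x <= y)%E.
Proof.
case: x => [x| |] H; last exact: leNye.
  by apply/lee_subgt0Pr => e e0; apply: H; rewrite lte_fin ltrBlDr ltrDl.
by rewrite leye_eq; apply/eqP/eqyP => r r0; apply: H; exact: ltry.
Qed.

Lemma limn_esup_ge (u : nat -> \bar R) (x : \bar R) : (\forall n \near \oo, (x <= u n)%E) ->
  (x <= limn_esup u)%E.
Proof.
move=> H; apply: le_ereal_inf_tmp => _ [V FV <-].
have [n [xu Vn]] := filter_ex (filterI H FV).
by apply: le_trans xu _; apply: ereal_sup_ubound; exists n.
Qed.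

Lemma MR_mem_eq (a b : R) (c : bool) (u v : R -> X) :
  (forall t, [set` Interval (BLeft a) (BSide c b)] t -> u t = v t) ->
  MR_mem A p [set` Interval (BLeft a) (BSide c b)] v ->
  MR_mem A p [set` Interval (BLeft a) (BSide c b)] u /\
  MR_norm A p [set` Interval (BLeft a) (BSide c b)] u =
  MR_norm A p [set` Interval (BLeft a) (BSide c b)] v.
Proof.
set I := [set` _] => uv mv; have [Lv vd Lvd Gv] := MR_memP p1 mv.
have uv' : {ae mu, forall t, I t -> u t = v t} by apply: aeT.
have vu' : {ae mu, forall t, I t -> v t = u t} by apply: aeT => t It; rewrite uv.
have ud : is_weak_derivative I u (weak_derivative I v).
  by apply: (is_weak_derivative_eq vu' _ vd); apply: aeT.
split; last first.
  by apply: (@MR_norm_eq _ _ A p _ _ _ uv); exact: (@weak_derivativeE _ _ a b c _ _ ud).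
apply: (MR_memI (LpX_eq p1 uv' Lv) ud Lvd).
have [Gs Gfin] := (LpAP A p1 I v).1 Gv; apply/(LpAP A p1); split.
  have [s [s1 s2]] := Gs; exists s; split => //.
  by apply: aeS s2 => t st It; rewrite uv//; exact: st.
by rewrite (lpn_eq_ae p (g := fun t => `|v t| + `|A (v t)|))//; apply: aeT => t It; rewrite uv.
Qed.

Lemma semilinear_sub (d d' : R) G u0 v : d' <= d -> semi d G u0 v -> semi d' G u0 v.
Proof.
move=> dd; apply: (linear_solution_sub p1).
by apply: subset_itvl; rewrite bnd_simp lerD2l.
Qed.

(** Local existence: on a short interval the solution of the linear problem with
    forcing [G] nearly solves the semilinear problem. *)
Lemma semilinear_local_existence G u0 : LpX `[t0, t0 + 1] G -> Xp A p u0 ->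
  exists2 d : R, 0 < d & exists v, semi d G u0 v.
Proof.
move=> GL X0; have [c sc] := linear_solution_exists p1 maxreg ltr01 X0 GL.
have [r cr] := linear_solution_Xp_bounded p1 maxreg ltr01 X0 sc.
have [C [M [C0 M1 H]]] := semilinear_near p1 maxreg f_lip r ltr01.
have M0 : 0 < M by exact: lt_le_trans M1.
have fL := continuous_LpX p1 (lipschitz_continuous p1 maxreg f_lip ltr01 X0 sc cr).
have [fm ffin] := (LpXP p1 _ _).1 fL.
have mJ : measurable (`[t0, t0 + 1]%classic : set R) by exact: measurable_itv.
have e0 : 0 < M^-1 / C by rewrite divr_gt0// invr_gt0.
have [q q0 Hq] := lpn_small_interval p1 t0 mJ (fun t => normr_ge0 (f (c t)))
  (smeas_norm_aem mJ fm) ffin e0.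
pose d := Num.min q 1.
have d0 : 0 < d by rewrite lt_min q0 ltr01.
have d1 : d <= 1 by rewrite ge_min lexx orbT.
have dq : d <= q by rewrite ge_min lexx.
have sub : [set` Interval (BLeft t0) (BSide false (t0 + d))] `<=`
    [set` Interval (BLeft t0) (BSide false (t0 + 1))].
  by apply: subset_itvl; rewrite bnd_simp lerD2l.
exists d => //.
have sc' := linear_solution_sub p1 sub sc.
have eta0 : 0 <= M^-1 by rewrite invr_ge0 ltW.
have small : (C%:E * (N (u0 - u0)%R + lpn p `[t0, (t0 + d)%R]
    (fun t => `|f (c t) + G t - G t|)%R) <= M^-1%:E)%E.
  have -> : (fun t => `|f (c t) + G t - G t|) = (fun t => `|f (c t)|).
    by apply/funext => t; rewrite addrK.
  rewrite subrr (Xp_norm0 A p1) add0e.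
  apply: (@le_trans _ _ (C%:E * (M^-1 / C)%:E)%E); last first.
    by rewrite -EFinM lee_fin mulrC divfK// gt_eqF.
  apply: lee_wpmul2l; first by rewrite lee_fin ltW.
  apply: le_trans Hq; apply: (lpn_le p0 (fun t => normr_ge0 (f (c t))) (fun t => normr_ge0 (f (c t)))) => //.
  move=> t Jt; split; first exact: sub.
  by move: Jt; rewrite /= !in_itv/= => /andP[t1 t2]; apply/andP; split; lra.
have MM : M * M^-1 <= 1 by rewrite mulfV// gt_eqF.
have [v [sv _ _]] := H d M^-1 c G G u0 u0 d0 d1 X0 X0 sc'
  (fun t Jt => cr t (sub t Jt)) (LpX_sub p1 sub GL) eta0 small MM.
by exists v.
Qed.

Section maximal.
Variables (F : R -> X -> X) (G : R -> X) (u0 : X) (T : \bar R) (phi : R -> X).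
Hypothesis FE : forall t x, t0 <= t -> Xp A p x -> F t x = f x + G t.
Hypothesis X0 : Xp A p u0.
Hypothesis phi_max : maximal_solution A p t0 T F u0 phi.

Let lin_forcing_eq (d : R) h h' v : 0 < d ->
  (forall t, t0 <= t -> Xp A p (v t) -> h t = h' t) ->
  lin `[t0, t0 + d] t0 h u0 v -> lin `[t0, t0 + d] t0 h' u0 v.
Proof.
move=> d0 hh' sv; apply: linear_solution_eq (sv); apply: aeT => t Jt.
have [r Hr] := linear_solution_Xp_bounded p1 maxreg d0 X0 sv.
apply: hh'; first by move: Jt; rewrite /= in_itv/= => /andP[].
exact: le_lt_trans (Hr t Jt) (ltry _).
Qed.

Lemma maximal_semilinear (d : R) : 0 < d -> (d%:E < T)%E -> semi d G u0 phi.
Proof.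
move=> d0 dT; have [_ /(_ d d0 dT) s _] := phi_max.
by apply: (lin_forcing_eq d0 _ s) => t tt Xt; exact: FE.
Qed.

Lemma maximal_agree (d : R) v t : 0 < d -> semi d G u0 v -> t0 <= t -> t <= t0 + d ->
  (t%:E < t0%:E + T)%E -> v t = phi t.
Proof.
move=> d0 sv t1 t2 tT.
have tT' : ((t - t0)%:E < T)%E.
  by move: tT; case: (T) => [r| |//]; rewrite ?ltry// -EFinD !lte_fin ltrBlDl.
have [S [tS ST]] := real_between tT'.
pose d' := Num.min S d.
have d'0 : 0 < d' by rewrite lt_min d0 andbT; apply: le_lt_trans tS; rewrite subr_ge0.
have d'd : d' <= d by rewrite ge_min lexx orbT.
have d'T : (d'%:E < T)%E by apply: le_lt_trans ST; rewrite lee_fin ge_min lexx.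
apply: (semilinear_unique p1 maxreg f_lip d'0 X0 (semilinear_sub d'd sv)
  (maximal_semilinear d'0 d'T)).
by rewrite /= in_itv/= t1 -lerBlDl le_min (ltW tS)/= lerBlDl.
Qed.

(** Otherwise [v] would extend the maximal solution. *)
Lemma maximal_time (d : R) v : 0 < d -> semi d G u0 v -> (d%:E <= T)%E.
Proof.
move=> d0 sv; rewrite leNgt; apply/negP => Td.
have [_ _ /(_ d%:E v Td)] := phi_max; apply.
  move=> d' d'0; rewrite lte_fin => d'd.
  apply: (lin_forcing_eq d'0 _ (semilinear_sub (ltW d'd) sv)) => t tt Xt.
  by rewrite FE.
move=> t [t1 tT]; apply: (maximal_agree d0 sv t1 _ tT).
rewrite -lee_fin EFinD; apply: le_trans (ltW tT) _.
by apply: leeD2l; exact: ltW.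
Qed.

Lemma maximal_time_gt0 : LpX `[t0, t0 + 1] G -> (0 < T)%E.
Proof.
move=> GL; have [d d0 [v sv]] := semilinear_local_existence GL X0.
by apply: lt_le_trans (maximal_time d0 sv); rewrite lte_fin.
Qed.

End maximal.

(** The limit solution [c] solves the perturbed problem up to an error given by
    [u n - c0] and [G n]. *)
Lemma semilinear_stability (S e : R) (G : nat -> R -> X) (c : R -> X) (u : nat -> X) (c0 : X) :
  0 < S -> 0 < e -> Xp A p c0 -> (forall n, Xp A p (u n)) ->
  semi S (fun=> 0) c0 c ->
  (forall n, (0 < n)%N -> LpX `[t0, t0 + S] (G n)) ->
  (fun n => N (u n - c0)) @ \oo --> 0%E ->
  (fun n => lpn p `[t0, (t0 + S)%R] (fun t => `|G n t|)) @ \oo --> 0%E ->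
  \forall n \near \oo, exists v, [/\ semi S (G n) (u n) v,
    forall t, `[t0, t0 + S]%classic t -> (N (v t - c t)%R <= e%:E)%E &
    (MR_norm A p `[t0, (t0 + S)%R] (fun t => v t - c t)%R <= e%:E)%E].
Proof.
move=> S0 e0 Xc Xu sc GL ucvg Gcvg.
have [r cr] := linear_solution_Xp_bounded p1 maxreg S0 Xc sc.
have [C [M [C0 M1 H]]] := semilinear_near p1 maxreg f_lip r S0.
have M0 : 0 < M by exact: lt_le_trans M1.
pose e' := Num.min e 1.
have e'0 : 0 < e' by rewrite lt_min e0 ltr01.
pose eta := e' / M.
have eta0 : 0 < eta by rewrite divr_gt0.
have q0 : 0 < eta / C / 2 by rewrite !divr_gt0.
have Mee : M * eta = e' by rewrite /eta mulrC divfK// gt_eqF.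
near=> n.
have n0 : (0 < n)%N by near: n; exact: nbhs_infty_gt.
have un : (N (u n - c0)%R <= (eta / C / 2)%:E)%E.
  by near: n; apply: (cvge0P _).1 q0; [move=> n; exact: Xp_norm_ge0|exact: ucvg].
have Gn : (lpn p `[t0, (t0 + S)%R] (fun t => `|G n t|)%R <= (eta / C / 2)%:E)%E.
  by near: n; apply: (cvge0P _).1 q0; [move=> n; exact: lpn_ge0|exact: Gcvg].
have small : (C%:E * (N (u n - c0)%R + lpn p `[t0, (t0 + S)%R]
    (fun t => `|f (c t) + G n t - (f (c t) + 0)|)%R) <= eta%:E)%E.
  have -> : (fun t => `|f (c t) + G n t - (f (c t) + 0)|) = (fun t => `|G n t|).
    by apply/funext => t; rewrite addr0 addrC addKr.
  apply: (@le_trans _ _ (C%:E * (eta / C)%:E)%E); last first.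
    by rewrite -EFinM lee_fin mulrC divfK// gt_eqF.
  apply: lee_wpmul2l; first by rewrite lee_fin ltW.
  by rewrite (splitr (eta / C)) EFinD; exact: leeD.
have M1' : M * eta <= 1 by rewrite Mee ge_min lexx orbT.
have [v [sv vc MRv]] := H S eta c _ (G n) c0 (u n) S0 (lexx S) Xc (Xu n) sc cr (GL n n0)
  (ltW eta0) small M1'.
have le_e : ((M * eta)%:E <= e%:E)%E by rewrite Mee lee_fin ge_min lexx.
exists v; split; [exact: sv| |exact: le_trans MRv le_e].
by move=> t Jt; exact: le_trans (vc t Jt) le_e.
Unshelve. all: by end_near. Qed.

End local.

(** * The theorem *)

Lemma MR_norm_ge0 (R : realType) (X : completeNormedModType R) (A : linear_operator X)
  (p : R) (I : set R) u : (0 <= MR_norm A p I u)%E.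
Proof. by rewrite /MR_norm /W1p_norm !adde_ge0// /Lp_norm poweR_ge0. Qed.

Local Opaque lint lpn weak_derivative is_weak_derivative.

Theorem theorem3p3 (R : realType) (X : completeNormedModType R) (p : R)
    (A : linear_operator X) (t0 : R)
    (fn : nat -> R -> X -> X) (f : X -> X) (rho : R) (g : R -> X)
    (u0 : nat -> X) (T : nat -> \bar R) (phi : nat -> R -> X)
    (hp : 1 < p)
    (A_closed : closed_operator A)
    (A_dense : densely_defined A)
    (t0_ge0 : 0 <= t0)
    (A_maxreg : maximal_regularity A p t0)
    (f_lip : lipschitz_on_bounded_subsets A p f)
    (f0E : forall t x, 0 <= t -> Xp A p x -> fn 0%N t x = f x)
    (rho_01 : 0 < rho < 1)
    (g_loc : Lploc_mem p g)
    (fnE : forall n t x, (0 < n)%N -> 0 <= t -> Xp A p x ->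
       fn n t x = f x + n%:R `^ (rho / p) *: g (n%:R * t))
    (g_decay : forall S : R, 0 < S ->
       ((fun n : nat => ((n%:R * S)^-1 `^ (1 - rho))%:E *
           \int[lebesgue_measure]_(s in `[(n%:R * t0)%R, (n%:R * t0 + n%:R * S)%R])
             ((`|g s| `^ p)%R%:E))%E @ \oo --> 0%E))
    (u0_Xp : forall n, Xp A p (u0 n))
    (u0_cvg : (fun n => Xp_norm A p (u0 n - u0 0%N)) @ \oo --> 0%E)
    (phi_sol : forall n, maximal_solution A p t0 (T n) (fn n) (u0 n) (phi n)) :
  [/\ forall n, (0 < T n)%E,
      (T 0%N <= limn_esup T)%E
    & forall a b : R, t0 <= a -> a <= b -> (b%:E < t0%:E + T 0%N)%E ->
      [/\ \forall n \near \oo,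
            `[a, b] `<=` time_interval t0 (T n) /\
            MR_mem A p `[a, b] (fun t => phi n t - phi 0%N t),
          (fun n => ereal_sup
             [set Xp_norm A p (phi n t - phi 0%N t) | t in `[a, b]]) @ \oo
            --> 0%E
        & (fun n => MR_norm A p `[a, b] (fun t => phi n t - phi 0%N t)) @ \oo
            --> 0%E]].
Proof.
have p1 := hp.
pose G n := if n is 0%N then fun=> (0 : X) else oscillating_forcing p rho g n.
have FE n t x : t0 <= t -> Xp A p x -> fn n t x = f x + G n t.
  move=> tt Xx; have t_ge0 := le_trans t0_ge0 tt.
  by case: n => [|n]; [rewrite f0E// addr0|rewrite fnE].
have GE n : (0 < n)%N -> G n = oscillating_forcing p rho g n by case: n.
have GL n (S : R) : 0 < S -> Lp_mem p `[t0, t0 + S] (whole_space X) (G n).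
  move=> S0; case: n => [|n].
    by apply: (continuous_LpX p1) => x; exact: cst_continuous.
  exact: (oscillating_forcing_LpX p1 t0_ge0 g_loc g_decay).
have T_gt0 n : (0 < T n)%E.
  exact: (maximal_time_gt0 p1 A_maxreg f_lip (FE n) (u0_Xp n) (phi_sol n) (GL n 1 ltr01)).
have key (S : R) : 0 < S -> (S%:E < T 0%N)%E -> forall e : R, 0 < e ->
    \forall n \near \oo, (S%:E <= T n)%E /\ exists v,
      [/\ semilinear_solution A p t0 f S (G n) (u0 n) v,
      forall t, `[t0, t0 + S]%classic t -> (Xp_norm A p (v t - phi 0%N t)%R <= e%:E)%E &
      (MR_norm A p `[t0, (t0 + S)%R] (fun t => v t - phi 0%N t)%R <= e%:E)%E].
  move=> S0 ST e e0.
  have s0 := maximal_semilinear p1 A_maxreg (FE 0%N) (u0_Xp 0%N) (phi_sol 0%N) S0 ST.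
  have Gcvg : (fun n => lpn p `[t0, (t0 + S)%R] (fun t => `|G n t|)) @ \oo --> 0%E.
    apply/cvge0P => [n|e' e'0]; first exact: lpn_ge0.
    have H := oscillating_forcing_cvg0 p1 t0_ge0 g_loc g_decay S0.
    apply: filterS2 (nbhs_infty_gt 0) ((cvge0P (fun n => lpn_ge0 _ _ _)).1 H e' e'0) => n n0.
    by rewrite (GE n n0).
  have stab := semilinear_stability p1 A_maxreg f_lip S0 e0 (u0_Xp 0%N) u0_Xp s0
    (fun n _ => GL n S S0) u0_cvg Gcvg.
  apply: filterS stab => n [v [sv vc MRv]]; split; last by exists v.
  exact: (maximal_time p1 A_maxreg f_lip (FE n) (u0_Xp n) (phi_sol n) S0 sv).
split; [exact: T_gt0| |].
  apply: lee_real_lt => r rT.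
  have [S [rS ST]] : exists S, Num.max r 0 < S /\ (S%:E < T 0%N)%E.
    by apply: real_between; rewrite /Num.max; case: ifP.
  move: rS; rewrite gt_max => /andP[rS S0].
  apply: limn_esup_ge; apply: filterS (key S S0 ST 1 ltr01) => n [SnT _].
  by apply: le_trans SnT; rewrite lee_fin ltW.
move=> a b t0a ab bT.
have bT' : ((b - t0)%:E < T 0%N)%E.
  by move: bT; case: (T 0%N) => [r| |//]; rewrite ?ltry// -EFinD !lte_fin ltrBlDl.
have [S [bS ST]] := real_between bT'.
have S0 : 0 < S by apply: le_lt_trans bS; rewrite subr_ge0 (le_trans t0a).
have bS' : b < t0 + S by rewrite -ltrBlDl.
have abS : [set` Interval (BLeft a) (BSide false b)] `<=`
    [set` Interval (BLeft t0) (BSide false (t0 + S))].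
  by apply: subset_itv; rewrite bnd_simp// ltW.
have main (e : R) : 0 < e -> \forall n \near \oo,
    [/\ `[a, b] `<=` time_interval t0 (T n),
        MR_mem A p `[a, b] (fun t => phi n t - phi 0%N t),
        forall t, `[a, b]%classic t -> (Xp_norm A p (phi n t - phi 0%N t)%R <= e%:E)%E &
        (MR_norm A p `[a, b] (fun t => phi n t - phi 0%N t)%R <= e%:E)%E].
  move=> e0; apply: filterS (key S S0 ST e e0) => n [SnT [v [sv vc MRv]]].
  have inT t : `[a, b]%classic t -> [/\ t0 <= t, t <= t0 + S & (t%:E < t0%:E + T n)%E].
    rewrite /= in_itv/= => /andP[at_ tb]; have tS := le_lt_trans tb bS'.
    split; [exact: le_trans at_|exact: ltW|].
    by apply: (@lt_le_trans _ _ (t0 + S)%:E); [rewrite lte_fin|rewrite EFinD leeD2l].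
  have vE t : `[a, b]%classic t -> v t = phi n t.
    move=> /inT[t1 t2 tT].
    exact: (maximal_agree p1 A_maxreg f_lip (FE n) (u0_Xp n) (phi_sol n) S0 sv t1 t2 tT).
  have s0 := maximal_semilinear p1 A_maxreg (FE 0%N) (u0_Xp 0%N) (phi_sol 0%N) S0 ST.
  have [_ mv _ _] := linear_solutionB p1 sv s0.
  have dE t : `[a, b]%classic t -> phi n t - phi 0%N t = v t - phi 0%N t.
    by move=> It; rewrite vE.
  have [mn nE] := @MR_mem_eq _ _ A p p1 a b false (fun t => phi n t - phi 0%N t)
    (fun t => v t - phi 0%N t) dE (MR_mem_sub p1 abS mv).
  split; [by move=> t /inT[t1 _ tT]; split|exact: mn| |].
    by move=> t It; rewrite (dE t It); exact: (vc t (abS t It)).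
  by rewrite nE; exact: le_trans (MR_norm_sub p1 abS mv) MRv.
split.
- by apply: filterS (main 1 ltr01) => n [].
- apply/cvge0P => [n|e e0].
    apply: le_trans (Xp_norm_ge0 A p1 (phi n a - phi 0%N a)) _.
    by apply: ereal_sup_ubound; exists a => //=; rewrite in_itv/= lexx.
  by apply: filterS (main e e0) => n [_ _ H _]; apply: ge_ereal_sup => _ [t It <-]; exact: H.
- apply/cvge0P => [n|e e0]; first exact: MR_norm_ge0.
  by apply: filterS (main e e0) => n [].
Qed.
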